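(* Let $d\ge 1$ be a fixed integer and let $Y_t=\mu_t+\varepsilon_t$, $t=1,\dots,n$, where $\{\varepsilon_t\}$ is a mean zero stationary process, $\nabla^d\mu_t=\gamma_t$ with $\{\gamma_t\}$ i.i.d. with mean zero and variance $\tau^2/n^{2d-1}$ for a fixed constant $\tau>0$, and the error process $\{\varepsilon_t\}$ is independent of $\{\gamma_t\}$ (and of the trend $\mu$). Let $\rho_\varepsilon(j)$ be the lag-$j$ autocovariance of $\{\varepsilon_t\}$, assume $\sum_{1\le j<\infty}j|\rho_\varepsilon(j)|<\infty$, let $g_\varepsilon(u)=\sum_{-\infty<j<\infty}\rho_\varepsilon(j)e^{iju}$ and assume $g_\varepsilon(0)>0$. Let $\hat\mu(\nu)$ be the penalized least squares estimate of $\mu$ with difference order $d$ and penalty parameter $\nu>0$, and let $D(\nu)=E\|\hat\mu(\nu)-\mu\|^2/n$. Put $$c_1=\frac{g_\varepsilon(0)\,\mathrm{Beta}(1/(2d),2-1/(2d))}{2d\pi},\qquad c_2=\frac{\tau^2\,\mathrm{Beta}(1+1/(2d),1-1/(2d))}{2d\pi}.$$ If $\nu=\nu_n$ satisfies $\nu\to\infty$ and $\nu/n^{2d}\to0$ as $n\to\infty$, then $$D(\nu)=\left[c_1\nu^{-1/(2d)}+c_2\,\nu^{1-1/(2d)}n^{-2d+1}\right](1+o(1)).$$ Moreover, as $n\to\infty$, $D(\nu)$ is minimized over $\nu>0$ at $$\nu^*=n^{2d-1}(2d-1)^{-1}(c_1/c_2)(1+o(1)),$$ and the smallest mean square error is $$D(\nu^*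 )=n^{-(2d-1)/(2d)}\,c_3\,(1+o(1)),\qquad c_3=c_1(c_2/c_1)^{1/(2d)}\,2d\,(2d-1)^{-1+1/(2d)}.$$
   Context: $\nabla$ is the backward difference operator, $\nabla x_t=x_t-x_{t-1}$, and $\nabla^d$ its $d$-th iterate; the relation $\nabla^d\mu_t=\gamma_t$ is used for $t=d+1,\dots,n$. Equivalently, $\mu_t$ is the sum of a polynomial in $t$ of degree at most $d-1$ (with coefficients fixed or random) and $\sum_{1\le j\le t}(-1)^{t-j}\binom{-d}{t-j}\gamma_j$. The law of the error process $\{\varepsilon_t\}$ does not depend on $n$. $\|\cdot\|$ is the Euclidean norm on $\mathbb{R}^n$, prime denotes transpose, and $\mathrm{Beta}(a,b)=\int_0^1 x^{a-1}(1-x)^{b-1}\,dx$. The penalized least squares estimate $\hat\mu(\nu)$ is the minimizer over $\mu\in\mathbb{R}^n$ of $\sum_{1\le t\le n}(Y_t-\mu_t)^2+\nu\sum_{d+1\le t\le n}(\nabla^d\mu_t)^2$. Explicitly, let $S_{-d}$ be the $n\times n$ lower triangular matrix with $(t,j)$ entry $(-1)^{t-j}\binom{d}{t-j}$ for $t\ge j$ (and $0$ for $t<j$), and let $\overline S_{-d}$ be the $(n-d)\times n$ matrix obtained by deleting its first $d$ rows; then $\hat\mu(\nu)=(I+\nu\,\overline S_{-d}'\overline S_{-d})^{-1}Y$ with $Y=(Y_1,\dots,Y_n)'$. *)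

(* Defs.v *)
From HB Require Import structures.
From mathcomp Require Import all_boot all_order all_algebra.
From mathcomp Require Import all_classical all_reals all_analysis.
Set Implicit Arguments.
Unset Strict Implicit.
Unset Printing Implicit Defensive.
Import Order.TTheory GRing.Theory Num.Theory.
Import numFieldNormedType.Exports.
Local Open Scope classical_set_scope.
Local Open Scope ring_scope.

Section Processes.
Context {d : measure_display} {T : measurableType d} {R : realType}.
Variable P : probability T R.
Implicit Types (X Y : nat -> {RV P >-> R}) (I J : pred nat) (s : seq nat).

Definition cylinder X s (B : nat -> set R) : set T :=
  \bigcap_(t in [set` s]) (X t @^-1` B t).

Definition mutually_independent I X : Prop :=
  forall s (B : nat -> set R), uniq s -> all I s ->
    (forall t, measurable (B t)) ->
    P (cylinder X s B) = (\prod_(t <- s) P (X t @^-1` B t))%E.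

(* The finite-dimensional product rule below says that the sigma-algebras
   generated by (X_t)_{t in I} and (Y_t)_{t in J} are independent, since
   cylinders form a pi-system generating them. *)
Definition independent_processes I X J Y : Prop :=
  forall s s' (B C : nat -> set R), all I s -> all J s' ->
    (forall t, measurable (B t)) -> (forall t, measurable (C t)) ->
    P (cylinder X s B `&` cylinder Y s' C) =
    (P (cylinder X s B) * P (cylinder Y s' C))%E.

Definition iid I X : Prop :=
  mutually_independent I X /\
  forall t t', I t -> I t' -> forall B : set R, measurable B ->
    P (X t @^-1` B) = P (X t' @^-1` B).

(* Second-order stationarity: rho j is the lag-j autocovariance. *)
Definition mean_zero_stationary X (rho : int -> R) : Prop :=
  [/\ forall t, (X t : T -> R) \in Lfun P 2%:E,
      forall t, ('E_P[X t] = 0)%E &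
      forall t t', covariance P (X t) (X t') = (rho (t%:Z - t'%:Z))%:E].

Definition mean_zero_variance I X (v : R) : Prop :=
  forall t, I t ->
    [/\ (X t : T -> R) \in Lfun P 2%:E, ('E_P[X t] = 0)%E & ('V_P[X t] = v%:E)%E].

End Processes.

Definition same_law {d d' : measure_display} {T : measurableType d}
    {T' : measurableType d'} {R : realType} {P : probability T R}
    {P' : probability T' R}
    (X : nat -> {RV P >-> R}) (X' : nat -> {RV P' >-> R}) : Prop :=
  forall (s : seq nat) (B : nat -> set R), (forall t, measurable (B t)) ->
    P (cylinder X s B) = P' (cylinder X' s B).

Section Deterministic.
Context {R : realType}.

(* The two-sided series is summed symmetrically; since rho is even, the terms
   j and -j of sum_j rho(j) e^{iju} combine into their cosine parts. *)
Definition spectral_function (rho : int -> R) (u : R) : R :=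
  limn (fun N : nat => \sum_(i < N.*2.+1)
    rho (i%:Z - N%:Z) * cos ((i%:Z - N%:Z)%:~R * u)).

Definition Beta (a b : R) : R :=
  \int[lebesgue_measure]_(x in `[0, 1]) (x `^ (a - 1) * (1 - x) `^ (b - 1)).

(* Only used at t >= 1, so that the truncation of t.-1 at 0 is harmless. *)
Definition nabla (x : nat -> R) (t : nat) : R := x t - x t.-1.

(* Coordinates of a vector of R^n numbered from 1: coord x t is x_t for
   1 <= t <= n. Other values of t are not used. *)
Definition coord n (x : 'cV[R]_n) (t : nat) : R :=
  if insub t.-1 is Some i then x i 0 else 0.

(* Squared Euclidean norm; the library norm on matrices is the sup norm. *)
Definition sq_norm n (x : 'cV[R]_n) : R := \sum_i x i 0 ^+ 2.

Definition pls_criterion (d n : nat) (nu : R) (y m : 'cV[R]_n) : R :=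
  \sum_(1 <= t < n.+1) (coord y t - coord m t) ^+ 2 +
  nu * \sum_(d.+1 <= t < n.+1) (iter d nabla (coord m) t) ^+ 2.

(* For nu > 0 the criterion is strictly convex and coercive, hence has exactly
   one minimizer; the default value 0 is then never taken. *)
Definition pls_estimate (d n : nat) (nu : R) (y : 'cV[R]_n) : 'cV[R]_n :=
  xget 0 [set m | forall m', pls_criterion d nu y m <= pls_criterion d nu y m'].

Definition c1 (d : nat) (g0 : R) : R :=
  g0 * Beta ((2 * d)%:R^-1) (2 - (2 * d)%:R^-1) / ((2 * d)%:R * pi).

Definition c2 (d : nat) (tau : R) : R :=
  tau ^+ 2 * Beta (1 + (2 * d)%:R^-1) (1 - (2 * d)%:R^-1) / ((2 * d)%:R * pi).

Definition c3 (d : nat) (g0 tau : R) : R :=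
  c1 d g0 * (c2 d tau / c1 d g0) `^ ((2 * d)%:R^-1) * (2 * d)%:R *
  ((2 * d)%:R - 1) `^ (-1 + (2 * d)%:R^-1).

(* u_n = v_n (1 + o(1)); in particular u_n is finite for n large. *)
Definition eq_1o1 (u : nat -> \bar R) (v : nat -> R) : Prop :=
  exists r : nat -> R, r @ \oo --> (0 : R) /\
    \forall n \near \oo, u n = (v n * (1 + r n))%:E.

Definition minimizer_gt0 (f : R -> \bar R) (x : R) : Prop :=
  0 < x /\ forall y, 0 < y -> (f x <= f y)%E.

End Deterministic.

Section Risk.
Context {disp : measure_display} {T : measurableType disp} {R : realType}.
Variable P : probability T R.

Definition vec (n : nat) (X : nat -> {RV P >-> R}) (w : T) : 'cV[R]_n :=
  \col_(i < n) X i.+1 w.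

Definition mean_sq_error (d n : nat) (mu eps : nat -> {RV P >-> R}) (nu : R)
    : \bar R :=
  ('E_P[fun w => sq_norm
      (pls_estimate d nu (vec n mu w + vec n eps w) - vec n mu w)]
   * (n%:R^-1)%:E)%E.

End Risk.

(* Main.v *)
(* With H = (I + nu S'S)^-1, S the reduced d-th difference matrix, the risk is
     n D(nu) = tr(H^2 Cov eps) + tau^2 n^(1-2d) nu tr(H - H^2).
   S'S differs from the Gram matrix of the cyclic d-th difference by d rank-one terms.
   By the Sherman-Morrison formula each of them moves the traces by a bounded amount,
   so H may be replaced by a circulant matrix, whose eigenvalues are
   1 / (1 + nu (2 sin(pi k / n))^(2d)).  Only frequencies k = o(n) matter; there the
   Fejer means of the spectral density are close to its value at 0.  With nu = b^(2d) the
   traces, multiplied by b / n, become Riemann sums of monotone functions built from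
   1 / (1 + v^(2d)), and v^(2d) / (1 + v^(2d)) = x turns the limit integrals into Beta
   integrals.
   At nu = (z r_n)^(2d) with r_n = n^((2d-1)/(2d)), r_n D(nu) tends to C1 / z + C2 z^(2d-1).
   The variance decreases and the bias increases with nu up to O(1) corrections, so
   minimizers have z in a fixed compact interval, on which the limit has a unique
   minimum with a quadratic gap. *)
Require Import Defs.
From HB Require Import structures.
From mathcomp Require Import all_boot all_order all_algebra.
From mathcomp Require Import all_classical all_reals all_analysis.
From mathcomp Require Import measurable_realfun lebesgue_measure.
From mathcomp Require Import ring lra zify.
Set Implicit Arguments.
Unset Strict Implicit.
Unset Printing Implicit Defensive.
Import Order.TTheory GRing.Theory Num.Theory.
Import numFieldNormedType.Exports.
Local Open Scope classical_set_scope.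
Local Open Scope ring_scope.

(** * Resolvents of positive semidefinite matrices *)

Section QuadraticForms.
Context {R : realFieldType} {n : nat}.
Implicit Types (A M S : 'M[R]_n) (x y w a : 'cV[R]_n).

(** The trace limits hold only along sequences with b -> infinity and b / n -> 0, whereas a
    minimizer may a priori be any nu > 0. Monotonicity bridges this: it bounds the risk on a whole
    half-line by a value at one scale where the limits apply. The bias is monotone for the exact
    smoother, by the resolvent identity. The covariance matrix need not commute with the penalty, so
    the variance is compared with its cyclic version, a combination of decreasing weights with
    nonnegative coefficients.

    A rank-one term w w' has bounded cost although w carries a factor sqrt(nu): its correction to H
    is c a a' with a = H w, c = 1 / (1 + w'Hw), and c |a|^2 <= 1 because H^2 <= H. Multiplied by b /
    n this vanishes; in the bias it is nu times a bounded number, against a trace of order nu n / b.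

    The first moment of rho gives a Fejer error of order 1/n + sin(pi k / n). One filter weight
    absorbs b sin(pi k / n), which turns that error into a relative O(1/b). *)

Definition bform M x y : R := (x^T *m M *m y) 0 0.

Definition psd M : Prop := M^T = M /\ forall x, 0 <= bform M x x.

Lemma bformE M x y : bform M x y = \sum_i \sum_j x i 0 * y j 0 * M i j.
Proof.
rewrite /bform mxE exchange_big/=; apply: eq_bigr => j _.
rewrite !mxE mulr_suml; apply: eq_bigr => i _; rewrite !mxE; ring.
Qed.

Lemma bform1E x y : bform 1%:M x y = \sum_i x i 0 * y i 0.
Proof.
by rewrite /bform mulmx1 mxE; apply: eq_bigr => i _; rewrite !mxE.
Qed.

Lemma bform1_ge0 x : 0 <= bform 1%:M x x.
Proof. by rewrite bform1E sumr_ge0// => i _; rewrite -expr2 sqr_ge0. Qed.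

Lemma bform1_eq0 x : bform 1%:M x x = 0 -> x = 0.
Proof.
rewrite bform1E => /eqP; rewrite psumr_eq0 => [/allP h|i _]; last first.
  by rewrite -expr2 sqr_ge0.
apply/colP => i; rewrite mxE; apply/eqP.
by have := h i (mem_index_enum _); rewrite /= -expr2 sqrf_eq0.
Qed.

Lemma bformDl M x1 x2 y : bform M (x1 + x2) y = bform M x1 y + bform M x2 y.
Proof. by rewrite /bform linearD/= !mulmxDl mxE. Qed.

Lemma bformDr M x y1 y2 : bform M x (y1 + y2) = bform M x y1 + bform M x y2.
Proof. by rewrite /bform mulmxDr mxE. Qed.

Lemma bformDm M1 M2 x y : bform (M1 + M2) x y = bform M1 x y + bform M2 x y.
Proof. by rewrite /bform mulmxDr mulmxDl mxE. Qed.

Lemma bformZm c M x y : bform (c *: M) x y = c * bform M x y.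
Proof. by rewrite /bform -scalemxAr -scalemxAl mxE. Qed.

Lemma bformZl c M x y : bform M (c *: x) y = c * bform M x y.
Proof. by rewrite /bform linearZ/= -!scalemxAl mxE. Qed.

Lemma bformZr c M x y : bform M x (c *: y) = c * bform M x y.
Proof. by rewrite /bform -scalemxAr mxE. Qed.

Lemma bformMl M A x y : bform M (A *m x) y = bform (A^T *m M) x y.
Proof. by rewrite /bform trmx_mul !mulmxA. Qed.

Lemma bformMr M A x y : bform M x (A *m y) = bform (M *m A) x y.
Proof. by rewrite /bform !mulmxA. Qed.

Lemma bformC M x y : M^T = M -> bform M x y = bform M y x.
Proof.
move=> h; rewrite /bform -[in LHS](trmxK (_ *m y)) mxE.
by rewrite trmx_mul trmx_mul trmxK h mulmxA.
Qed.

Lemma bform_tr M x y : bform M x y = \tr (M *m (y *m x^T)).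
Proof. by rewrite mulmxA mxtrace_mulC mulmxA trace_mx11. Qed.

Lemma psd1 : psd 1%:M.
Proof. split; [by rewrite trmx1 | exact: bform1_ge0]. Qed.

Lemma psd_gram S : psd (S^T *m S).
Proof.
split; first by rewrite trmx_mul trmxK.
by move=> x; rewrite -bformMr -(mulmx1 S^T) -bformMl bform1_ge0.
Qed.

Lemma psdZ c M : 0 <= c -> psd M -> psd (c *: M).
Proof.
move=> c0 [hs hp]; split; first by rewrite linearZ/= hs.
by move=> x; rewrite bformZm mulr_ge0.
Qed.

Lemma psdD M A : psd M -> psd A -> psd (M + A).
Proof.
move=> [h1 p1] [h2 p2]; split; first by rewrite linearD/= h1 h2.
by move=> x; rewrite bformDm addr_ge0.
Qed.

Lemma psd_outer w : psd (w *m w^T).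
Proof.
split; first by rewrite trmx_mul trmxK.
move=> x; rewrite /bform mulmxA -mulmxA mxE big_ord1.
rewrite -[w^T *m x]trmxK trmx_mul trmxK [X in _ * X]mxE.
by rewrite -expr2 sqr_ge0.
Qed.

(** The diagonal entries are the values of the form of [M] at the rows of [A]. *)
Lemma tr_conj_ge0 A M : psd M -> 0 <= \tr (A *m M *m A^T).
Proof.
move=> [_ hp]; rewrite /mxtrace sumr_ge0// => i _.
suff -> : (A *m M *m A^T) i i = bform M (row i A)^T (row i A)^T by [].
by rewrite /bform trmxK -row_mul tr_row !mxE; apply: eq_bigr => j _; rewrite !mxE.
Qed.

End QuadraticForms.

(** * Resolvents and their rank-one updates *)

Section Resolvent.
Context {R : realFieldType} {n : nat}.
Implicit Types (A M S H : 'M[R]_n) (x y w a : 'cV[R]_n).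

Definition resolvent A : 'M[R]_n := invmx (1%:M + A).

Lemma unit_1D_psd A : psd A -> 1%:M + A \in unitmx.
Proof.
move=> [hs hp]; rewrite -row_free_unit; apply: inj_row_free => v hv.
suff : v^T = 0 by move=> /(congr1 trmx); rewrite trmxK trmx0.
apply: bform1_eq0; apply/eqP; rewrite eq_le bform1_ge0 andbT.
have : bform (1%:M + A) v^T v^T = 0 by rewrite /bform trmxK hv mul0mx mxE.
by rewrite bformDm; have := hp v^T; lra.
Qed.

Lemma resolventK A : psd A -> resolvent A *m (1%:M + A) = 1%:M.
Proof. by move=> h; rewrite mulVmx// unit_1D_psd. Qed.

Lemma resolventVK A : psd A -> (1%:M + A) *m resolvent A = 1%:M.
Proof. by move=> h; rewrite mulmxV// unit_1D_psd. Qed.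

Lemma resolvent_eq A H : psd A -> (1%:M + A) *m H = 1%:M -> H = resolvent A.
Proof.
move=> h e; rewrite -[H]mul1mx -(resolventK h) -mulmxA e mulmx1 //.
Qed.

Lemma trmx_resolvent A : psd A -> (resolvent A)^T = resolvent A.
Proof. by move=> [hs _]; rewrite /resolvent trmx_inv linearD/= trmx1 hs. Qed.

Lemma resolvent_sub_sqr A : psd A ->
  resolvent A - resolvent A *m resolvent A = resolvent A *m A *m resolvent A.
Proof.
move=> h; set H := resolvent A.
have : H *m (1%:M + A) *m H = H by rewrite resolventK// mul1mx.
by rewrite mulmxDr mulmx1 mulmxDl => /(canRL (addKr _)) ->; rewrite addrC.
Qed.

Lemma psd_resolvent A : psd A -> psd (resolvent A).
Proof.
move=> h; split; first exact: trmx_resolvent.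
move=> x; set H := resolvent A.
have -> : H = H^T *m (1%:M + A) *m H.
  by rewrite trmx_resolvent// resolventK// mul1mx.
by rewrite -bformMr -bformMl bformDm addr_ge0 ?bform1_ge0//; case: h.
Qed.

(** The difference of the two forms is that of H - H^2 = H A H, a congruence of [A]. *)
Lemma resolvent_sqr_le A x : psd A ->
  bform 1%:M (resolvent A *m x) (resolvent A *m x) <= bform (resolvent A) x x.
Proof.
move=> h; rewrite bformMr bformMl mul1mx trmx_resolvent//.
rewrite -subr_ge0.
have -> (M N : 'M[R]_n) : bform M x x - bform N x x = bform (M - N) x x.
  by rewrite bformDm -(scaleN1r N) bformZm mulN1r.
rewrite resolvent_sub_sqr// -{1}(trmx_resolvent h) -bformMr -bformMl.
by case: h.
Qed.

(** With z = H x one has x = z + A z, and the cross term z'Az in |x|^2 is nonnegative. *)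
Lemma resolvent_contraction A x : psd A ->
  bform 1%:M (resolvent A *m x) (resolvent A *m x) <= bform 1%:M x x.
Proof.
move=> h; set z := resolvent A *m x.
have -> : x = z + A *m z by rewrite -{1}(mul1mx z) -mulmxDl mulmxA resolventVK// mul1mx.
rewrite !(bformDl, bformDr) ?(bformC (A *m z) z (trmx1 _ _)) // bformMr mul1mx.
case: (h) => _ /(_ z); have := bform1_ge0 (A *m z); lra.
Qed.

(** Sherman-Morrison with a = H w and c = 1 / (1 + w'Hw). The bound on c |a|^2 follows from |H w|^2
    <= w'Hw and is uniform in the size of [w]. *)
Lemma resolvent_rank1 A w : psd A ->
  exists (c : R) a, [/\ 0 <= c, c * bform 1%:M a a <= 1 &
    resolvent A = resolvent (A + w *m w^T) + c *: (a *m a^T)].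
Proof.
move=> h; set H := resolvent A.
set q := bform H w w.
have q0 : 0 <= q by have [_] := psd_resolvent h; apply.
have q1 : 0 < 1 + q by rewrite ltr_pwDl.
have HT : H^T = H by exact: trmx_resolvent.
exists (1 + q)^-1, (H *m w); split; first by rewrite invr_ge0 ltW.
  rewrite ler_pdivrMl// mulr1; apply: le_trans (resolvent_sqr_le _ h) _.
  by rewrite -/q lerDr.
apply/eqP; rewrite -subr_eq; apply/eqP.
apply: (resolvent_eq (psdD h (psd_outer w))).
rewrite trmx_mul HT addrA [LHS]mulmxDl [X in X + _]mulmxDr resolventVK//.
rewrite mulmxN -scalemxAr !mulmxA resolventVK// mul1mx.
rewrite mulmxDr mulmxN -scalemxAr !mulmxA.
have -> : w *m w^T *m H *m w *m w^T *m H = q *: (w *m w^T *m H).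
  have e : w^T *m H *m w = q%:M by rewrite [LHS]mx11_scalar.
  have e' (X : 'rV_n) : w^T *m (H *m (w *m X)) = q *: X.
    by rewrite !mulmxA e mul_scalar_mx.
  by rewrite -!mulmxA e' -scalemxAr.
set V := w *m w^T *m H.
rewrite scalerA -addrA -[RHS]addr0; congr (_ + _).
rewrite addrA [_ + V]addrC -addrA -opprD -scalerDl.
have -> : (1 + q)^-1 + (1 + q)^-1 * q = 1 by field; rewrite gt_eqF.
by rewrite scale1r subrr.
Qed.

(** Writing G = H - c a a' for the updated resolvent, the difference of traces is 2c M(a, Ha) - c^2
    |a|^2 M(a, a). Since |Ha| <= |a| and c |a|^2 <= 1, the two terms are at most 4s and 2s. *)
Lemma resolvent_rank1_trace (s : R) A w M : psd A -> M^T = M -> 0 <= s ->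
  (forall x y, `|bform M x y| <= s * (bform 1%:M x x + bform 1%:M y y)) ->
  `|\tr (resolvent A *m resolvent A *m M) -
    \tr (resolvent (A + w *m w^T) *m resolvent (A + w *m w^T) *m M)| <= 6 * s.
Proof.
move=> h hM s0 hs; have [c [a [c0 ca eH]]] := resolvent_rank1 w h.
set H := resolvent A in eH *; set G := resolvent _ in eH *.
have eG : G = H - c *: (a *m a^T) by rewrite eH addrK.
have HT : H^T = H by exact: trmx_resolvent.
set q := bform 1%:M a a in ca.
have eqa : a^T *m a = q%:M by rewrite [LHS]mx11_scalar /q /bform mulmx1.
have -> : \tr (H *m H *m M) - \tr (G *m G *m M) =
   2 * c * bform M a (H *m a) - c ^+ 2 * q * bform M a a.
  rewrite [bform M a (H *m a)]bform_tr [bform M a a]bform_tr.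
  have -> : \tr (M *m (H *m a *m a^T)) = \tr (H *m a *m a^T *m M).
    by rewrite mxtrace_mulC.
  have e2 : \tr (a *m a^T *m H *m M) = \tr (H *m a *m a^T *m M).
    rewrite -mxtrace_tr !trmx_mul trmxK hM HT mulmxA mxtrace_mulC mulmxA.
    by rewrite mxtrace_mulC !mulmxA.
  have -> : \tr (M *m (a *m a^T)) = \tr (a *m a^T *m M).
    by rewrite mxtrace_mulC.
  have e3 : a *m a^T *m (a *m a^T) = q *: (a *m a^T).
    by rewrite -mulmxA (mulmxA a^T) eqa mul_scalar_mx -scalemxAr.
  have -> : G *m G *m M = H *m H *m M - c *: (H *m a *m a^T *m M)
      - c *: (a *m a^T *m H *m M) + (c ^+ 2 * q) *: (a *m a^T *m M).
    rewrite eG; set Pa := a *m a^T in e3 *.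
    rewrite mulmxBl !mulmxBr -!scalemxAl -!scalemxAr e3.
    rewrite !mulmxBl -!scalemxAl !scalerA /Pa !mulmxA opprB addrA.
    by rewrite [RHS]addrAC -expr2.
  rewrite mxtraceD (linearB mxtrace)/= (linearB mxtrace)/= !mxtraceZ e2; ring.
have Ha := resolvent_contraction a h.
have q0 : 0 <= q := bform1_ge0 _.
have Ha0 := bform1_ge0 (H *m a).
have b1 := hs a (H *m a). have b2 := hs a a.
rewrite -/H -/q in Ha b1 b2.
apply: le_trans (ler_normB _ _) _.
rewrite (normrM (2 * c)) ger0_norm ?mulr_ge0// (normrM (c ^+ 2 * q)).
rewrite (@ger0_norm _ (c ^+ 2 * q)) ?mulr_ge0 ?sqr_ge0//.
have cq0 : 0 <= c * q by exact: mulr_ge0.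
have cq2 : (c * q) ^+ 2 <= 1 by rewrite expr_le1.
have l1 : 2 * c * `|bform M a (H *m a)| <= 4 * s * (c * q).
  have -> : 4 * s * (c * q) = 2 * c * (s * (q + q)) by ring.
  apply: ler_wpM2l; first by rewrite mulr_ge0.
  by apply: le_trans b1 _; rewrite ler_wpM2l// lerD2l.
have l2 : c ^+ 2 * q * `|bform M a a| <= 2 * s * (c * q) ^+ 2.
  have -> : 2 * s * (c * q) ^+ 2 = c ^+ 2 * q * (s * (q + q)) by ring.
  by apply: ler_wpM2l b2; rewrite mulr_ge0// sqr_ge0.
nra.
Qed.

(** The difference of the traces is exactly c |a|^2. *)
Lemma resolvent_rank1_trace1 A w : psd A ->
  `|\tr (resolvent A) - \tr (resolvent (A + w *m w^T))| <= 1.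
Proof.
move=> h; have [c [a [c0 ca ->]]] := resolvent_rank1 w h.
rewrite mxtraceD addrC addKr mxtraceZ mxtrace_mulC trace_mx11.
by rewrite -(mulmx1 a^T) -/(bform 1%:M a a) ger0_norm ?mulr_ge0 ?bform1_ge0.
Qed.

End Resolvent.

(** * The smoother as a function of the penalty parameter *)

Section Ridge.
Context {R : realFieldType} {n : nat}.
Implicit Types (S : 'M[R]_n) (x y m : 'cV[R]_n) (nu mu : R).

Definition ridge S nu : 'M[R]_n := resolvent (nu *: (S^T *m S)).

Lemma psd_penalty S nu : 0 <= nu -> psd (nu *: (S^T *m S)).
Proof. by move=> nu0; apply: psdZ => //; exact: psd_gram. Qed.

(** With A and B the two resolvents and Y = A S'S B, expanding A (1 + mu S'S) B and A (1 + nu S'S) B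
    gives A = AB + mu Y and B = AB + nu Y; in nu A - mu B the terms in Y cancel. Commutation,
    monotonicity of the bias and continuity in [nu] all come from this identity. *)
Lemma ridge_resolvent_identity S nu mu : 0 < mu -> 0 < nu ->
  nu *: ridge S nu - mu *: ridge S mu =
  (nu - mu) *: (ridge S nu *m ridge S mu).
Proof.
move=> m0 n0; set A := ridge S nu; set B := ridge S mu.
have eA : A *m (1%:M + nu *: (S^T *m S)) = 1%:M.
  by apply: resolventK; apply: psd_penalty; exact: ltW.
have eB : (1%:M + mu *: (S^T *m S)) *m B = 1%:M.
  by apply: resolventVK; apply: psd_penalty; exact: ltW.
have h1 : A = A *m B + mu *: (A *m (S^T *m S) *m B).
  by rewrite -{1}(mulmx1 A) -eB mulmxA mulmxDr mulmx1 mulmxDl -scalemxAr -scalemxAl.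
have h2 : B = A *m B + nu *: (A *m (S^T *m S) *m B).
  by rewrite -{1}(mul1mx B) -eA mulmxDr mulmx1 mulmxDl -scalemxAr -scalemxAl.
set X := A *m B in h1 h2 *; set Y := A *m _ *m B in h1 h2.
have -> : nu *: A - mu *: B = nu *: (X + mu *: Y) - mu *: (X + nu *: Y).
  by rewrite -h1 -h2.
rewrite !scalerDr !scalerA (mulrC mu nu) opprD addrACA subrr addr0.
by rewrite -scalerBl.
Qed.

(** Exchanging [nu] and [mu] changes the sign of both the left side and the coefficient of the
    resolvent identity. *)
Lemma ridge_comm S nu mu : 0 < mu -> 0 < nu ->
  ridge S nu *m ridge S mu = ridge S mu *m ridge S nu.
Proof.
move=> m0 n0; have [->//|/eqP ne] := eqVneq nu mu.
have ne0 : nu - mu != 0 by rewrite subr_eq0; apply/eqP.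
have e1 := ridge_resolvent_identity S m0 n0.
have e2 := ridge_resolvent_identity S n0 m0.
apply: (scalerI ne0); rewrite -e1 -opprB e2 -scaleNr opprB //.
Qed.

(** Here H - H^2 = H (nu S'S) H. The right side is the squared Frobenius norm of nu S H, which is
    how the bias enters the risk. *)
Lemma ridge_bias S nu : 0 < nu ->
  nu * \tr (ridge S nu - ridge S nu *m ridge S nu) =
  \tr (S *m (nu *: ridge S nu) *m (nu *: ridge S nu) *m S^T).
Proof.
move=> n0; have hp := psd_penalty S (ltW n0).
rewrite /ridge resolvent_sub_sqr// -!(scalemxAr, scalemxAl) !mxtraceZ.
congr (_ * (_ * _)); set H := resolvent _; rewrite -(mulmxA (S *m H)) [RHS]mxtrace_mulC.
by rewrite !mulmxA.
Qed.

Lemma ridge_bias_ge0 S nu : 0 < nu ->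
  0 <= nu * \tr (ridge S nu - ridge S nu *m ridge S nu).
Proof.
move=> n0; rewrite ridge_bias//.
have -> : S *m (nu *: ridge S nu) *m (nu *: ridge S nu) *m S^T =
    (S *m (nu *: ridge S nu)) *m 1%:M *m (S *m (nu *: ridge S nu))^T.
  have [pA _] := psdZ (ltW n0) (psd_resolvent (psd_penalty S (ltW n0))).
  by rewrite mulmx1 trmx_mul pA mulmxA.
by apply: tr_conj_ge0; exact: psd1.
Qed.

(* With A = nu H_nu and B = mu H_mu the resolvent identity gives A - B = c A B with c >= 0,
   hence A^2 - B^2 = c (A B A + B A B). *)
Lemma ridge_bias_nondecreasing S nu mu : 0 < mu -> mu <= nu ->
  mu * \tr (ridge S mu - ridge S mu *m ridge S mu) <=
  nu * \tr (ridge S nu - ridge S nu *m ridge S nu).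
Proof.
move=> m0 mn; have n0 := lt_le_trans m0 mn.
rewrite !ridge_bias//.
have e := ridge_resolvent_identity S m0 n0.
have eC := ridge_comm S m0 n0.
have pA : psd (nu *: ridge S nu).
  by apply: psdZ (psd_resolvent (psd_penalty S _)); exact: ltW.
have pB : psd (mu *: ridge S mu).
  by apply: psdZ (psd_resolvent (psd_penalty S _)); exact: ltW.
set A := nu *: ridge S nu in e pA *; set B := mu *: ridge S mu in e pB *.
have cAB : A *m B = B *m A.
  by rewrite /A /B -!scalemxAl -!scalemxAr !scalerA eC mulrC.
set c := (nu - mu) / (nu * mu).
have c0 : 0 <= c by rewrite divr_ge0 ?subr_ge0// mulr_ge0// ltW.
have {}e : A - B = c *: (A *m B).
  rewrite e /A /B /c -!scalemxAl -!scalemxAr !scalerA; congr (_ *: _).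
  by field; rewrite !gt_eqF.
have eAB : A *m A - B *m B = c *: (A *m B *m A + B *m A *m B).
  have -> : A *m A - B *m B = A *m (A - B) + (A - B) *m B.
    by rewrite mulmxBr mulmxBl addrA subrK.
  rewrite e -scalemxAr -scalemxAl -scalerDr; congr (_ *: (_ + _)).
  by rewrite -!mulmxA cAB.
  by rewrite cAB.
rewrite -subr_ge0 -(linearB mxtrace)/= -mulmxBl -(mulmxA S A A) -(mulmxA S B B).
rewrite -mulmxBr eAB.
rewrite -scalemxAr -scalemxAl mxtraceZ mulr_ge0// mulmxDr mulmxDl mxtraceD.
rewrite addr_ge0//.
- have -> : S *m (A *m B *m A) *m S^T = (S *m A) *m B *m (S *m A)^T.
    by rewrite trmx_mul (proj1 pA) !mulmxA.
  exact: tr_conj_ge0.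
- have -> : S *m (B *m A *m B) *m S^T = (S *m B) *m A *m (S *m B)^T.
    by rewrite trmx_mul (proj1 pB) !mulmxA.
  exact: tr_conj_ge0.
Qed.

(** The normal equations y - h = nu S'S h cancel the cross terms. The excess over the value at [h]
    controls |m - h|^2, which yields minimality and uniqueness at once. *)
Lemma ridge_complete_square S nu y m : 0 < nu -> let h := ridge S nu *m y in
  bform 1%:M (y - m) (y - m) + nu * bform 1%:M (S *m m) (S *m m) =
  bform 1%:M (y - h) (y - h) + nu * bform 1%:M (S *m h) (S *m h) +
  (bform 1%:M (m - h) (m - h) + nu * bform 1%:M (S *m (m - h)) (S *m (m - h))).
Proof.
move=> n0 h; have hp := psd_penalty S (ltW n0).
set z := m - h; have -> : m = h + z by rewrite /z addrC subrK.
clearbody z.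
have ey : y = h + nu *: (S^T *m (S *m h)).
  by rewrite /h -{1}(mul1mx y) -(resolventVK hp) mulmxDl mulmxDl mul1mx -!scalemxAl !mulmxA.
have b1 : bform 1%:M (y - h) z = nu * bform 1%:M (S *m h) (S *m z).
  rewrite {1}ey addrAC subrr add0r bformZl bformMl trmxK mulmx1.
  by rewrite [in RHS]bformMr mul1mx.
have -> : y - (h + z) = (y - h) + (-1) *: z by rewrite scaleN1r opprD addrA.
set u := y - h in b1 *; clearbody u; rewrite mulmxDr !(bformDl, bformDr, bformZl, bformZr).
rewrite (bformC z u (trmx1 _ _)) (bformC (S *m z) (S *m h) (trmx1 _ _)) b1.
by ring.
Qed.

End Ridge.

(** * Cyclic differences *)

Section Frequencies.
Context {R : realType}.
Implicit Types (n k m : nat) (x y : R).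

(** Half of the Fourier frequency 2 pi k / n, so that the eigenvalues of the cyclic difference
    become squares of 2 sin. *)
Definition freq n k : R := pi * k%:R / n%:R.

Lemma cos_freqDn n k x : (0 < n)%N ->
  cos (2 * freq n k * (x + n%:R)) = cos (2 * freq n k * x).
Proof.
move=> n0; have nR : n%:R != 0 :> R by rewrite pnatr_eq0 -lt0n.
have -> : 2 * freq n k * (x + n%:R) = 2 * freq n k * x + (pi *+ 2) *+ k.
  by rewrite -(mulr_natr (pi *+ 2)) -(mulr_natr pi) /freq; field.
exact: (periodicn (@cosD2pi R)).
Qed.

(** Each term telescopes: 2 sin(y) cos(2yk) = sin((2k+1)y) - sin((2k-1)y). *)
Lemma sum_cos_telescope y m :
  (2 * sin y) * \sum_(k < m) cos (2 * y * k%:R) =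
  sin ((m%:R + m%:R - 1) * y) + sin y.
Proof.
elim: m => [|m ih]; first by rewrite big_ord0 mulr0 add0r sub0r mulN1r sinN addNr.
rewrite big_ord_recr/= mulrDr ih.
have e1 : (m.+1%:R + m.+1%:R - 1) * y = 2 * y * m%:R + y by rewrite -natr1; ring.
have e2 : (m%:R + m%:R - 1) * y = 2 * y * m%:R - y by ring.
by rewrite e1 e2 !sinD sinN cosN; ring.
Qed.

Lemma sin_freq_gt0 n m : (0 < m < n)%N -> 0 < sin (freq n m).
Proof.
move=> /andP[m0 mn]; apply: sin_gt0_pi; rewrite /freq.
have n0 : 0 < n%:R :> R by rewrite ltr0n (ltn_trans m0).
apply/andP; split; first by rewrite divr_gt0// mulr_gt0 ?pi_gt0 ?ltr0n.
by rewrite ltr_pdivrMr// ltr_pM2l ?pi_gt0// ltr_nat.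
Qed.

Lemma sin_freq_ge0 n k : (k <= n)%N -> 0 <= sin (freq n k).
Proof.
case: n => [|n] kn; first by rewrite /freq invr0 mulr0 sin0.
apply: sin_ge0_pi; rewrite /freq; apply/andP; split.
  by rewrite divr_ge0// mulr_ge0// pi_ge0.
by rewrite ler_pdivrMr ?ltr0n// ler_pM2l ?pi_gt0// ler_nat.
Qed.

(** At y = pi m / n the upper end (2n-1)y is -y modulo 2 pi, so the two boundary terms cancel, and
    sin(y) is nonzero. The roles of [k] and [m] are exchanged, since only their product enters. *)
Lemma sum_cos_freq_eq0 n m : (0 < m < n)%N ->
  \sum_(k < n) cos (2 * freq n k * m%:R) = 0.
Proof.
move=> mn; have n0 : (0 < n)%N by case: n mn => //; rewrite ltn0 andbF.
have nR : n%:R != 0 :> R by rewrite pnatr_eq0 -lt0n.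
have := sum_cos_telescope (freq n m) n.
have -> : (n%:R + n%:R - 1) * freq n m = - freq n m + (pi *+ 2) *+ m.
  by rewrite -(mulr_natr (pi *+ 2)) -(mulr_natr pi) /freq; field.
rewrite (periodicn (@sinD2pi R)) sinN addNr => /eqP.
rewrite mulf_eq0 gt_eqF/= ?mulr_gt0 ?sin_freq_gt0// => /eqP h.
rewrite -[RHS]h; apply: eq_bigr => k _; congr cos.
by rewrite /freq; field.
Qed.

Lemma sum_cos_freq n (t s : 'I_n) :
  \sum_(k < n) cos (2 * freq n k * (t%:R - s%:R)) = n%:R * (t == s)%:R.
Proof.
have [->|ts] := eqVneq t s.
  under eq_bigr do rewrite subrr mulr0 cos0.
  by rewrite sumr_const card_ord mulr1.
wlog lst : t s ts / (s < t)%N => [hw|].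
  have := ts; rewrite -val_eqE neq_ltn => /orP[l|l]; last exact: hw.
  rewrite -(hw s t) // 1?eq_sym//.
  by apply: eq_bigr => k _; rewrite -cosN -mulrN opprB.
rewrite mulr0 -[RHS](@sum_cos_freq_eq0 n (t - s)); last first.
  by rewrite subn_gt0 lst (leq_ltn_trans (leq_subr _ _)).
by apply: eq_bigr => k _; rewrite natrB// ltnW.
Qed.

Lemma two_sub_2cos y : 2 - 2 * cos (2 * y) = (2 * sin y) ^+ 2.
Proof. by rewrite (mulr_natl y) cos_mulr2n exprMn sin2cos2 -mulr_natl; ring. Qed.

End Frequencies.

(** * The spectrum of the cyclic difference and the comparison with the true penalty *)

Section CyclicDifferences.
Context {R : realType} (n' : nat).
Let n := n'.+1.

Definition cshift : 'M[R]_n := \matrix_(i, j) (j == ord_pred i)%:R.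
Definition cdiff : 'M[R]_n := 1%:M - cshift.

Lemma cshift_mul p (A : 'M[R]_(n, p)) i j : (cshift *m A) i j = A (ord_pred i) j.
Proof.
rewrite mxE (bigD1 (ord_pred i))//= mxE eqxx mul1r big1 ?addr0// => k /negPf nk.
by rewrite mxE nk mul0r.
Qed.

Lemma trcshift_mul p (A : 'M[R]_(n, p)) i j : (cshift^T *m A) i j = A (ordS i) j.
Proof.
rewrite mxE (bigD1 (ordS i))//= !mxE ordSK eqxx mul1r big1 ?addr0// => k nk.
rewrite !mxE; case: eqP => [ei|]; last by rewrite mul0r.
by rewrite ei ord_predK eqxx in nk.
Qed.

Lemma cshift_orth : cshift^T *m cshift = 1%:M.
Proof.
apply/matrixP => i j; rewrite trcshift_mul !mxE ordSK.
by rewrite eq_sym.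
Qed.

Lemma trcdiff : cdiff^T = 1%:M - cshift^T.
Proof. by rewrite /cdiff linearB/= trmx1. Qed.

(** The shift is orthogonal, hence commutes with its transpose. Normality allows the [d]-th power to
    be taken outside the Gram matrix. *)
Lemma cdiff_normal : cdiff^T *m cdiff = cdiff *m cdiff^T.
Proof.
rewrite trcdiff /cdiff !mulmxBl !mulmxBr !mul1mx !mulmx1.
by rewrite cshift_orth (mulmx1C cshift_orth) !opprB addrACA [RHS]addrACA; congr (_ + _); rewrite addrC.
Qed.

(** Real part of the [k]-th Fourier character centred at [s]; letting [s] vary keeps the spectral
    analysis within real matrices. *)
Definition cosvec (k s : nat) : 'cV[R]_n :=
  \col_t cos (2 * freq n k * (t%:R - s%:R)).

Lemma cosvecS k s t :
  cosvec k s (ordS t) 0 = cos (2 * freq n k * (t%:R - s%:R) + 2 * freq n k).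
Proof.
rewrite mxE /=; have := ltn_ord t; rewrite leq_eqVlt => /orP[/eqP e|l].
  have eR : t%:R = n%:R - 1 :> R by apply/eqP; rewrite eq_sym subr_eq natr1 e.
  by rewrite e modnn -[LHS](@cos_freqDn R n)// eR; congr cos; ring.
by rewrite modn_small// -natr1; congr cos; ring.
Qed.

Lemma cosvec_pred k s t : cosvec k s (ord_pred t) 0 =
  cos (2 * freq n k * (t%:R - s%:R) - 2 * freq n k).
Proof.
have := cosvecS k s (ord_pred t); rewrite ord_predK.
rewrite mxE /=; case: t => [[|t] lt]/=.
  move=> _; rewrite mxE/= modn_small//.
  have -> : 2 * freq n k * (0 - s%:R) - 2 * freq n k = 2 * freq n k * (0 - s%:R - 1) :> R.
    by ring.
  have -> : n'%:R = n%:R - 1 :> R by apply/eqP; rewrite eq_sym subr_eq natr1.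
  by rewrite -[RHS](@cos_freqDn R n)//; congr cos; ring.
move=> _; rewrite mxE/= modnDr modn_small 1?ltnW//.
by rewrite -natr1; congr cos; ring.
Qed.

Lemma cdiff_eigen k s :
  cdiff^T *m cdiff *m cosvec k s = ((2 * sin (freq n k)) ^+ 2) *: cosvec k s.
Proof.
rewrite -two_sub_2cos trcdiff /cdiff.
rewrite mulmxBl mul1mx mulmxBr mulmx1 cshift_orth.
apply/colP => t; rewrite !mulmxBl mul1mx.
have eB (A B : 'cV[R]_n) : (A - B) t 0 = A t 0 - B t 0 by rewrite !mxE.
rewrite !eB cshift_mul trcshift_mul cosvecS cosvec_pred !mxE !cosD cosN sinN; ring.
Qed.

Variables (d : nat).
Let Delta := cdiff ^+ d.

Lemma trmxX (A : 'M[R]_n) j : (A ^+ j)^T = A^T ^+ j.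
Proof.
by elim: j => [|j ih]; rewrite ?expr0 ?trmx1// exprS exprSr trmx_mul ih.
Qed.

Lemma cdiffX_gram : Delta^T *m Delta = (cdiff^T *m cdiff) ^+ d.
Proof.
rewrite /Delta trmxX [RHS]exprMn_comm//.
exact: cdiff_normal.
Qed.

Definition cfreq k : R := 2 * sin (freq n k).

Lemma cdiffX_eigen k s :
  Delta^T *m Delta *m cosvec k s = (cfreq k ^+ (2 * d)) *: cosvec k s.
Proof.
rewrite cdiffX_gram exprM; elim: d => [|j ih]; first by rewrite !expr0 mul1mx scale1r.
rewrite exprS -[_ * _]/(cdiff^T *m cdiff *m (cdiff^T *m cdiff) ^+ j).
by rewrite -(mulmxA (cdiff^T *m cdiff)) ih -scalemxAr cdiff_eigen scalerA -exprSr.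
Qed.

(** The circulant matrix with symbol [w], as a cosine sum. When [w] is symmetric under k -> n - k,
    the values [w k] are its eigenvalues. *)
Definition cosmx (w : nat -> R) : 'M[R]_n :=
  \matrix_(t, s) (n%:R^-1 * \sum_(k < n) w k * cos (2 * freq n k * (t%:R - s%:R))).

Lemma col_cosmx w s : col s (cosmx w) = n%:R^-1 *: \sum_(k < n) w k *: cosvec k s.
Proof.
apply/colP => t; rewrite !mxE summxE; congr (_ * _).
by apply: eq_bigr => k _; rewrite !mxE.
Qed.

Lemma cosmx1 : cosmx (fun=> 1) = 1%:M.
Proof.
apply/matrixP => t s; rewrite !mxE.
under eq_bigr do rewrite mul1r.
by rewrite sum_cos_freq mulrA mulVf ?mul1r ?pnatr_eq0.
Qed.

Lemma tr_cosmx w : \tr (cosmx w) = \sum_(k < n) w k.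
Proof.
rewrite /mxtrace; under eq_bigr do rewrite mxE.
under eq_bigr do under eq_bigr do rewrite subrr mulr0 cos0 mulr1.
by rewrite sumr_const card_ord -[LHS]mulr_natl mulrA mulfV ?mul1r ?pnatr_eq0.
Qed.

Definition filter_weight (nu : R) k : R := (1 + nu * cfreq k ^+ (2 * d))^-1.

Lemma filter_den_gt0 nu k : 0 <= nu -> 0 < 1 + nu * cfreq k ^+ (2 * d).
Proof.
by move=> n0; rewrite ltr_pwDl// mulr_ge0// exprM exprn_ge0// sqr_ge0.
Qed.

(** On each column, 1 + nu Delta'Delta multiplies [cosvec k s] by the inverse of
    [filter_weight nu k]. Starting from the identity, which is [cosmx] of the constant 1, one
    application gives H and a second one H^2. *)
Lemma ridge_cosmx nu w : 0 <= nu ->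
  ridge Delta nu *m cosmx w = cosmx (fun k => filter_weight nu k * w k).
Proof.
move=> n0; have hp := psd_penalty Delta n0.
rewrite -[RHS]mul1mx -(resolventK hp) -mulmxA; congr (_ *m _).
have col_eq (A B : 'M[R]_n) : (forall s, col s A = col s B) -> A = B.
  by move=> h; apply/matrixP => t s; have /colP/(_ t) := h s; rewrite !mxE.
apply: col_eq => s; apply/esym; rewrite colE -mulmxA -colE !col_cosmx -!scalemxAr mulmx_sumr; congr (_ *: _).
apply: eq_bigr => k _; rewrite -scalemxAr mulmxDl mul1mx -scalemxAl cdiffX_eigen scalerA -{1}[cosvec k s]scale1r -scalerDl.
rewrite scalerA; congr (_ *: _); rewrite mulrAC mulVf ?mul1r//.
by rewrite gt_eqF// filter_den_gt0.
Qed.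

Lemma ridge_cyclic nu : 0 <= nu -> ridge Delta nu = cosmx (filter_weight nu).
Proof.
move=> n0; rewrite -[LHS]mulmx1 -cosmx1 ridge_cosmx//.
by under eq_fun do rewrite mulr1.
Qed.

Lemma ridge_cyclic_sqr nu : 0 <= nu ->
  ridge Delta nu *m ridge Delta nu = cosmx (fun k => filter_weight nu k ^+ 2).
Proof.
by move=> n0; rewrite {2}ridge_cyclic// ridge_cosmx//.
Qed.

(* Zeroing the first d rows (j = d) instead of deleting them does not change the Gram matrix
   of the penalty; the other rows of the cyclic difference do not wrap around. *)
Definition keep j : 'M[R]_n := diag_mx (\row_i (j <= i)%:R).
Definition kept_diff j : 'M[R]_n := keep j *m Delta.

Definition wrap_row j : 'cV[R]_n := Delta^T *m \col_i (i == j :> nat)%:R.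

Lemma kept_diff0 : kept_diff 0 = Delta.
Proof.
rewrite /kept_diff /keep; have -> : \row_i (0 <= i)%N%:R = const_mx 1 :> 'rV[R]_n.
  by apply/rowP => i; rewrite !mxE.
by rewrite diag_const_mx mul1mx.
Qed.

Lemma keep_tr_mul j : (keep j)^T *m keep j = keep j.
Proof.
rewrite tr_diag_mx mul_diag_mx; apply/matrixP => a b; rewrite !mxE.
by case: (j <= a)%N; rewrite ?mul1r ?mul0r ?mul0rn.
Qed.

(** [keep j] and [keep j.+1] differ by the projection on coordinate [j], so one more zeroed row
    removes one rank-one term from the Gram matrix. *)
Lemma kept_diff_step j : (kept_diff j)^T *m kept_diff j =
  (kept_diff j.+1)^T *m kept_diff j.+1 + wrap_row j *m (wrap_row j)^T.
Proof.
rewrite /kept_diff /wrap_row !trmx_mul trmxK !mulmxA.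
rewrite -!(mulmxA (Delta^T)) !keep_tr_mul -mulmxDr -mulmxDl !mulmxA.
congr (_ *m _ *m _).
apply/matrixP => a b; rewrite !mxE big_ord1 !mxE.
rewrite -val_eqE/=; have [->|ab] := eqVneq (a : nat) b.
  by rewrite !mulr1n leq_eqVlt eq_sym; case: ltngtP => //= _; rewrite ?mulr0 ?mulr1 ?addr0 ?add0r.
rewrite !mulr0n add0r; case: eqP => [ea|]; last by rewrite mul0r.
by rewrite -ea eq_sym (negPf ab) mulr0.
Qed.

Lemma kept_diff_penalty nu j : 0 <= nu ->
  exists w : 'cV[R]_n, nu *: ((kept_diff j)^T *m kept_diff j) =
  nu *: ((kept_diff j.+1)^T *m kept_diff j.+1) + w *m w^T.
Proof.
move=> n0; exists (Num.sqrt nu *: wrap_row j).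
rewrite kept_diff_step scalerDr linearZ/= -scalemxAl -scalemxAr scalerA.
by rewrite -expr2 sqr_sqrtr.
Qed.

(** Zeroing the rows one by one costs [6 * s] each time. The factor sqrt(nu) sits inside the
    rank-one vectors, so the bound does not involve [nu]. *)
Lemma ridge_trace_perturbation s nu (M : 'M[R]_n) j : 0 <= nu -> M^T = M -> 0 <= s ->
  (forall x y, `|bform M x y| <= s * (bform 1%:M x x + bform 1%:M y y)) ->
  `|\tr (ridge (kept_diff j) nu *m ridge (kept_diff j) nu *m M) -
    \tr (ridge Delta nu *m ridge Delta nu *m M)| <= 6 * s * j%:R.
Proof.
move=> n0 hM s0 hs; rewrite -[in X in _ - X]kept_diff0.
elim: j => [|j ih]; first by rewrite subrr normr0 mulr0.
have [w ew] := kept_diff_penalty j n0.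
have := resolvent_rank1_trace w (psd_penalty (kept_diff j.+1) n0) hM s0 hs.
rewrite -ew => h; rewrite -[j.+1%:R]natr1 mulrDr mulr1 [leRHS]addrC.
by apply: le_trans (lerD h ih); exact: ler_distD.
Qed.

Lemma ridge_trace_perturbation1 nu j : 0 <= nu ->
  `|\tr (ridge (kept_diff j) nu) - \tr (ridge Delta nu)| <= j%:R.
Proof.
move=> n0; rewrite -[in X in _ - X]kept_diff0.
elim: j => [|j ih]; first by rewrite subrr normr0.
have [w ew] := kept_diff_penalty j n0.
have := resolvent_rank1_trace1 w (psd_penalty (kept_diff j.+1) n0).
rewrite -ew => h; rewrite -[j.+1%:R]natr1 [leRHS]addrC.
by apply: le_trans (lerD h ih); exact: ler_distD.
Qed.

End CyclicDifferences.

(** * Toeplitz covariance matrices *)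

Section EvenSequences.
Context {R : realType}.
Variable f : int -> R.
Hypothesis f_even : forall j, f (- j) = f j.

Lemma sum_symmetric_window N :
  \sum_(i < N.*2.+1) f (i%:Z - N%:Z) = f 0 + 2 * \sum_(1 <= j < N.+1) f j%:Z.
Proof.
elim: N => [|N ih]; first by rewrite big_ord1 subrr big_geq// mulr0 addr0.
rewrite doubleS big_ord_recl big_ord_recr/= big_nat_recr//= mulrDr addrA.
have -> : f (0%:Z - N.+1%:Z) = f N.+1%:Z by rewrite sub0r f_even.
have -> : f ((bump 0 N.*2.+1)%:Z - N.+1%:Z) = f N.+1%:Z.
  by congr f; rewrite /bump/= add1n; lia.
have -> : \sum_(i < N.*2.+1) f ((bump 0 i)%:Z - N.+1%:Z) =
          \sum_(i < N.*2.+1) f (i%:Z - N%:Z).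
  by apply: eq_bigr => i _; congr f; rewrite /bump/= add1n; lia.
rewrite ih; ring.
Qed.

(** The diagonals at distance [j] have n - j entries each; the induction adds the last row and the
    last column. *)
Lemma sum_toeplitz n :
  \sum_(t < n) \sum_(s < n) f (t%:Z - s%:Z) =
  n%:R * f 0 + 2 * \sum_(1 <= j < n) (n%:R - j%:R) * f j%:Z.
Proof.
have side m : \sum_(s < m) f (m%:Z - s%:Z) = \sum_(1 <= j < m.+1) f j%:Z.
  rewrite big_add1/= big_nat_rev/= -[RHS]/(\sum_(0 <= i < m) f (m - i.+1).+1%:Z) big_mkord.
  by apply: eq_bigr => i _; congr f; have := ltn_ord i; lia.
elim: n => [|n ih]; first by rewrite big_ord0 big_geq// mul0r mulr0 addr0.
rewrite big_ord_recr/= big_ord_recr/= subrr.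
under eq_bigr do rewrite big_ord_recr/=.
rewrite big_split/= ih side.
have -> : \sum_(i < n) f (i%:Z - n%:Z) = \sum_(1 <= j < n.+1) f j%:Z.
  by rewrite -side; apply: eq_bigr => i _; rewrite -f_even opprB.
have -> : \sum_(1 <= j < n.+1) (n.+1%:R - j%:R) * f j%:Z =
   \sum_(1 <= j < n) (n%:R - j%:R) * f j%:Z + \sum_(1 <= j < n.+1) f j%:Z.
  case: n {ih} => [|n]; first by rewrite !big_geq// addr0.
  rewrite !(big_nat_recr n.+1)//= addrA -big_split/=.
  congr (_ + _); last by rewrite -[n.+2%:R]natr1; ring.
  by apply: eq_bigr => j _; rewrite -[n.+2%:R]natr1; ring.
by rewrite -[n.+1%:R]natr1; ring.
Qed.

(** Row [t] is, up to reflection, a stretch of [n] consecutive terms of the symmetric window from -n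
    to n. *)
Lemma row_sum_toeplitz_le n (t : 'I_n) : (forall j, 0 <= f j) ->
  \sum_(s < n) f (t%:Z - s%:Z) <= f 0 + 2 * \sum_(1 <= j < n.+1) f j%:Z.
Proof.
move=> f0; rewrite -sum_symmetric_window.
rewrite -(big_mkord xpredT (fun s : nat => f (t%:Z - s%:Z))).
rewrite -(big_mkord xpredT (fun i : nat => f (i%:Z - n%:Z))).
have tn := ltn_ord t.
have l1 : (n - t <= n - t + n)%N by rewrite leq_addr.
have l2 : (n - t + n <= n.*2.+1)%N by rewrite -addnn; lia.
rewrite (big_cat_nat (leq0n (n - t)) (leq_trans l1 l2)) (big_cat_nat l1 l2)/=.
rewrite -[X in X <= _]addr0 -[X in X <= _]add0r lerD ?sumr_ge0// lerD ?sumr_ge0//.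
have shift a (F : nat -> R) : \sum_(a <= i < a + n) F i = \sum_(0 <= i < n) F (i + a)%N.
  by rewrite -{1}[a]add0n big_addn addKn.
rewrite (shift (n - t)%N).
apply: ler_sum_nat => s /andP[_ sn]; rewrite -f_even.
by rewrite le_eqVlt; apply/orP; left; apply/eqP; congr f; lia.
Qed.

End EvenSequences.

Section Toeplitz.
Context {R : realType}.
Variable rho : int -> R.
Hypothesis rho_even : forall j, rho (- j) = rho j.
Variable A : R.
Hypothesis rho_moment : forall N, \sum_(1 <= j < N) j%:R * `|rho j%:Z| <= A.

Let absrho_even j : `|rho (- j)| = `|rho j|. Proof. by rewrite rho_even. Qed.

Lemma sum_abs_rho_le N : \sum_(1 <= j < N) `|rho j%:Z| <= A.
Proof.
apply: le_trans (rho_moment N); apply: ler_sum_nat => j /andP[j1 _].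
by rewrite -{1}(mul1r `|_|) ler_wpM2r// ler1n.
Qed.

Lemma moment_ge0 : 0 <= A.
Proof. by have := rho_moment 0; rewrite big_geq. Qed.

Let partial N := rho 0 + 2 * \sum_(1 <= j < N.+1) rho j%:Z.

Lemma is_cvg_sum_rho : cvgn partial.
Proof.
apply: is_cvgD; first exact: is_cvg_cst.
apply: is_cvgMr; set v := fun j : nat => rho j.+1%:Z.
have -> : (fun N => \sum_(1 <= j < N.+1) rho j%:Z) = series v.
  by apply/funext => N; rewrite big_add1.
apply: normed_cvg; apply: nondecreasing_is_cvgn.
  by apply: nondecreasing_series => *; exact: normr_ge0.
exists A => _ [N _ <-]; apply: le_trans (sum_abs_rho_le N.+1).
by rewrite big_add1.
Qed.

(** At frequency 0 every cosine is 1. Absolute summability makes the [limn] in the definition a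
    genuine limit. *)
Lemma spectral_function0E :
  partial @ \oo --> spectral_function rho 0.
Proof.
suff -> : spectral_function rho 0 = limn partial by exact: is_cvg_sum_rho.
rewrite /spectral_function; congr (lim (_ @ \oo)); apply/funext => N.
rewrite /partial -(sum_symmetric_window rho_even).
by apply: eq_bigr => i _; rewrite mulr0 cos0 mulr1.
Qed.

Definition covmx n : 'M[R]_n := \matrix_(t, s) rho (t%:Z - s%:Z).

Lemma trmx_covmx n : (covmx n)^T = covmx n.
Proof. by apply/matrixP => i j; rewrite !mxE -rho_even opprB. Qed.

(** Schur test: |x_i y_j| <= x_i^2 + y_j^2, and absolute row sums are at most |rho(0)| + 2A for
    every [n]. This is the constant [s] of the rank-one perturbation bound. *)
Lemma covmx_bform_le n (x y : 'cV[R]_n) :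
  `|bform (covmx n) x y| <=
  (`|rho 0| + 2 * A) * (bform 1%:M x x + bform 1%:M y y).
Proof.
set s := _ + 2 * A.
have hs (t : 'I_n) : \sum_(s < n) `|rho (t%:Z - s%:Z)| <= s.
  apply: le_trans (row_sum_toeplitz_le absrho_even _ _) _ => //.
  by rewrite lerD2l ler_wpM2l// sum_abs_rho_le.
have sq (z : 'cV[R]_n) : \sum_(i < n) \sum_(j < n) z i 0 ^+ 2 * `|rho (i%:Z - j%:Z)| <= s * bform 1%:M z z.
  rewrite bform1E mulr_sumr; apply: ler_sum => i _.
  by rewrite -mulr_sumr mulrC -expr2 ler_wpM2r// sqr_ge0.
rewrite bformE (le_trans (ler_norm_sum _ _ _))//.
apply: (@le_trans _ _ (\sum_(i < n) \sum_(j < n) (x i 0 ^+ 2 * `|rho (i%:Z - j%:Z)| +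
    y j 0 ^+ 2 * `|rho (j%:Z - i%:Z)|))).
  apply: ler_sum => i _; apply: le_trans (ler_norm_sum _ _ _) _.
  apply: ler_sum => j _; rewrite mxE -[j%:Z - _]opprB rho_even -mulrDl !normrM ler_wpM2r//.
  rewrite -(real_normK (num_real (x i 0))) -(real_normK (num_real (y j 0))).
  have := sqr_ge0 (`|x i 0| - `|y j 0|).
  have := sqr_ge0 `|x i 0|; have := sqr_ge0 `|y j 0|; nra.
under eq_bigr do rewrite big_split/=.
rewrite big_split/= mulrDr lerD//.
by rewrite exchange_big/=.
Qed.

(** The Fejer mean of the spectral density at 2 pi k / n, that is, the expected periodogram. *)
Definition fejer n k : R :=
  n%:R^-1 * \sum_(t < n) \sum_(s < n) cos (2 * freq n k * (t%:R - s%:R)) * rho (t%:Z - s%:Z).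

Lemma tr_cosmx_covmx n' w : \tr (cosmx n' w *m covmx n'.+1) = \sum_(k < n'.+1) w k * fejer n'.+1 k.
Proof.
transitivity (\sum_(t < n'.+1) \sum_(s < n'.+1) \sum_(k < n'.+1) w k * (n'.+1%:R^-1 *
    (cos (2 * freq n'.+1 k * (t%:R - s%:R)) * rho (t%:Z - s%:Z)))).
  apply: eq_bigr => t _; rewrite mxE; apply: eq_bigr => s _.
  rewrite !mxE -[s%:Z - t%:Z]opprB rho_even -[LHS]mulrA mulr_suml mulr_sumr.
  by apply: eq_bigr => k _; ring.
under eq_bigr do rewrite exchange_big/=.
rewrite exchange_big/=; apply: eq_bigr => k _; rewrite /fejer !mulr_sumr.
by apply: eq_bigr => t _; rewrite !mulr_sumr.
Qed.

(** By the addition formula it is the covariance form at the cosine vector plus the form at the sine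
    vector, divided by n. The sign is what makes the cyclic variance monotone. *)
Lemma fejer_ge0 n k : psd (covmx n) -> 0 <= fejer n k.
Proof.
move=> [_ hp]; rewrite mulr_ge0 ?invr_ge0//.
set c : 'cV[R]_n := \col_t cos (2 * freq n k * t%:R).
set s : 'cV[R]_n := \col_t sin (2 * freq n k * t%:R).
rewrite (_ : \sum_(t < n) _ = bform (covmx n) c c + bform (covmx n) s s) ?addr_ge0//.
rewrite !bformE -big_split/=; apply: eq_bigr => i _.
rewrite -big_split/=; apply: eq_bigr => j _.
by rewrite !mxE mulrBr cosB; ring.
Qed.

Lemma fejerE n k : (0 < n)%N -> fejer n k =
  rho 0 + 2 * \sum_(1 <= j < n) (1 - j%:R / n%:R) * (cos (2 * freq n k * j%:R) * rho j%:Z).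
Proof.
move=> n0; have nR : n%:R != 0 :> R by rewrite pnatr_eq0 -lt0n.
rewrite /fejer; set f := fun j : int => cos (2 * freq n k * j%:~R) * rho j.
have fe j : f (- j) = f j by rewrite /f rho_even rmorphN/= mulrN cosN.
have := sum_toeplitz fe n.
have -> : \sum_(t < n) \sum_(s < n) f (t%:Z - s%:Z) = \sum_(t < n) \sum_(s < n)
    cos (2 * freq n k * (t%:R - s%:R)) * rho (t%:Z - s%:Z).
  by apply: eq_bigr => t _; apply: eq_bigr => s _; rewrite /f rmorphB.
move=> ->; rewrite mulrDr mulKf// {1}/f mulr0 cos0 mul1r; congr (_ + _).
rewrite mulrCA; congr (_ * _); rewrite mulr_sumr; apply: eq_bigr => j _.
by rewrite mulrA mulrBr mulVf// [n%:R^-1 * _]mulrC.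
Qed.

Lemma abs_sin_mulrn_le (x : R) j : `|sin (x * j%:R)| <= j%:R * `|sin x|.
Proof.
elim: j => [|j ih]; first by rewrite mulr0 sin0 normr0 mul0r.
rewrite -natr1 mulrDr mulr1 sinD (le_trans (ler_normD _ _))// mulrDl mul1r !normrM.
apply: lerD; first by rewrite -[leRHS]mulr1 ler_pM// cos_max.
by rewrite -[leRHS]mul1r ler_pM// cos_max.
Qed.

Lemma cfreq_pred n k : (0 < n)%N -> cfreq n.-1 k = 2 * sin (freq n k) :> R.
Proof. by case: n. Qed.

(** With x = pi k / n, each lag contributes at most j |rho(j)| (1/n + 2 sin x). The triangular
    factor loses j/n; the cosine loses 1 - cos(2xj) = 2 sin^2(xj) <= 2j sin x; a lag j >= n left out
    of the Fejer mean satisfies 1 <= j/n. *)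
Lemma partial_fejer_close n k N : (0 < n)%N -> (k <= n)%N -> (n <= N)%N ->
  `|partial N - fejer n k| <= 2 * A * (n%:R^-1 + cfreq n.-1 k).
Proof.
move=> n0 kn nN; have nR : 0 < n%:R :> R by rewrite ltr0n.
have c0 : 0 <= cfreq n.-1 k :> R by rewrite mulr_ge0// prednK// sin_freq_ge0.
rewrite fejerE// /partial opprD addrACA subrr add0r -mulrBr normrM ger0_norm//.
rewrite -mulrA ler_wpM2l//.
have n1 : (1 <= n)%N by [].
rewrite (big_cat_nat n1 (leqW nN))/= addrAC -sumrB.
apply: (@le_trans _ _ (\sum_(1 <= j < N.+1) j%:R * `|rho j%:Z| * (n%:R^-1 + cfreq n.-1 k))); last first.
  by rewrite -mulr_suml ler_wpM2r ?rho_moment// addr_ge0// invr_ge0 ltW.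
rewrite [leRHS](big_cat_nat n1 (leqW nN))/=.
apply: le_trans (ler_normD _ _) _; apply: lerD.
  apply: le_trans (ler_norm_sum _ _ _) _; apply: ler_sum_nat => j /andP[j1 jn].
  set x := freq n k; set C := cos _.
  have -> : rho j%:Z - (1 - j%:R / n%:R) * (C * rho j%:Z) =
    ((1 - C) + C * (j%:R / n%:R)) * rho j%:Z by ring.
  rewrite normrM mulrAC mulrDr ler_wpM2r//.
  apply: le_trans (ler_normD _ _) _; rewrite addrC lerD//.
    rewrite normrM (ger0_norm (divr_ge0 _ _))// -[leRHS]mul1r ler_wpM2r ?divr_ge0//.
    exact: cos_max.
  have -> : 1 - C = 2 * sin (x * j%:R) ^+ 2.
    have := two_sub_2cos (x * j%:R); rewrite mulrA -/C exprMn => h; lra.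
  have s2 : 0 <= 2 * sin (x * j%:R) ^+ 2 by rewrite mulr_ge0// sqr_ge0.
  rewrite (ger0_norm s2) cfreq_pred// -/x [leRHS]mulrCA ler_wpM2l//.
  rewrite -(ger0_norm (sqr_ge0 _)) normrX -[sin x]ger0_norm ?sin_freq_ge0//.
  apply: le_trans (abs_sin_mulrn_le _ _).
  by rewrite expr2 -[leRHS]mulr1 ler_wpM2l// sin_max.
apply: le_trans (ler_norm_sum _ _ _) _; apply: ler_sum_nat => j /andP[jn _].
rewrite mulrAC -[leLHS]mul1r ler_wpM2r// mulrDr -[leLHS]addr0 lerD//; last by apply: mulr_ge0 c0.
by rewrite ler_pdivlMr// mul1r ler_nat.
Qed.

Lemma fejer_close n k : (0 < n)%N -> (k <= n)%N ->
  `|fejer n k - spectral_function rho 0| <= 2 * A * (n%:R^-1 + cfreq n.-1 k).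
Proof.
move=> n0 kn; rewrite distrC.
have : (fun N => `|partial N - fejer n k|) @ \oo --> `|spectral_function rho 0 - fejer n k|.
  by apply: cvg_norm; apply: cvgB; [exact: spectral_function0E|exact: cvg_cst].
move=> /[dup] /cvgP h /(cvg_lim (@Rhausdorff R)) <-.
apply: limr_le => //; near=> N; apply: partial_fejer_close => //.
by near: N; exact: nbhs_infty_ge.
Unshelve. all: by end_near.
Qed.

End Toeplitz.

(** * Riemann sums and Beta integrals *)

Section SineBounds.
Context {R : realType}.
Implicit Types x : R.

Lemma sin_mvt x : 0 < x -> exists2 c, 0 < c < x & sin x = cos c * x.
Proof.
move=> x0; have hc : {within `[0, x], continuous (@sin R)}.
  by apply: continuous_subspaceT => y; exact: continuous_sin.
have [c] := MVT x0 (fun y _ => is_derive_sin y) hc.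
by rewrite in_itv/= sin0 !subr0 => cx e; exists c.
Qed.

Lemma sin_le_id x : 0 <= x -> sin x <= x.
Proof.
rewrite le_eqVlt => /predU1P[<-|x0]; first by rewrite sin0.
have [c _ ->] := sin_mvt x0; rewrite -[leRHS]mul1r ler_wpM2r ?cos_le1//.
exact: ltW.
Qed.

(** By the half-angle formula 1 - cos x = 2 sin^2(x/2), this reduces to |sin y| <= |y|. *)
Lemma cos_ge_quadratic x : 1 - x ^+ 2 / 2 <= cos x.
Proof.
wlog x0 : x / 0 <= x => [hw|].
  have [/hw//|x0] := leP 0 x.
  by rewrite -cosN -sqrrN hw// oppr_ge0 ltW.
have -> : cos x = 1 - 2 * sin (x / 2) ^+ 2.
  have {1}-> : x = x / 2 *+ 2 by rewrite -(mulr_natr (x / 2)); field.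
  by rewrite cos_mulr2n sin2cos2 -(mulr_natr (cos _ ^+ 2)); ring.
have -> : 1 - x ^+ 2 / 2 = 1 - 2 * (x / 2) ^+ 2 by field.
rewrite lerD2l lerN2 ler_wpM2l//.
have x20 : 0 <= x / 2 by rewrite divr_ge0.
rewrite -[leLHS]real_normK ?num_real// lerXn2r ?nnegrE//.
have [x4|x4] := leP (x / 2) 1; last exact: le_trans (sin_max _) (ltW x4).
rewrite ger0_norm ?sin_le_id//; apply: sin_ge0_pi; rewrite x20/=.
by apply: le_trans x4 _; apply: le_trans (pi_ge2 R); rewrite ler1n.
Qed.

Lemma sin_ge_cubic x : 0 <= x -> x - x ^+ 3 / 2 <= sin x.
Proof.
rewrite le_eqVlt => /predU1P[<-|x0]; first by rewrite sin0; lra.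
have [c /andP[c0 cx] ->] := sin_mvt x0; have h := cos_ge_quadratic c.
have c2 : c ^+ 2 <= x ^+ 2 by rewrite ler_sqr ?nnegrE ltW.
have -> : x - x ^+ 3 / 2 = (1 - x ^+ 2 / 2) * x by field.
by rewrite ler_wpM2r//; [exact: ltW | lra].
Qed.

(** Put y = x/2 <= 1 in sin x = 2 cos(y) sin(y): there cos y >= 1/2 and sin y >= y/2. Any positive
    constant in place of 1/4 would give a comparison of the same kind. *)
Lemma sin_ge_quarter x : 0 <= x -> x <= pi / 2 -> x / 4 <= sin x.
Proof.
move=> x0 xp; have p2 := pihalf_lt2 R.
have -> : sin x = 2 * (cos (x / 2) * sin (x / 2)).
  have {1}-> : x = x / 2 *+ 2 by rewrite -(mulr_natr (x / 2)); field.
  by rewrite sin_mulr2n mulr_natl.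
have -> : x / 4 = 2 * (2^-1 * (x / 2 * 2^-1)) by field.
set y := x / 2; have y0 : 0 <= y by rewrite divr_ge0.
have y1 : y <= 1 by rewrite /y; lra.
have y2 : y ^+ 2 <= 1 by rewrite expr_le1.
have c := cos_ge_quadratic y; have s := sin_ge_cubic y0.
rewrite ler_wpM2l// ler_pM ?mulr_ge0//; first lra.
apply: le_trans s; have : y * y ^+ 2 <= y * 1 by rewrite ler_wpM2l.
rewrite -exprS; lra.
Qed.

End SineBounds.

Lemma exprB_le (R : realFieldType) (u v : R) m : 0 <= u -> u <= v ->
  v ^+ m - u ^+ m <= m%:R * v ^+ m.-1 * (v - u).
Proof.
move=> u0 uv; rewrite subrXX mulrC ler_wpM2r ?subr_ge0//.
have v0 := le_trans u0 uv.
apply: (@le_trans _ _ (\sum_(i < m) v ^+ m.-1)).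
  apply: ler_sum => i _.
  have e : m.-1 = (m.-1 - i + i)%N by have := ltn_ord i; lia.
  by rewrite [in leRHS]e exprD ler_wpM2l ?exprn_ge0// lerXn2r ?nnegrE.
by rewrite sumr_const card_ord mulr_natl.
Qed.

(** * The filter profile and the replacement of the sine by its argument *)

Section SpectralWeight.
Context {R : realType} (d : nat).
Hypothesis d_gt0 : (0 < d)%N.
Implicit Types v x : R.

Definition weight v : R := (1 + v ^+ (2 * d))^-1.

Lemma even_expr_ge0 v : 0 <= v ^+ (2 * d).
Proof. by rewrite exprM exprn_ge0// sqr_ge0. Qed.

Lemma weight_den_gt0 v : 0 < 1 + v ^+ (2 * d).
Proof. by rewrite ltr_pwDl// even_expr_ge0. Qed.

Lemma weight_gt0 v : 0 < weight v. Proof. by rewrite invr_gt0 weight_den_gt0. Qed.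

Lemma weight_le1 v : weight v <= 1.
Proof. by rewrite invf_le1 ?weight_den_gt0// lerDl even_expr_ge0. Qed.

Lemma weight_compl v : v ^+ (2 * d) * weight v = 1 - weight v.
Proof. by rewrite /weight; field; rewrite gt_eqF// weight_den_gt0. Qed.

Lemma weight_nonincreasing u v : 0 <= u -> u <= v -> weight v <= weight u.
Proof.
move=> u0 uv; rewrite lef_pV2 ?posrE ?weight_den_gt0//.
by rewrite lerD2l lerXn2r ?nnegrE// (le_trans u0).
Qed.

Lemma expr_le_1Dexpr v j : 0 <= v -> (j <= 2 * d)%N -> v ^+ j <= 1 + v ^+ (2 * d).
Proof.
move=> v0 jd; have [v1|v1] := leP v 1.
  by apply: (@le_trans _ _ 1); [rewrite exprn_ile1|rewrite lerDl even_expr_ge0].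
by rewrite (le_trans (ler_weXn2l (ltW v1) jd))// lerDr.
Qed.

Lemma expr_weight_le1 v j : 0 <= v -> (j <= 2 * d)%N -> v ^+ j * weight v <= 1.
Proof.
by move=> v0 jd; rewrite ler_pdivrMr ?weight_den_gt0// mul1r expr_le_1Dexpr.
Qed.

(** With s = 2 sin x and z = 2x, the difference is w(bs) w(bz) ((bz)^(2d) - (bs)^(2d)) and z - s <=
    z^3/8. The weight w(bz) absorbs the power (bz)^(2d); after z <= 4s the weight w(bs) absorbs
    (bs)^2. The result is of order b^(-2) uniformly in [x]. *)
Lemma weight_sin_close (b x : R) : 0 < b -> 0 <= x -> x <= pi / 2 ->
  0 <= weight (b * (2 * sin x)) - weight (b * (2 * x)) <= (4 * d)%:R / b ^+ 2.
Proof.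
move=> b0 x0 xp.
have s0 : 0 <= 2 * sin x.
  by have := sin_ge_quarter x0 xp; lra.
set s := 2 * sin x in s0 *; set z := 2 * x.
have z0 : 0 <= z by rewrite /z; lra.
have sz : s <= z by rewrite /s/z; have := sin_le_id x0; lra.
have z4 : z <= 4 * s by rewrite /s/z; have := sin_ge_quarter x0 xp; lra.
have zs : z - s <= z ^+ 3 / 8.
  rewrite /s/z; have := sin_ge_cubic x0.
  have -> : (2 * x) ^+ 3 / 8 = x ^+ 3 by field.
  lra.
have bs0 : 0 <= b * s by rewrite mulr_ge0// ltW.
have bz0 : 0 <= b * z by rewrite mulr_ge0// ltW.
have bsz : b * s <= b * z by apply: ler_wpM2l sz; exact: ltW.
rewrite subr_ge0 weight_nonincreasing//=.
have -> : weight (b * s) - weight (b * z) =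
   weight (b * s) * (weight (b * z) * ((b * z) ^+ (2 * d) - (b * s) ^+ (2 * d))).
  by rewrite /weight; field; rewrite !gt_eqF ?weight_den_gt0.
have h1 : weight (b * z) * ((b * z) ^+ (2 * d) - (b * s) ^+ (2 * d)) <=
    (2 * d)%:R * (z ^+ 2 / 8).
  have l := exprB_le (2 * d) bs0 (ler_wpM2l (ltW b0) sz).
  apply: (@le_trans _ _ (weight (b * z) * ((2 * d)%:R * (b * z) ^+ (2 * d).-1 * (b * z - b * s)))).
    by rewrite ler_wpM2l// ltW// weight_gt0.
  apply: (@le_trans _ _ ((2 * d)%:R * (z ^+ 2 / 8) * ((b * z) ^+ (2 * d) * weight (b * z)))).
    have -> : (b * z) ^+ (2 * d) = (b * z) ^+ (2 * d).-1 * (b * z).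
      by rewrite -exprSr prednK// muln_gt0.
    set X := (b * z) ^+ _; set W := weight _.
    have X0 : 0 <= X by exact: exprn_ge0.
    have W0 : 0 <= W by exact/ltW/weight_gt0.
    have -> : W * ((2 * d)%:R * X * (b * z - b * s)) = (2 * d)%:R * X * W * b * (z - s) by ring.
    have -> : (2 * d)%:R * (z ^+ 2 / 8) * (X * (b * z) * W) =
        (2 * d)%:R * X * W * b * (z ^+ 3 / 8) by field.
    by rewrite ler_wpM2l// !mulr_ge0// ltW.
  rewrite -[leRHS]mulr1 ler_wpM2l//.
    by rewrite mulr_ge0// divr_ge0// sqr_ge0.
  by rewrite weight_compl gerBl ltW// weight_gt0.
have h2 : (b * s) ^+ 2 * weight (b * s) <= 1 by apply: expr_weight_le1 => //; rewrite leq_pmulr.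
have W0 : 0 <= weight (b * s) by exact/ltW/weight_gt0.
apply: le_trans (ler_wpM2l W0 h1) _.
have z2 : z ^+ 2 <= 16 * s ^+ 2.
  have -> : 16 * s ^+ 2 = (4 * s) ^+ 2 by ring.
  by rewrite lerXn2r ?nnegrE// mulr_ge0.
rewrite ler_pdivlMr ?exprn_gt0//.
have -> : (4 * d)%:R = (2 * d)%:R * 2 :> R by rewrite -natrM mulnAC.
apply: (@le_trans _ _ ((2 * d)%:R * (2 * ((b * s) ^+ 2 * weight (b * s))))).
  have -> : weight (b * s) * ((2 * d)%:R * (z ^+ 2 / 8)) * b ^+ 2 =
    (2 * d)%:R * (weight (b * s) * b ^+ 2 * (z ^+ 2 / 8)) by ring.
  have -> : 2 * ((b * s) ^+ 2 * weight (b * s)) = weight (b * s) * b ^+ 2 * (2 * s ^+ 2).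
    by rewrite exprMn; ring.
  by rewrite ler_wpM2l// ler_wpM2l ?mulr_ge0 ?sqr_ge0//; lra.
by rewrite ler_wpM2l//; lra.
Qed.

End SpectralWeight.

(** * Integrability of Beta densities and the incomplete Beta function *)

Section BetaIntegral.
Context {R : realType}.
Notation mu := (@lebesgue_measure R).
Implicit Types (x a b : R).

(** The open interval is exhausted by compact ones, on which the fundamental theorem of calculus
    bounds the integral by [2 * C]; monotone convergence concludes. The function may blow up at both
    ends. *)
Lemma integrable_of_bounded_primitive (f F : R -> R) (C : R) :
  (forall x, 0 < x < 1 -> {for x, continuous f}) ->
  (forall x, 0 < x < 1 -> 0 <= f x) ->
  (forall x, 0 < x < 1 -> is_derive x 1 F (f x)) ->
  (forall x, 0 < x < 1 -> `|F x| <= C) ->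
  mu.-integrable `]0%R, (1%R : R)[ (EFin \o f).
Proof.
move=> fc f0 dF FC.
have mf : measurable_fun `]0%R, (1%R : R)[ f.
  apply: subspace_continuous_measurable_fun => //.
  apply: continuous_in_subspaceT => x; rewrite inE/= in_itv/=; exact: fc.
(* The shift by 3 gives e <= 1/3, so that every interval from e to 1 - e is nondegenerate. *)
pose e (k : nat) : R := k.+3%:R^-1.
have e0 k : 0 < e k by rewrite invr_gt0.
have e1 k : e k <= 3^-1 by rewrite lef_pV2 ?posrE// ler_nat.
pose I k : set R := `[e k, 1 - e k]%classic.
have I01 k x : I k x -> 0 < x < 1.
  rewrite /I/= in_itv/= => /andP[l1 l2]; have := e0 k; lra.
have bigI : \bigcup_k I k = `]0%R, (1%R : R)[%classic.
  apply/seteqP; split => [x [k _ /I01]|x]; first by rewrite /= in_itv.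
  rewrite /= in_itv/= => /andP[x0 x1].
  have m0 : 0 < Num.min x (1 - x) by rewrite lt_min x0 subr_gt0.
  have [k _ hk] := near_infty_natSinv_lt (PosNum m0).
  exists k => //; rewrite /I/= in_itv/=.
  have : e k <= k.+1%:R^-1 by rewrite lef_pV2 ?posrE// ler_nat ltnS -addn2 leq_addr.
  have := hk _ (leqnn k); rewrite /= lt_min => /andP[h1 h2] h3.
  by rewrite (le_trans h3 (ltW h1))/= lerBrDl -lerBrDr (le_trans h3 (ltW h2)).
apply/integrableP; split; first exact/measurable_EFinP.
have -> : (\int[mu]_(x in `]0%R, (1%R : R)[) `|(EFin \o f) x| = \int[mu]_(x in `]0%R, (1%R : R)[) (f x)%:E)%E.
  apply: eq_integral => x; rewrite inE/= in_itv/= => /f0 h.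
  by rewrite /= ger0_norm.
rewrite -bigI.
have cv : (\int[mu]_(x in I i) (f x)%:E)%E @[i --> \oo] --> (\int[mu]_(x in \bigcup_i I i) (f x)%:E)%E.
  apply: ge0_nondecreasing_set_cvg_integral.
  - move=> m k mk; rewrite subsetEset => x; rewrite /I/= !in_itv/=.
    have : e k <= e m by rewrite lef_pV2 ?posrE// ler_nat !ltnS.
    move=> h /andP[h1 h2]; apply/andP; split; lra.
  - by move=> i; exact: measurable_itv.
  - move=> i; apply/measurable_EFinP; apply: measurable_funS mf => // x /I01.
    by rewrite /= in_itv.
  - by move=> i x /I01 /f0; rewrite lee_fin.
apply: (@le_lt_trans _ _ (2 * C)%:E); last by rewrite ltry.
rewrite -(cvg_lim _ cv)//; apply: lime_le; first by apply/cvg_ex; eexists; exact: cv.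
near=> k; have ek : e k < 1 - e k by have := e1 k; have := e0 k; lra.
rewrite (@continuous_FTC2 _ f F)//.
- rewrite -EFinB lee_fin.
  have h1 : `|F (1 - e k)| <= C by apply: FC; have := e1 k; have := e0 k; lra.
  have h2 : `|F (e k)| <= C by apply: FC; have := e1 k; have := e0 k; lra.
  apply: le_trans (ler_norm _) _; apply: le_trans (ler_normB _ _) _; lra.
- apply: continuous_in_subspaceT => x; rewrite inE => /I01; exact: fc.
- have cF x : 0 < x < 1 -> {for x, continuous F}.
    by move=> /dF h; apply/differentiable_continuous; apply/derivable1_diffP; case: h.
  split; first by move=> x; rewrite in_itv/= => h; have [|//] := dF x; have := e0 k; lra.
    by apply: cvg_at_right_filter; apply: cF; have := e0 k; have := e1 k; lra.
  by apply: cvg_at_left_filter; apply: cF; have := e0 k; have := e1 k; lra.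
- move=> x; rewrite in_itv/= => /andP[h1 h2].
  have h3 : 0 < x < 1 by have := e0 k; lra.
  by rewrite derive1E; apply: derive_val; exact: dF.
Unshelve. all: by end_near.
Qed.


Definition beta_density (a b x : R) : R := x `^ (a - 1) * (1 - x) `^ (b - 1).

Section BetaDensity.
Variables (a b : R).
Hypotheses (a0 : 0 < a) (b0 : 0 < b).

Lemma continuous_powR (r x : R) : 0 < x -> {for x, continuous (@powR R ^~ r)}.
Proof.
move=> x0; apply/differentiable_continuous; apply/derivable1_diffP.
by apply: derivable_powR; rewrite in_itv/= x0.
Qed.

Lemma continuous_powR_onem (r x : R) : x < 1 -> {for x, continuous (fun y : R => (1 - y) `^ r)}.
Proof.
move=> x1; apply: (@continuous_comp _ _ _ (fun y : R => 1 - y) (@powR R ^~ r)).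
  by apply: cvgB; [exact: cvg_cst|exact: cvg_id].
by apply: continuous_powR; rewrite subr_gt0.
Qed.

Lemma continuous_beta_density x : 0 < x < 1 -> {for x, continuous (beta_density a b)}.
Proof.
move=> /andP[x0 x1]; apply: continuousM; first exact: continuous_powR.
exact: continuous_powR_onem.
Qed.

Lemma is_derive_onem_powR (r x : R) : x < 1 ->
  is_derive x 1 (fun y : R => (1 - y) `^ r) (- (r * (1 - x) `^ (r - 1))).
Proof.
move=> x1.
have h1 : is_derive x 1 (fun y : R => 1 - y) (-1).
  by apply: is_derive_eq; rewrite add0r mul1r.
have h2 : is_derive (1 - x) 1 (@powR R ^~ r) (r * (1 - x) `^ (r - 1)).
  by apply: is_derive1_powR; rewrite subr_gt0.
by have := @is_derive1_comp R (@powR R ^~ r) (fun y : R => 1 - y) x _ _ h2 h1; rewrite mulrN1.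
Qed.

Lemma integrable_beta_majorant :
  mu.-integrable `]0%R, (1%R : R)[ (EFin \o (fun x : R => x `^ (a - 1) + (1 - x) `^ (b - 1))).
Proof.
apply: (@integrable_of_bounded_primitive _
  (fun x => a^-1 * x `^ a - b^-1 * (1 - x) `^ b) (a^-1 + b^-1)).
- move=> x /andP[x0 x1]; apply: continuousD; first exact: continuous_powR.
  exact: continuous_powR_onem.
- by move=> x _; rewrite addr_ge0// powR_ge0.
- move=> x /andP[x0 x1].
  have h1 := is_derive1_powR a x0; have h2 := is_derive_onem_powR b x1.
  have -> : (fun x : R => a^-1 * x `^ a - b^-1 * (1 - x) `^ b) =
    a^-1 *: (@powR R ^~ a) - b^-1 *: (fun y : R => (1 - y) `^ b) by [].
  apply: is_derive_eq; rewrite scalerN opprK /GRing.scale/= !mulrA !mulVf ?gt_eqF//.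
  by rewrite !mul1r.
- move=> x /andP[x0 x1]; apply: le_trans (ler_normB _ _) _.
  have hp (r y : R) : 0 < r -> 0 < y < 1 -> `|r^-1 * y `^ r| <= r^-1.
    move=> r0 /andP[y0 y1]; have r1 : 0 <= r^-1 by rewrite invr_ge0 ltW.
    rewrite ger0_norm; last by rewrite mulr_ge0// powR_ge0.
    have y01 : 0 < y <= 1 by rewrite y0 ltW.
    by rewrite -[leRHS]mulr1 ler_wpM2l// -[leRHS](powRr0 y) ger_powR// ltW.
  by rewrite lerD// hp ?x0//; apply/andP; split; lra.
Qed.

Lemma powR_le2 (r y : R) : 0 < r -> 2^-1 <= y -> y <= 1 -> y `^ (r - 1) <= 2.
Proof.
move=> r0 y2 y1; have y0 : 0 < y by lra.
apply: (@le_trans _ _ (y `^ (- 1))).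
  by apply: ger_powR; [rewrite y0 y1|lra].
rewrite powR_inv1; last exact: ltW.
by rewrite -[leRHS]invrK lef_pV2 ?posrE.
Qed.

(** On each half of the interval one factor is away from its singularity and is at most 2, since
    y^(r-1) <= 1/y for r > 0 and y <= 1. The sum on the right has an explicit bounded primitive. *)
Lemma beta_density_le x : 0 < x < 1 ->
  0 <= beta_density a b x <= 2 * (x `^ (a - 1) + (1 - x) `^ (b - 1)).
Proof.
move=> /andP[x0 x1]; rewrite /beta_density mulr_ge0 ?powR_ge0//= mulrDr.
have [x2|x2] := leP x 2^-1.
  have := powR_le2 b0 (_ : 2^-1 <= 1 - x) (_ : 1 - x <= 1) => /(_ ltac:(lra) ltac:(lra)) h.
  apply: (@le_trans _ _ (2 * x `^ (a - 1))); last by rewrite lerDl mulr_ge0// powR_ge0.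
  by rewrite mulrC ler_wpM2r// powR_ge0.
have := powR_le2 a0 (ltW x2) (ltW x1) => h.
apply: (@le_trans _ _ (2 * (1 - x) `^ (b - 1))); last by rewrite lerDr mulr_ge0// powR_ge0.
by rewrite ler_wpM2r// powR_ge0.
Qed.

Lemma measurable_beta_density : measurable_fun [set: R] (beta_density a b).
Proof.
apply: measurable_funM; first exact: measurable_powR.
apply: (@measurableT_comp _ _ _ _ _ _ (@powR R ^~ (b - 1))); first exact: measurable_powR.
exact: measurable_funB.
Qed.

Lemma integrable_beta_density : mu.-integrable `[0%R, (1%R : R)] (EFin \o beta_density a b).
Proof.
have mb : measurable_fun [set: R] (EFin \o beta_density a b).
  by apply/measurable_EFinP; exact: measurable_beta_density.
suff : mu.-integrable `]0%R, (1%R : R)[ (EFin \o beta_density a b).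
  move=> /integrableP[_ h]; apply/integrableP; split; first exact: measurable_funS mb.
  rewrite integral_itv_bndoo//.
  by apply/measurableT_comp => //; exact: measurable_funS mb.
apply: (@le_integrable _ _ _ mu _ _ _ (EFin \o (fun x : R => 2 * (x `^ (a - 1) + (1 - x) `^ (b - 1))))) => //.
- exact: measurable_funS mb.
- move=> x; rewrite /= in_itv/= => /beta_density_le /andP[h1 h2].
  rewrite lee_fin !ger0_norm//; exact: le_trans h2.
- by apply: (integrableZl _ _ integrable_beta_majorant).
Qed.

(** The incomplete Beta function. *)
Definition beta_primitive (t : R) : R := parameterized_integral mu 0 t (beta_density a b).

Lemma beta_primitive_derive (t : R) : 0 < t < 1 ->
  is_derive t 1 beta_primitive (beta_density a b t).
Proof.
move=> t01; have /andP[t0 t1] := t01.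
have [h1 h2] := continuous_FTC1_closed t1 integrable_beta_density t0
  (continuous_beta_density t01).
by rewrite -h2 derive1E; exact: DeriveDef.
Qed.

Lemma beta_primitive_cvg0 : beta_primitive t @[t --> (0:R)] --> (0:R).
Proof. exact: (parameterized_integral_cvg_left ltr01 integrable_beta_density). Qed.

Lemma beta_primitive_cvg1 : beta_primitive t @[t --> (1:R)^'-] --> Beta a b.
Proof. exact: (parameterized_integral_cvg_at_left ltr01 integrable_beta_density). Qed.

End BetaDensity.

End BetaIntegral.

(** * Riemann sums of monotone functions on the half-line *)

Section MonotoneRiemannSums.
Context {R : realType}.
Variables (Psi q : R -> R) (M L : R).
Hypothesis Psi_derive : forall v : R, 0 < v -> is_derive v 1 Psi (q v).
Hypothesis q_noninc : forall u v : R, 0 <= u -> u <= v -> q v <= q u.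
Hypothesis q_bound : forall v : R, 0 <= v -> 0 <= q v <= M.
Hypothesis Psi_cvg0 : Psi v @[v --> (0:R)^'+] --> (0:R).
Hypothesis Psi_cvgy : Psi v @[v --> +oo] --> L.

Lemma primitive_step u v : 0 < u -> u < v ->
  q v * (v - u) <= Psi v - Psi u <= q u * (v - u).
Proof.
move=> u0 uv.
have hc : {within `[u, v], continuous Psi}.
  apply: derivable_within_continuous => x; rewrite in_itv/= => /andP[ux _].
  by have [] := Psi_derive (lt_le_trans u0 ux).
have hd x : x \in `]u, v[%R -> is_derive x 1 Psi (q x).
  by rewrite in_itv/= => /andP[ux _]; apply: Psi_derive; exact: lt_trans ux.
have [c] := MVT uv hd hc; rewrite in_itv/= => /andP[uc cv] ->.
by rewrite !ler_wpM2r ?subr_ge0 ?(ltW uv)// q_noninc ?ltW// (lt_trans u0).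
Qed.

(** Monotonicity encloses each increment of [Psi] between neighbouring terms. [Psi] is controlled
    only on v > 0, so the comparison starts at [e]; in the upper bound the terms at 0 and at [e]
    cost at most [M * e] each. *)
Lemma riemann_sum_bounds e N : 0 < e -> (0 < N)%N ->
  Psi (N%:R * e) - Psi e <= e * \sum_(k < N) q (k%:R * e) <=
  Psi (N%:R * e) - Psi e + 2 * M * e.
Proof.
move=> e0; case: N => // N _.
have step j : e * q (j.+2%:R * e) <= Psi (j.+2%:R * e) - Psi (j.+1%:R * e) <= e * q (j.+1%:R * e).
  have := @primitive_step (j.+1%:R * e) (j.+2%:R * e); rewrite -mulrBl -natrB// subSnn mul1r.
  rewrite ![e * _]mulrC; apply; first by rewrite mulr_gt0.
  by rewrite ltr_pM2r// ltr_nat.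
apply/andP; split.
  elim: N => [|N ih].
    rewrite mul1r subrr big_ord1 mul0r mulr_ge0// ?(ltW e0)//.
    by have /andP[] := q_bound (lexx 0).
  rewrite big_ord_recr/= mulrDr; have /andP[_ h] := step N.
  lra.
have U : e * \sum_(k < N.+1) q (k.+1%:R * e) <= Psi (N.+1%:R * e) - Psi e + M * e.
  elim: N => [|N ih].
    rewrite mul1r subrr big_ord1 mul1r add0r mulrC ler_wpM2r ?(ltW e0)//.
    by have /andP[] := q_bound (ltW e0).
  rewrite big_ord_recr/= mulrDr; have /andP[h _] := step N.
  lra.
have -> : Psi (N.+1%:R * e) - Psi e + 2 * M * e = M * e + (Psi (N.+1%:R * e) - Psi e + M * e) by ring.
rewrite big_ord_recl mulrDr lerD//.
  by rewrite mul0r mulrC ler_wpM2r ?(ltW e0)//; have /andP[] := q_bound (lexx 0).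
apply: le_trans U; rewrite ler_wpM2l ?(ltW e0)// big_ord_recr/= lerDl.
by have /andP[] : 0 <= q (N.+1%:R * e) <= M by apply: q_bound; rewrite mulr_ge0// (ltW e0).
Qed.

Lemma riemann_sum_cvg (e : nat -> R) (N : nat -> nat) :
  (forall n, 0 < e n) -> (forall n, (0 < N n)%N) ->
  e @ \oo --> (0:R) -> (fun n => (N n)%:R * e n) @ \oo --> +oo ->
  (fun n => e n * \sum_(k < N n) q (k%:R * e n)) @ \oo --> L.
Proof.
move=> e0 N0 ec Nc.
have c1 : (fun n => Psi (e n)) @ \oo --> (0:R).
  by apply: (cvg_at_rightP Psi 0 0).1 => //; split.
have c2 : (fun n => Psi ((N n)%:R * e n)) @ \oo --> L by exact: (cvg_comp _ _ Nc Psi_cvgy).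
have c3 : (fun n => Psi ((N n)%:R * e n) - Psi (e n)) @ \oo --> L.
  by rewrite -[L]subr0; apply: cvgB.
apply: (squeeze_cvgr _ c3 (_ : (fun n => Psi ((N n)%:R * e n) - Psi (e n) + 2 * M * e n) @ \oo --> L)).
  by apply: nearW => n; exact: riemann_sum_bounds.
by rewrite -[L]addr0 -[X in L + X](mulr0 (2 * M)); apply: cvgD => //; apply: cvgMr.
Qed.

End MonotoneRiemannSums.

(** [Psi] is strictly increasing, hence 0 <= Psi 1 < Psi 2 <= L. Applied to the weight primitives,
    this shows that the Beta constants are positive. *)
Lemma primitive_limit_gt0 (R : realType) (Psi q : R -> R) (L : R) :
  (forall v : R, 0 < v -> is_derive v 1 Psi (q v)) ->
  (forall v : R, 0 < v -> 0 < q v) ->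
  Psi v @[v --> (0:R)^'+] --> (0:R) -> Psi v @[v --> +oo] --> L -> 0 < L.
Proof.
move=> dPsi q0 c0 cy.
have mono (u v : R) : 0 < u -> u < v -> Psi u < Psi v.
  move=> u0 uv; have hc : {within `[u, v], continuous Psi}.
    apply: derivable_within_continuous => x; rewrite in_itv/= => /andP[ux _].
    by have [] := dPsi _ (lt_le_trans u0 ux).
  have hd x : x \in `]u, v[%R -> is_derive x 1 Psi (q x).
    by rewrite in_itv/= => /andP[ux _]; apply: dPsi; exact: lt_trans ux.
  have [c] := MVT uv hd hc; rewrite in_itv/= => /andP[uc cv] e.
  by rewrite -subr_gt0 e mulr_gt0 ?subr_gt0// q0// (lt_trans u0).
have p1 : 0 <= Psi 1.
  rewrite -(cvg_lim (@Rhausdorff R) c0); apply: limr_le; first exact: cvgP c0.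
  near=> v; apply/ltW/mono; first by near: v; exact: nbhs_right_gt.
  by near: v; exact: nbhs_right_lt.
have p2 : Psi 2 <= L.
  rewrite -(cvg_lim (@Rhausdorff R) cy); apply: limr_ge; first exact: cvgP cy.
  near=> v; apply/ltW/mono => //; near: v; exact: nbhs_pinfty_gt.
have := mono 1 2 ltr01; rewrite ltr1n => /(_ isT) h.
exact: le_lt_trans p1 (lt_le_trans h p2).
Unshelve. all: by end_near.
Qed.

(** * Primitives of the filter weights through incomplete Beta functions *)

Section WeightPrimitives.
Context {R : realType} (d : nat).
Hypothesis d_gt0 : (0 < d)%N.
Let m := (2 * d)%N.
Let a : R := m%:R^-1.
Implicit Types v : R.

Let m0 : (0 < m)%N. Proof. by rewrite /m muln_gt0. Qed.
Let mR : 0 < m%:R :> R. Proof. by rewrite ltr0n. Qed.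
Let a0 : 0 < a. Proof. by rewrite invr_gt0. Qed.
Let a2 : a <= 2^-1.
Proof. by rewrite lef_pV2 ?posrE// ler_nat /m leq_pmulr. Qed.

Definition coweight v : R := 1 - weight d v.

Lemma coweightE v : coweight v = v ^+ m * weight d v.
Proof. by rewrite /coweight weight_compl. Qed.

Lemma coweight01 v : 0 < v -> 0 < coweight v < 1.
Proof.
move=> v0; rewrite coweightE mulr_gt0 ?exprn_gt0 ?weight_gt0//=.
by rewrite weight_compl gtrBl weight_gt0.
Qed.

Lemma coweight_derive v : 0 < v ->
  is_derive v 1 coweight (m%:R * v ^+ m.-1 * weight d v ^+ 2).
Proof.
move=> v0.
have h0 : is_derive v 1 (fun x : R => 1 + x ^+ m) (m%:R * v ^+ m.-1).
  have -> : (fun x : R => 1 + x ^+ m) = cst 1 + (@id R) ^+ m.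
    by apply/funext => x; rewrite exprfctE.
  by apply: is_derive_eq; rewrite add0r /GRing.scale/= mulr1.
have nz : 1 + v ^+ m != 0 by rewrite gt_eqF// weight_den_gt0.
have h1 := @is_deriveV R (fun x : R => 1 + x ^+ m) v _ 1 nz h0.
have -> : coweight = cst 1 - (fun y : R => (1 + y ^+ m)^-1) by [].
apply: is_derive_eq; rewrite sub0r scaleNr opprK /GRing.scale/= mulrC.
by rewrite /weight exprVn.
Qed.

Lemma coweight_cvg0 : coweight v @[v --> (0:R)^'+] --> (0:R).
Proof.
have hid : (fun v : R => v) @ (0:R)^'+ --> (0:R) by apply: cvg_at_right_filter; exact: cvg_id.
apply: (squeeze_cvgr _ (cvg_cst (0:R)) hid).
near=> v; have v0 : 0 < v by near: v; exact: nbhs_right_gt.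
have v1 : v < 1 by near: v; exact: nbhs_right_lt.
have /andP[c0 _] := coweight01 v0; rewrite (ltW c0)/= coweightE.
apply: (@le_trans _ _ (v ^+ m)).
  by rewrite -[leRHS]mulr1 ler_wpM2l ?weight_le1// exprn_ge0// ltW.
rewrite -[leRHS]expr1; apply: ler_wiXn2l; [exact: ltW|exact: ltW|exact: m0].
Unshelve. all: by end_near.
Qed.

Lemma coweight_cvgy : coweight v @[v --> +oo] --> (1:R)^'-.
Proof.
move=> A [e /= e0 he]; rewrite -[_ A]/(\forall v \near +oo, A (coweight v)); near=> v.
have v0 : 0 < v by near: v; exact: nbhs_pinfty_gt.
have ve : e^-1 < v by near: v; apply: nbhs_pinfty_gt; rewrite num_real.
have /andP[c0 c1] := coweight01 v0; apply: he => //=.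
rewrite /coweight opprB addrCA subrr addr0 ger0_norm; last exact/ltW/weight_gt0.
have h : v ^+ 1 * weight d v <= 1 by apply: expr_weight_le1; [exact: ltW|exact: m0].
have {}h : weight d v <= v^-1 by rewrite -[leRHS]mul1r ler_pdivlMr// mulrC -[v]expr1.
by apply: le_lt_trans h _; rewrite invf_plt ?posrE.
Unshelve. all: by end_near.
Qed.

Lemma expr_powR_inv v : 0 < v -> (v ^+ m) `^ a = v.
Proof.
move=> v0; rewrite -powR_mulrn ?ltW// -powRrM mulfV ?gt_eqF// powRr1// ltW//.
Qed.

(* coweight is v^m / (1 + v^m), with derivative m v^(m-1) / (1 + v^m)^2: it turns
   beta densities into the summands below. *)
Definition sqweight_primitive v : R := a * beta_primitive a (2 - a) (coweight v).
Definition gapweight_primitive v : R := a * beta_primitive (1 + a) (1 - a) (coweight v).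

Lemma beta_density_coweight (r t v : R) : 0 < v ->
  beta_density r t (coweight v) = (v ^+ m) `^ (r - 1) * weight d v `^ (t - 1 + (r - 1)).
Proof.
move=> v0; rewrite /beta_density {2}/coweight opprB addrCA subrr addr0 coweightE.
have w0 := weight_gt0 d v.
rewrite powRM ?exprn_ge0 ?(ltW v0) ?(ltW w0)//.
by rewrite (addrC (t - 1)) (@powRD _ _ (r - 1)) ?mulrA// (gt_eqF w0) implybT.
Qed.

Lemma sqweight_primitive_derive v : 0 < v ->
  is_derive v 1 sqweight_primitive (weight d v ^+ 2).
Proof.
move=> v0.
have h : is_derive v 1 (beta_primitive a (2 - a) \o coweight)
   (beta_density a (2 - a) (coweight v) * (m%:R * v ^+ m.-1 * weight d v ^+ 2)).
  apply: is_derive1_comp; last exact: coweight_derive.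
  apply: beta_primitive_derive; [exact: a0|by have := a2; lra|exact: coweight01].
suff -> : weight d v ^+ 2 = a * (beta_density a (2 - a) (coweight v) * (m%:R * v ^+ m.-1 * weight d v ^+ 2)).
  exact: is_deriveZ.
rewrite beta_density_coweight// -/a.
(* The two Beta parameters add up to 2, so the density leaves no power of [weight]; as a = 1/m, the
   remaining factor (v^m)^(a-1) is v / v^m. *)
have -> : (2 - a - 1) + (a - 1) = 0 by ring.
rewrite powRr0 powRB; last by rewrite (gt_eqF (exprn_gt0 m v0)) implybT.
rewrite expr_powR_inv// powRr1; last by rewrite exprn_ge0// ltW.
have -> : v ^+ m = v * v ^+ m.-1 by rewrite -exprS prednK.
rewrite /a; field.
by rewrite !gt_eqF//= ?exprn_gt0.
Qed.

Lemma gapweight_primitive_derive v : 0 < v ->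
  is_derive v 1 gapweight_primitive (weight d v - weight d v ^+ 2).
Proof.
move=> v0.
have h : is_derive v 1 (beta_primitive (1 + a) (1 - a) \o coweight)
   (beta_density (1 + a) (1 - a) (coweight v) * (m%:R * v ^+ m.-1 * weight d v ^+ 2)).
  apply: is_derive1_comp; last exact: coweight_derive.
  by apply: beta_primitive_derive; [have := a0; lra|have := a2; lra|exact: coweight01].
suff -> : weight d v - weight d v ^+ 2 = a * (beta_density (1 + a) (1 - a) (coweight v) * (m%:R * v ^+ m.-1 * weight d v ^+ 2)).
  exact: is_deriveZ.
rewrite beta_density_coweight//.
have -> : (1 - a - 1) + (1 + a - 1) = 0 by ring.
have -> : 1 + a - 1 = a by ring.
rewrite powRr0 expr_powR_inv//.
have -> : weight d v - weight d v ^+ 2 = (v ^+ m * weight d v) * weight d v.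
  by rewrite weight_compl; ring.
have -> : v ^+ m = v * v ^+ m.-1 by rewrite -exprS prednK.
rewrite /a; field.
by rewrite !gt_eqF.
Qed.

Lemma sqweight_primitive_cvg0 : sqweight_primitive v @[v --> (0:R)^'+] --> (0:R).
Proof.
rewrite -[X in _ --> X](mulr0 a); apply: cvgMr.
apply: (cvg_comp _ _ coweight_cvg0).
apply: beta_primitive_cvg0; [exact: a0|by have := a2; lra].
Qed.

Lemma gapweight_primitive_cvg0 : gapweight_primitive v @[v --> (0:R)^'+] --> (0:R).
Proof.
rewrite -[X in _ --> X](mulr0 a); apply: cvgMr.
apply: (cvg_comp _ _ coweight_cvg0).
by apply: beta_primitive_cvg0; [have := a0|have := a2]; lra.
Qed.

Lemma sqweight_primitive_cvgy : sqweight_primitive v @[v --> +oo] --> a * Beta a (2 - a).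
Proof.
apply: cvgMr; apply: (cvg_comp _ _ coweight_cvgy).
apply: beta_primitive_cvg1; [exact: a0|by have := a2; lra].
Qed.

Lemma gapweight_primitive_cvgy : gapweight_primitive v @[v --> +oo] --> a * Beta (1 + a) (1 - a).
Proof.
apply: cvgMr; apply: (cvg_comp _ _ coweight_cvgy).
by apply: beta_primitive_cvg1; [have := a0|have := a2]; lra.
Qed.

End WeightPrimitives.

(** Reflection maps the second half of the indices onto 1, ..., n/2. What is left over is -t(0),
    together with the middle term when [n] is even; both lie between 0 and 1 in absolute value and
    have opposite signs. *)
Lemma sum_symmetric_half (R : realFieldType) (t : nat -> R) n :
  (forall k, 0 <= t k <= 1) -> (forall k, (k <= n)%N -> t (n - k)%N = t k) ->
  `|\sum_(k < n) t k - 2 * \sum_(k < uphalf n) t k| <= 1.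
Proof.
move=> t01 sym; set N := uphalf n.
have Nn : (N <= n)%N by rewrite /N uphalf_half; lia.
rewrite -!(big_mkord xpredT t) (big_cat_nat (leq0n N) Nn)/=.
have -> : \sum_(N <= k < n) t k = \sum_(0 <= i < n - N) t i.+1.
  rewrite -{1}[N]add0n big_addn big_nat_rev/= add0n.
  apply: eq_big_nat => i /andP[_ iN]; rewrite -sym; last by lia.
  by congr t; lia.
have nN : (n - N = n./2)%N by rewrite /N uphalf_half; lia.
have tele h : \sum_(0 <= i < h) t i.+1 = \sum_(0 <= i < h.+1) t i - t 0%N.
  by rewrite [in RHS]big_nat_recl//= addrAC subrr add0r.
rewrite nN tele; have /andP[a0 a1] := t01 0%N.
have [e|e] : N = n./2 \/ N = n./2.+1 by rewrite /N uphalf_half; lia.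
  rewrite e big_nat_recr//=; have /andP[b0 b1] := t01 n./2.
  by rewrite ler_norml; apply/andP; split; lra.
by rewrite e ler_norml; apply/andP; split; lra.
Qed.

(** * Limits of the sums of filter weights *)

Section SpectralSums.
Context {R : realType} (d : nat).
Hypothesis d_gt0 : (0 < d)%N.

Definition weight_sum j n (b : R) : R :=
  \sum_(k < n.+1) weight d (b * cfreq n k) ^+ j.

Lemma cfreq_sym n k : (k <= n.+1)%N -> cfreq n (n.+1 - k) = cfreq n k :> R.
Proof.
move=> kn; rewrite /cfreq; congr (2 * _); rewrite /freq natrB//.
have -> : pi * (n.+1%:R - k%:R) / n.+1%:R = - (pi * k%:R / n.+1%:R) + pi :> R.
  by field; rewrite ?nat1r ?natr1 pnatr_eq0.
by rewrite sinDpi sinN opprK.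
Qed.

Lemma freq_le_pihalf n k : (k < uphalf n.+1)%N -> 0 <= (freq n.+1 k : R) <= pi / 2.
Proof.
move=> kn; rewrite /freq; apply/andP; split.
  by rewrite divr_ge0// mulr_ge0// pi_ge0.
rewrite ler_pdivrMr// -mulrA ler_pM2l ?pi_gt0// ler_pdivlMl// -natrM ler_nat.
by move: kn; rewrite uphalf_half; lia.
Qed.

Lemma exprB_unit_le (x y : R) j : 0 <= y -> y <= x -> x <= 1 ->
  0 <= x ^+ j - y ^+ j <= j%:R * (x - y).
Proof.
move=> y0 yx x1; rewrite subr_ge0 lerXn2r ?nnegrE ?(le_trans y0)//=.
apply: le_trans (exprB_le _ y0 yx) _.
rewrite ler_wpM2r ?subr_ge0// -[leRHS]mulr1 ler_wpM2l// exprn_ile1// (le_trans y0) //.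
Qed.

(** Folding leaves the angles at most pi/2, where the sine is comparable to its argument. The sine
    error is then added over at most n + 1 frequencies. *)
Lemma weight_sum_riemann_close j n (b : R) : 0 < b ->
  `|weight_sum j n b -
    2 * \sum_(k < uphalf n.+1) weight d (k%:R * (2 * pi * b / n.+1%:R)) ^+ j| <=
  1 + 2 * (n.+1%:R * (j%:R * ((4 * d)%:R / b ^+ 2))).
Proof.
move=> b0; set t := fun k => weight d (b * cfreq n k) ^+ j.
have t01 k : 0 <= t k <= 1.
  by rewrite /t exprn_ge0 ?exprn_ile1// ?weight_le1// ltW// weight_gt0.
have h1 : `|weight_sum j n b - 2 * \sum_(k < uphalf n.+1) t k| <= 1.
  by apply: sum_symmetric_half => // k kn; rewrite /t cfreq_sym.
apply: le_trans (ler_distD _ _ _) (lerD h1 _).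
rewrite -mulrBr normrM ger0_norm// ler_wpM2l// -sumrB.
apply: le_trans (ler_norm_sum _ _ _) _.
apply: (@le_trans _ _ (\sum_(k < uphalf n.+1) (j%:R * ((4 * d)%:R / b ^+ 2)))).
  apply: ler_sum => k _; have /andP[f0 f1] := freq_le_pihalf (ltn_ord k).
  have -> : k%:R * (2 * pi * b / n.+1%:R) = b * (2 * freq n.+1 k).
    by rewrite /freq; ring.
  have /andP[w0 w1] := weight_sin_close d_gt0 b0 f0 f1.
  rewrite subr_ge0 in w0.
  have wz := ltW (weight_gt0 d (b * (2 * freq n.+1 k))).
  have /andP[g0 g1] := exprB_unit_le j wz w0 (weight_le1 _ _).
  by rewrite ger0_norm// (le_trans g1)// ler_wpM2l.
rewrite sumr_const card_ord -[leLHS]mulr_natl ler_wpM2r ?ler_nat//.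
  by rewrite mulr_ge0// divr_ge0// exprn_ge0// ltW.
by rewrite uphalf_half; lia.
Qed.

(** The mesh is 2 pi b / (n + 1); against the 2 from folding it leaves the factor 1/pi. Multiplied
    by b / (n + 1), the approximation error becomes b / (n + 1) plus a constant over b, which
    explains the two growth conditions. *)
Lemma weight_sum_cvg j (Psi : R -> R) (L : R) (b : nat -> R) :
  (forall v : R, 0 < v -> is_derive v 1 Psi (weight d v ^+ j)) ->
  Psi v @[v --> (0:R)^'+] --> (0:R) -> Psi v @[v --> +oo] --> L ->
  (forall n, 0 < b n) -> b @ \oo --> +oo ->
  (fun n => b n / n.+1%:R) @ \oo --> (0:R) ->
  (fun n => b n / n.+1%:R * weight_sum j n (b n)) @ \oo --> L / pi.
Proof.
move=> dPsi c0 cy b0 bc bn.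
pose e n := 2 * pi * b n / n.+1%:R.
pose N n := uphalf n.+1.
have e0 n : 0 < e n by rewrite divr_gt0// !mulr_gt0 ?pi_gt0.
have ec : e @ \oo --> (0:R).
  have -> : e = fun n => (2 * pi) * (b n / n.+1%:R) by apply/funext => n; rewrite /e mulrA.
  by rewrite -[X in _ --> X](mulr0 (2 * pi)); apply: cvgMr.
have Nc : (fun n => (N n)%:R * e n) @ \oo --> +oo.
  apply/cvgryPge => A; move/cvgryPge : bc => /(_ A); apply: filterS => n An.
  apply: le_trans An _; rewrite /e.
  have p1 : 1 <= pi :> R by apply: le_trans (pi_ge2 R); rewrite ler1n.
  have hN : n.+1%:R <= 2 * (N n)%:R :> R.
    by rewrite -natrM ler_nat /N uphalf_half; lia.
  rewrite mulrA ler_pdivlMr//.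
  have -> : (N n)%:R * (2 * pi * b n) = (2 * (N n)%:R * pi) * b n by ring.
  by rewrite mulrC ler_pM2r// -[leLHS]mulr1 ler_pM.
have rs : (fun n => e n * \sum_(k < N n) weight d (k%:R * e n) ^+ j) @ \oo --> L.
  apply: (@riemann_sum_cvg _ Psi (fun v => weight d v ^+ j) 1) => //.
  - move=> u v u0 uv; rewrite lerXn2r ?nnegrE ?(ltW (weight_gt0 _ _))//.
    exact: weight_nonincreasing.
  - by move=> v _; rewrite exprn_ge0 ?exprn_ile1 ?weight_le1// (ltW (weight_gt0 _ _)).
have err : (fun n => b n / n.+1%:R * weight_sum j n (b n) -
    pi^-1 * (e n * \sum_(k < N n) weight d (k%:R * e n) ^+ j)) @ \oo --> (0:R).
  apply/norm_cvg0P.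
  apply: (squeeze_cvgr _ (cvg_cst (0:R)) (_ : (fun n => b n / n.+1%:R +
     2 * j%:R * (4 * d)%:R * (b n)^-1) @ \oo --> (0:R))); last first.
    rewrite -[X in _ --> X]addr0 -[X in _ + X](mulr0 (2 * j%:R * (4 * d)%:R)).
    by apply: cvgD => //; apply: cvgMr; apply/(gtr0_cvgV0 (nearW _ b0)).
  apply: nearW => n; rewrite normr_ge0/=.
  have q0 : 0 <= b n / n.+1%:R by rewrite divr_ge0// ltW.
  have -> : b n / n.+1%:R * weight_sum j n (b n) -
    pi^-1 * (e n * \sum_(k < N n) weight d (k%:R * e n) ^+ j) =
    b n / n.+1%:R * (weight_sum j n (b n) - 2 * \sum_(k < N n) weight d (k%:R * e n) ^+ j).
    rewrite {1}/e; have p0 : pi != 0 :> R by rewrite gt_eqF// pi_gt0.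
    have n0 : n.+1%:R != 0 :> R by rewrite pnatr_eq0.
    set sm := \sum_(_ < _) _; set W := weight_sum _ _ _; clearbody sm W.
    by move: (pi) p0 (n.+1%:R) n0 => p p0 nn n0; field; rewrite p0 n0.
  rewrite normrM ger0_norm//.
  apply: le_trans (ler_wpM2l q0 (weight_sum_riemann_close j n (b0 n))) _.
  rewrite mulrDr mulr1 lerD2l le_eqVlt; apply/orP; left; apply/eqP.
  by field; rewrite ?nat1r ?natr1 pnatr_eq0/= gt_eqF.
have -> : (fun n => b n / n.+1%:R * weight_sum j n (b n)) =
  (fun n => (b n / n.+1%:R * weight_sum j n (b n) -
    pi^-1 * (e n * \sum_(k < N n) weight d (k%:R * e n) ^+ j)) +
    pi^-1 * (e n * \sum_(k < N n) weight d (k%:R * e n) ^+ j)).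
  by apply/funext => n; rewrite subrK.
rewrite -[L / pi]add0r mulrC; apply: cvgD => //; exact: cvgMr.
Qed.

Definition variance_constant : R := Beta (2 * d)%:R^-1 (2 - (2 * d)%:R^-1) / ((2 * d)%:R * pi).
Definition bias_constant : R := Beta (1 + (2 * d)%:R^-1) (1 - (2 * d)%:R^-1) / ((2 * d)%:R * pi).

Variable b : nat -> R.
Hypothesis b_gt0 : forall n, 0 < b n.
Hypothesis b_cvg : b @ \oo --> +oo.
Hypothesis b_small : (fun n => b n / n.+1%:R) @ \oo --> (0:R).

Lemma weight_sum2_cvg :
  (fun n => b n / n.+1%:R * weight_sum 2 n (b n)) @ \oo --> variance_constant.
Proof.
have -> : variance_constant = (2 * d)%:R^-1 * Beta (2 * d)%:R^-1 (2 - (2 * d)%:R^-1) / pi.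
  by rewrite /variance_constant invfM mulrA [_ * Beta _ _]mulrC.
apply: (@weight_sum_cvg _ (sqweight_primitive d)) => //.
- by move=> v v0; exact: sqweight_primitive_derive.
- exact: sqweight_primitive_cvg0.
- exact: sqweight_primitive_cvgy.
Qed.

(** Splitting w = w^2 + (w - w^2) makes the sum of the two Beta primitives a primitive of w. *)
Lemma weight_sum1_cvg :
  (fun n => b n / n.+1%:R * weight_sum 1 n (b n)) @ \oo --> variance_constant + bias_constant.
Proof.
have -> : variance_constant + bias_constant = ((2 * d)%:R^-1 * Beta (2 * d)%:R^-1 (2 - (2 * d)%:R^-1) +
  (2 * d)%:R^-1 * Beta (1 + (2 * d)%:R^-1) (1 - (2 * d)%:R^-1)) / pi.
  by rewrite /variance_constant /bias_constant invfM !mulrA ![Beta _ _ * _]mulrC mulrDl.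
apply: (@weight_sum_cvg _ (sqweight_primitive d \+ gapweight_primitive d)) => //.
- move=> v v0; have h1 := sqweight_primitive_derive d_gt0 v0.
  have h2 := gapweight_primitive_derive d_gt0 v0.
  have := is_deriveD h1 h2; rewrite addrCA subrr addr0 //.
- rewrite -[X in _ --> X]addr0; apply: cvgD.
    exact: sqweight_primitive_cvg0.
  exact: gapweight_primitive_cvg0.
- by apply: cvgD; [exact: sqweight_primitive_cvgy|exact: gapweight_primitive_cvgy].
Qed.

End SpectralSums.

Lemma variance_constant_gt0 (R : realType) d : (0 < d)%N -> 0 < variance_constant d :> R.
Proof.
move=> d0; have m0 : 0 < (2 * d)%:R :> R by rewrite ltr0n muln_gt0.
suff : 0 < (2 * d)%:R^-1 * Beta (2 * d)%:R^-1 (2 - (2 * d)%:R^-1) :> R.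
  by rewrite pmulr_rgt0 ?invr_gt0// => h; rewrite divr_gt0// mulr_gt0// pi_gt0.
apply: primitive_limit_gt0 (sqweight_primitive_derive d0) _ (sqweight_primitive_cvg0 d0) (sqweight_primitive_cvgy d0).
by move=> v _; rewrite exprn_gt0// weight_gt0.
Qed.

Lemma bias_constant_gt0 (R : realType) d : (0 < d)%N -> 0 < bias_constant d :> R.
Proof.
move=> d0; have m0 : 0 < (2 * d)%:R :> R by rewrite ltr0n muln_gt0.
suff : 0 < (2 * d)%:R^-1 * Beta (1 + (2 * d)%:R^-1) (1 - (2 * d)%:R^-1) :> R.
  by rewrite pmulr_rgt0 ?invr_gt0// => h; rewrite divr_gt0// mulr_gt0// pi_gt0.
apply: primitive_limit_gt0 (gapweight_primitive_derive d0) _ (gapweight_primitive_cvg0 d0) (gapweight_primitive_cvgy d0).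
move=> v v0; have -> : weight d v - weight d v ^+ 2 = (v ^+ (2 * d) * weight d v) * weight d v.
  by rewrite weight_compl; ring.
by rewrite !mulr_gt0 ?weight_gt0// exprn_gt0.
Qed.

(** * The risk as a trace *)

Section IndependentExpectation.
Context {disp : measure_display} {T : measurableType disp} {R : realType}.
Variable P : probability T R.

(* The product rule identifies the joint law of (X, Y) with the product of the
   laws, so that Fubini applies. *)
Lemma expectationM_indep (X Y : {RV P >-> R}) :
  (X : T -> R) \in Lfun P 2%:E -> (Y : T -> R) \in Lfun P 2%:E ->
  (forall A B : set R, measurable A -> measurable B ->
     P ((X @^-1` A) `&` (Y @^-1` B)) = (P (X @^-1` A) * P (Y @^-1` B))%E) ->
  'E_P[(X : T -> R) \* Y]%E = ('E_P[X] * 'E_P[Y])%E.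
Proof.
move=> X2 Y2 indep.
have mZ : measurable_fun [set: T] (fun w => (X w, Y w)).
  by apply: measurable_fun_pair; exact: measurable_funPT.
pose Zm := isMeasurableFun.Build _ _ _ _ _ mZ.
pose Z : {RV P >-> (R * R)%type} := MeasurableFun.Pack (MeasurableFun.Class Zm).
pose mX := distribution P X; pose mY := distribution P Y.
have eqm (A : set (R * R)) : measurable A -> (mX \x mY)%E A = distribution P Z A.
  by apply: product_measure_unique => A' B mA mB; exact: indep.
pose f : R * R -> \bar R := fun z => (z.1 * z.2)%:E.
have mf : measurable_fun [set: R * R] f.
  by apply/measurable_EFinP; apply: measurable_funM.
have XY1 : P.-integrable [set: T] (f \o Z).
  by apply/Lfun1_integrable; exact: Lfun2_mul_Lfun1.
have eqi g : (\int[(mX \x mY)%E]_z g z = \int[distribution P Z]_z g z)%E.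
  by apply: eq_measure_integral => A mA _; exact: eqm.
have fi : (mX \x mY)%E.-integrable [set: R * R] f.
  apply/integrableP; split => //; rewrite eqi.
  by have /integrableP[] := integrable_pushforward mZ mf XY1 measurableT.
have X1 : P.-integrable [set: T] (EFin \o X).
  by apply/Lfun1_integrable; apply: Lfun_subset12 X2; exact: fin_num_measure.
have Y1 : P.-integrable [set: T] (EFin \o Y).
  by apply/Lfun1_integrable; apply: Lfun_subset12 Y2; exact: fin_num_measure.
have EX : (\int[mX]_x x%:E = 'E_P[X])%E.
  by rewrite unlock integral_distribution//; exact/measurable_EFinP.
have EY : (\int[mY]_x x%:E = 'E_P[Y])%E.
  by rewrite unlock integral_distribution//; exact/measurable_EFinP.
have finY : ('E_P[Y] \is a fin_num)%E by rewrite unlock integrable_fin_num.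
have iX : mX.-integrable [set: R] EFin.
  by apply: (integrable_pushforward _ _ X1 measurableT) => //; exact/measurable_EFinP.
have iY : mY.-integrable [set: R] EFin.
  by apply: (integrable_pushforward _ _ Y1 measurableT) => //; exact/measurable_EFinP.
transitivity (\int[(mX \x mY)%E]_z f z)%E.
  rewrite eqi integral_distribution// unlock.
  by apply: eq_integral.
rewrite -(integral12_prod_meas1 fi)/=.
transitivity (\int[mX]_x (x%:E * 'E_P[Y]))%E.
  apply: eq_integral => x _; rewrite /fubini_F/= -EY -integralZl//.
by rewrite -(fineK finY) integralZr// EX.
Qed.

(** The square expands into finitely many integrable products. A one-point [I] yields the positivity
    of covariance matrices, the full set of coordinates yields the risk. *)
Lemma expectation_sum_sq (I J : finType) (a : I -> J -> R) (U : J -> T -> R)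
    (c : J -> J -> R) :
  (forall j, U j \in Lfun P 2%:E) ->
  (forall j k, 'E_P[U j \* U k]%E = (c j k)%:E) ->
  'E_P[fun w => (\sum_i (\sum_j a i j * U j w) ^+ 2)%R]%E =
  (\sum_i \sum_j \sum_k a i j * a i k * c j k)%:E.
Proof.
move=> U2 hc.
pose q (p : J * J) := \sum_i a i p.1 * a i p.2.
have iU p : P.-integrable [set: T] (EFin \o (U p.1 \* U p.2)).
  by apply/Lfun1_integrable; exact: Lfun2_mul_Lfun1.
transitivity (\int[P]_w (\sum_(p : J * J) (q p)%:E * (U p.1 w * U p.2 w)%R%:E))%E.
  rewrite unlock; apply: eq_integral => w _.
  under [RHS]eq_bigr do rewrite -EFinM.
  rewrite sumEFin; congr EFin.
  rewrite -(pair_bigA _ (fun j k => q (j, k) * (U j w * U k w)))/=.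
  transitivity (\sum_i \sum_j \sum_k a i j * a i k * (U j w * U k w)).
    apply: eq_bigr => i _; rewrite expr2 mulr_suml; apply: eq_bigr => j _.
    by rewrite mulr_sumr; apply: eq_bigr => k _; ring.
  rewrite exchange_big/=; apply: eq_bigr => j _; rewrite exchange_big/=.
  by apply: eq_bigr => k _; rewrite /q/= mulr_suml.
rewrite integral_sum//; last by move=> p; apply: integrableZl => //; exact: iU.
transitivity (\sum_(p : J * J) (q p * c p.1 p.2)%R%:E)%E.
  apply: eq_bigr => p _; rewrite integralZl//; last exact: iU.
  by rewrite EFinM -hc unlock.
rewrite sumEFin; congr EFin.
rewrite -(pair_bigA _ (fun j k => q (j, k) * c j k))/=.
rewrite [RHS]exchange_big/=; apply: eq_bigr => j _; rewrite [RHS]exchange_big/=.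
by apply: eq_bigr => k _; rewrite /q/= mulr_suml.
Qed.

End IndependentExpectation.

(** * The penalized estimate as a linear smoother *)

Section IteratedDifferences.
Context {R : realType}.

(** The [j]-th difference at [t] reads only the times t - j, ..., t, all at least 1, so the
    truncated predecessor at 0 is never reached. *)
Lemma iter_nabla_ext (f g : nat -> R) j t : (j < t)%N ->
  (forall s, (1 <= s <= t)%N -> f s = g s) -> iter j nabla f t = iter j nabla g t.
Proof.
elim: j t => [|j ih] t jt fg; first by apply: fg; rewrite leqnn andbT.
rewrite !iterS /nabla (ih t (ltnW jt) fg) (ih t.-1)//; first by case: t jt {fg}.
by move=> s /andP[s1 st]; apply: fg; rewrite s1 (leq_trans st)// leq_pred.
Qed.

Lemma coordS n (x : 'cV[R]_n) (i : 'I_n) : Defs.coord x i.+1 = x i 0.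
Proof. by rewrite /Defs.coord/= valK. Qed.

Variables (n d : nat).

Lemma cdiffX_mulE j (x : 'cV[R]_n.+1) (i : 'I_n.+1) : (j <= i)%N ->
  (cdiff n ^+ j *m x) i 0 = iter j nabla (Defs.coord x) i.+1.
Proof.
elim: j i => [|j ih] i ji; first by rewrite expr0 mul1mx /= coordS.
rewrite exprS -[_ * _]/(cdiff n *m (cdiff n ^+ j)) -mulmxA iterS /nabla/=.
rewrite {1}/cdiff mulmxBl mul1mx [LHS]mxE [X in _ + X]mxE cshift_mul ih ?(ltnW ji)//.
have ip : ord_pred i = i.-1 :> nat.
  rewrite /=; have := ltn_ord i; case: (i : nat) ji => // k _ kn.
  by rewrite addSn/= modnDr modn_small// ltnW.
rewrite ih; last by rewrite ip; lia.
by rewrite ip prednK//; lia.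
Qed.

Lemma keep_mulE j (x : 'cV[R]_n.+1) i : (keep n j *m x) i 0 = if (j <= i)%N then x i 0 else 0.
Proof. by rewrite /keep mul_diag_mx !mxE; case: ifP; rewrite ?mul1r ?mul0r. Qed.

Lemma kept_diff_mulE (x : 'cV[R]_n.+1) (i : 'I_n.+1) :
  (kept_diff n d d *m x) i 0 = if (d <= i)%N then iter d nabla (Defs.coord x) i.+1 else 0.
Proof.
rewrite /kept_diff -mulmxA keep_mulE; case: ifP => // di.
by rewrite cdiffX_mulE.
Qed.

Lemma pls_criterionE nu (y m : 'cV[R]_n.+1) : pls_criterion d nu y m =
  bform 1%:M (y - m) (y - m) + nu * bform 1%:M (kept_diff n d d *m m) (kept_diff n d d *m m).
Proof.
rewrite /pls_criterion !bform1E; congr (_ + nu * _).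
  rewrite big_add1/= big_mkord; apply: eq_bigr => i _.
  by rewrite !coordS !mxE expr2.
under [RHS]eq_bigr do rewrite kept_diff_mulE.
rewrite big_add1/= -(big_mkord xpredT (fun i => (if (d <= i)%N then iter d nabla (Defs.coord m) i.+1 else 0) *
   (if (d <= i)%N then iter d nabla (Defs.coord m) i.+1 else 0))).
(* If d > n + 1, no difference of order [d] fits into the sample and both penalties vanish. *)
have [dn|dn] := leqP d n.+1; last first.
  rewrite big_geq ?(ltnW dn)// big_nat big1// => i /andP[_ i_n].
  by rewrite leqNgt (leq_trans i_n (ltnW dn))/= mul0r.
rewrite [RHS](big_cat_nat (leq0n d) dn)/= [X in _ = X + _]big_nat [X in _ = X + _]big1 ?add0r.
  by apply: eq_big_nat => i /andP[di _]; rewrite di expr2.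
by move=> i /andP[_ id]; rewrite leqNgt id mul0r.
Qed.

(** The completed square exhibits the smoother output as the only minimizer, so [xget] returns it
    and not its default. *)
Lemma pls_estimateE nu (y : 'cV[R]_n.+1) : 0 < nu ->
  pls_estimate d nu y = ridge (kept_diff n d d) nu *m y.
Proof.
move=> nu0; set h := ridge _ _ *m y.
have crit m : pls_criterion d nu y m = pls_criterion d nu y h +
   (bform 1%:M (m - h) (m - h) + nu * bform 1%:M (kept_diff n d d *m (m - h)) (kept_diff n d d *m (m - h))).
  by rewrite !pls_criterionE ridge_complete_square.
apply: xget_unique.
  move=> m /=; rewrite (crit m) lerDl addr_ge0 ?bform1_ge0//.
  by rewrite mulr_ge0 ?bform1_ge0// ltW.
move=> m /= /(_ h); rewrite (crit m) gerDl => le0.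
apply/eqP; rewrite -subr_eq0; apply/eqP; apply: bform1_eq0.
have b1 := bform1_ge0 (m - h); have b2 := bform1_ge0 (kept_diff n d d *m (m - h)).
have b3 := mulr_ge0 (ltW nu0) b2.
by apply/eqP; rewrite eq_le b1 andbT; lra.
Qed.

(** From m = H m + nu H S'S m. The trend enters the error only through its differences S m, so its
    polynomial part disappears. *)
Lemma ridge_error nu (S : 'M[R]_n) (m e : 'cV[R]_n) : 0 < nu ->
  ridge S nu *m (m + e) - m = ridge S nu *m e - (nu *: ridge S nu *m S^T) *m (S *m m).
Proof.
move=> nu0; have hp := psd_penalty S (ltW nu0).
rewrite mulmxDr addrAC addrC; congr (_ + _).
rewrite -{2}[m]mul1mx -(resolventK hp) -[resolvent _]/(ridge S nu) mulmxDr mulmx1 mulmxDl.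
by rewrite opprD addrA subrr add0r -scalemxAr -!scalemxAl !mulmxA.
Qed.

End IteratedDifferences.

(** * Exact bias-variance formula *)

Section RiskFormula.
Context {disp : measure_display} {T : measurableType disp} {R : realType}.
Variable P : probability T R.
Variables (d n : nat) (eps mu gamma : nat -> {RV P >-> R}) (rho : int -> R) (v : R).
Let I := fun t => (d.+1 <= t <= n.+1)%N.
Hypothesis heps : mean_zero_stationary eps rho.
Hypothesis hmu : forall t w, I t -> iter d nabla (fun s => mu s w) t = gamma t w.
Hypothesis hgamma_iid : mutually_independent I gamma.
Hypothesis hgamma_var : mean_zero_variance I gamma v.
Hypothesis hind : independent_processes xpredT eps I gamma.

Let Lfun21 (X : T -> R) : X \in Lfun P 2%:E -> X \in Lfun P 1.
Proof. by apply: Lfun_subset12; exact: fin_num_measure. Qed.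

Lemma cov_mean_zero (X Y : T -> R) : X \in Lfun P 2%:E -> Y \in Lfun P 2%:E ->
  ('E_P[X] = 0)%E -> ('E_P[X \* Y] = covariance P X Y)%E.
Proof.
move=> X2 Y2 X0; rewrite covarianceE ?X0 ?mul0e ?sube0//; last exact: Lfun2_mul_Lfun1.
  exact: Lfun21.
exact: Lfun21.
Qed.

Lemma rho_symmetric j : rho (- j) = rho j.
Proof.
have [_ _ hc] := heps; case: j => [j|j].
  have h1 := hc 0%N j; have h2 := hc j 0%N.
  by rewrite covarianceC h2 sub0r subr0 in h1; case: h1.
have h1 := hc 0%N j.+1; have h2 := hc j.+1 0%N.
rewrite NegzE opprK.
by rewrite covarianceC h2 sub0r subr0 in h1; case: h1.
Qed.

Lemma expectation_eps t s : ('E_P[(eps t : T -> R) \* eps s] = (rho (t%:Z - s%:Z))%:E)%E.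
Proof. by have [h1 h2 h3] := heps; rewrite cov_mean_zero// h3. Qed.

Lemma expectation_gamma t s : I t -> I s ->
  ('E_P[(gamma t : T -> R) \* gamma s] = (v * (t == s)%:R)%:E)%E.
Proof.
move=> It Is; have [t1 t2 t3] := hgamma_var It; have [s1 s2 s3] := hgamma_var Is.
have [<-|ts] := eqVneq t s.
  by rewrite cov_mean_zero// mulr1 -t3 /variance.
rewrite expectationM_indep// ?t2 ?s2 ?mul0e ?mulr0// => A B mA mB.
pose C := fun u => if u == t then A else B.
have uq : uniq [:: t; s] by rewrite /= inE ts.
have al : all I [:: t; s] by rewrite /= It Is.
have := hgamma_iid (B := C) uq al; rewrite !big_cons big_nil mule1 /C eqxx eq_sym (negPf ts).
move=> <-; last by move=> u; rewrite /C; case: ifP.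
congr (P _); rewrite /cylinder; apply/seteqP; split => w /=.
  move=> [wA wB] u /=; rewrite !inE => /orP[/eqP->|/eqP->]; rewrite ?eqxx//.
  by rewrite eq_sym (negPf ts).
move=> h; split; first by have := h t; rewrite /= !inE eqxx/=; apply.
by have := h s; rewrite /= !inE eqxx orbT eq_sym (negPf ts); apply.
Qed.

Lemma expectation_eps_gamma t s : I s -> ('E_P[(eps t : T -> R) \* gamma s] = 0)%E.
Proof.
move=> Is; have [h1 h2 h3] := heps; have [s1 s2 s3] := hgamma_var Is.
rewrite expectationM_indep// ?h2 ?mul0e// => A B mA mB.
have al : all I [:: s] by rewrite /= Is.
have := hind (s := [:: t]) (s' := [:: s]) (B := fun=> A) (C := fun=> B) isT al (fun=> mA) (fun=> mB).
have cyl (X : nat -> {RV P >-> R}) u (D : set R) : cylinder X [:: u] (fun=> D) = X u @^-1` D.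
  apply/seteqP; split => w /=; last by move=> h x /=; rewrite inE => /eqP->.
  by move=> h; have := h u; rewrite /= inE eqxx; apply.
by rewrite !cyl.
Qed.

(** The form at [x] is the expectation of the square of the linear combination of errors with
    coefficients [x]. *)
Lemma psd_covmx m : psd (covmx rho m).
Proof.
split; first exact: trmx_covmx rho_symmetric m.
move=> x; have [e1 _ _] := heps.
pose U (t : 'I_m) : T -> R := eps t.
have Uc (t s : 'I_m) : 'E_P[U t \* U s]%E = (rho (t%:Z - s%:Z))%:E.
  exact: expectation_eps.
have := expectation_sum_sq (fun (_ : 'I_1) t => x t 0) (fun t : 'I_m => e1 t) Uc.
rewrite big_ord1 => e; rewrite -lee_fin.
rewrite bformE (_ : \sum_i _ = \sum_j \sum_k x j 0 * x k 0 * rho (j%:Z - k%:Z)).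
  by rewrite -e; apply: expectation_ge0 => w; rewrite big_ord1 sqr_ge0.
by apply: eq_bigr => i _; apply: eq_bigr => j _; rewrite mxE.
Qed.

(** The error is linear in the joint noise (eps, gamma), indexed by a sum type. The mixed
    covariances vanish by independence; each diagonal block yields one trace. *)
Lemma mean_sq_errorE nu : 0 < nu ->
  let H := ridge (kept_diff n d d) nu in
  mean_sq_error d n.+1 mu eps nu =
  (n.+1%:R^-1 * (\tr (H *m H *m covmx rho n.+1) + v * (nu * \tr (H - H *m H))))%:E.
Proof.
move=> nu0 H.
set S := kept_diff n d d in H *; set B := nu *: H *m S^T.
(* Index [t] stands for time t + 1, and [gamma] is constrained only from time d + 1 on. The zeros
   below match the zeroed rows of [S]. *)
pose g (t : 'I_n.+1) : T -> R := if (d <= t)%N then gamma t.+1 else cst 0.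
pose U (j : 'I_n.+1 + 'I_n.+1) : T -> R := match j with inl t => eps t.+1 | inr t => g t end.
pose a (i : 'I_n.+1) (j : 'I_n.+1 + 'I_n.+1) : R := match j with inl t => H i t | inr t => - B i t end.
pose c (j k : 'I_n.+1 + 'I_n.+1) : R := match j, k with
  | inl t, inl s => rho (t%:Z - s%:Z)
  | inr t, inr s => v * ((t == s) && (d <= t)%N)%:R
  | _, _ => 0 end.
have It (t : 'I_n.+1) : (d <= t)%N -> I t.+1 by move=> dt; rewrite /I ltnS dt/=.
have errE w : sq_norm (pls_estimate d nu (vec n.+1 mu w + vec n.+1 eps w) - vec n.+1 mu w) =
   \sum_i (\sum_j a i j * U j w) ^+ 2.
  rewrite pls_estimateE// ridge_error// -/S -/H -/B /sq_norm.
  apply: eq_bigr => i _; congr (_ ^+ 2).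
  rewrite big_sumType/= !mxE; congr (_ + _).
    by apply: eq_bigr => t _; rewrite !mxE.
  rewrite -sumrN; apply: eq_bigr => t _; rewrite mulNr; congr (- (_ * _)).
  rewrite kept_diff_mulE /g; case: ifP => // dt.
  rewrite -hmu ?It//; apply: iter_nabla_ext; first by rewrite ltnS.
  move=> s /andP[s1 st]; have sn : (s.-1 < n.+1)%N by have := ltn_ord t; lia.
  have -> : s = (Ordinal sn).+1 by rewrite /= prednK.
  by rewrite coordS mxE.
rewrite /mean_sq_error; under eq_fun do rewrite errE.
have [e1 e2 e3] := heps.
have U2 j : U j \in Lfun P 2%:E.
  case: j => t; first exact: e1.
  rewrite /= /g; case: ifP => dt; last exact: Lfun_cst.
  by have [] := hgamma_var (It _ dt).
have Uc j k : 'E_P[U j \* U k]%E = (c j k)%:E.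
  have z0 (f : T -> R) : ('E_P[f \* cst 0%R] = 0)%E.
    rewrite (_ : f \* cst 0 = cst 0) ?expectation_cst//.
    by apply/funext => w; rewrite /= mulr0.
  have comm (f h : T -> R) : ('E_P[f \* h] = 'E_P[h \* f])%E.
    by congr expectation; apply/funext => w; rewrite /= mulrC.
  case: j k => [t|t] [s|s] /=.
  - by rewrite expectation_eps; congr (rho _)%:E; lia.
  - by rewrite /g; case: ifP => ds; [rewrite expectation_eps_gamma// It|rewrite z0].
  - rewrite comm /g; case: ifP => ds; [rewrite expectation_eps_gamma// It//|by rewrite z0].
  - rewrite /g; case: ifP => dt; last by rewrite comm z0 andbF mulr0.
    case: ifP => ds; last first.
      by rewrite z0; case: eqP => [ts|]; rewrite ?mulr0//; rewrite ts ds in dt.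
    by rewrite expectation_gamma ?It// eqSS andbT.
rewrite (expectation_sum_sq _ U2 Uc) -EFinM mulrC; congr (_ * _)%:E.
have hp := psd_penalty S (ltW nu0).
have HT : H^T = H by exact: trmx_resolvent.
have B0 i (t : 'I_n.+1) : (d <= t)%N = false -> B i t = 0.
  move=> dt; rewrite mxE big1// => s _.
  by rewrite [S^T s t]mxE /S /kept_diff /keep mul_diag_mx !mxE dt mul0r mulr0.
have -> : \tr (H *m H *m covmx rho n.+1) = \tr (H *m covmx rho n.+1 *m H^T).
  by rewrite HT -mulmxA mxtrace_mulC.
have -> : nu * \tr (H - H *m H) = \tr (B *m B^T).
  have [nHT _] := psdZ (ltW nu0) (psd_resolvent hp).
  have BT : B^T = S *m (nu *: H) by rewrite /B trmx_mul trmxK nHT.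
  by rewrite BT ridge_bias// -/H -(mulmxA (S *m _)) mxtrace_mulC.
rewrite /mxtrace mulr_sumr -big_split/=; apply: eq_bigr => i _.
rewrite big_sumType/=; congr (_ + _).
  rewrite mxE.
  transitivity (\sum_(s < n.+1) \sum_(t < n.+1) H i t * rho (t%:Z - s%:Z) * H i s).
    rewrite [RHS]exchange_big/=; apply: eq_bigr => t _; rewrite big_sumType/=.
    rewrite [X in _ + X]big1 ?addr0; last by move=> s _; rewrite mulr0.
    by apply: eq_bigr => s _; ring.
  apply: eq_bigr => s _; rewrite !mxE mulr_suml; apply: eq_bigr => t _.
  by rewrite !mxE.
rewrite mxE mulr_sumr; apply: eq_bigr => t _; rewrite big_sumType/=.
rewrite big1 ?add0r; last by move=> s _; rewrite mulr0.
rewrite (bigD1 t)//= eqxx/= big1 ?addr0; last first.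
  by move=> s /negPf st; rewrite eq_sym st/= !mulr0.
rewrite [B^T t i]mxE; case dt : (d <= t)%N; last by rewrite (B0 _ _ dt) oppr0 !mul0r mulr0.
by rewrite mulrNN /= mulr1 mulrC.
Qed.

End RiskFormula.

(** * Asymptotics of the traces *)

Section RiskAsymptotics.
Context {R : realType} (d : nat).
Hypothesis d_gt0 : (0 < d)%N.
Variables (rho : int -> R) (A : R).
Hypothesis rho_even : forall j, rho (- j) = rho j.
Hypothesis rho_moment : forall N, \sum_(1 <= j < N) j%:R * `|rho j%:Z| <= A.
Hypothesis rho_psd : forall n, psd (covmx rho n).
Let m := (2 * d)%N.
Let g0 := spectral_function rho 0.

Definition variance_trace n nu : R :=
  \tr (ridge (kept_diff n d d) nu *m ridge (kept_diff n d d) nu *m covmx rho n.+1).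
Definition bias_trace n nu : R :=
  nu * \tr (ridge (kept_diff n d d) nu - ridge (kept_diff n d d) nu *m ridge (kept_diff n d d) nu).
Definition cyclic_variance n b : R :=
  \sum_(k < n.+1) weight d (b * cfreq n k) ^+ 2 * fejer rho n.+1 k.

Lemma filter_weightE n (b : R) k : filter_weight n d (b ^+ m) k = weight d (b * cfreq n k).
Proof. by rewrite /filter_weight -exprMn. Qed.

Lemma variance_trace_close n (b : R) : 0 < b ->
  `|variance_trace n (b ^+ m) - cyclic_variance n b| <=
  6 * (`|rho 0| + 2 * A) * d%:R.
Proof.
move=> b0; have nu0 : 0 <= b ^+ m by rewrite exprn_ge0// ltW.
have s0 : 0 <= `|rho 0| + 2 * A.
  by rewrite addr_ge0// mulr_ge0// (moment_ge0 rho_moment).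
have := ridge_trace_perturbation d d nu0 (trmx_covmx rho_even n.+1) s0
  (covmx_bform_le rho_even rho_moment (n := n.+1)).
rewrite ridge_cyclic_sqr// tr_cosmx_covmx//.
by under eq_bigr do rewrite filter_weightE.
Qed.

(** The trace of H moves by at most [d], that of H^2 by at most 6d (the case M = 1, s = 1), hence
    the 7. *)
Lemma bias_trace_close n (b : R) : 0 < b ->
  `|bias_trace n (b ^+ m) - b ^+ m * (weight_sum d 1 n b - weight_sum d 2 n b)| <=
  b ^+ m * (7 * d%:R).
Proof.
move=> b0; have nu0 : 0 <= b ^+ m by rewrite exprn_ge0// ltW.
have h1 := @ridge_trace_perturbation1 R n d (b ^+ m) d nu0.
have am (x y : 'cV[R]_n.+1) : `|bform 1%:M x y| <= 1 * (bform 1%:M x x + bform 1%:M y y).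
  rewrite !bform1E mul1r -big_split/=; apply: le_trans (ler_norm_sum _ _ _) _.
  apply: ler_sum => i _; rewrite -!expr2 normrM.
  rewrite -(real_normK (num_real (x i 0))) -(real_normK (num_real (y i 0))).
  have := sqr_ge0 (`|x i 0| - `|y i 0|).
  have := sqr_ge0 `|x i 0|; have := sqr_ge0 `|y i 0|; nra.
have h2 := ridge_trace_perturbation d d nu0 (trmx1 _ _) ler01 am.
rewrite ridge_cyclic// tr_cosmx in h1.
rewrite !mulmx1 ridge_cyclic_sqr// tr_cosmx mulr1 in h2.
rewrite /bias_trace -mulrBr normrM (ger0_norm nu0) ler_wpM2l//.
rewrite (linearB mxtrace)/=.
have -> : weight_sum d 1 n b = \sum_(k < n.+1) filter_weight n d (b ^+ m) k.
  by apply: eq_bigr => k _; rewrite filter_weightE expr1.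
have -> : weight_sum d 2 n b = \sum_(k < n.+1) filter_weight n d (b ^+ m) k ^+ 2.
  by apply: eq_bigr => k _; rewrite filter_weightE.
set W1 := \sum_(k < _) _ in h1 *; set W2 := \sum_(k < _) _ in h2 *.
set T1 := \tr _ in h1 *; set T2 := \tr _ in h2 *.
have -> : T1 - T2 - (W1 - W2) = (T1 - W1) - (T2 - W2) by ring.
apply: le_trans (ler_normB _ _) _.
have -> : 7 * d%:R = d%:R + 6 * d%:R :> R by ring.
exact: lerD h1 h2.
Qed.

(** In the Fejer error 1/n + [cfreq], the second part is paid by one of the two weights: v w(v) <= 1
    at v = b [cfreq] leaves a factor 1/b and a single weight. *)
Lemma cyclic_variance_close n (b : R) : 0 < b ->
  `|cyclic_variance n b - g0 * weight_sum d 2 n b| <=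
  2 * A * (n.+1%:R^-1 * weight_sum d 2 n b + b^-1 * weight_sum d 1 n b).
Proof.
move=> b0; rewrite /cyclic_variance /weight_sum mulr_sumr -sumrB.
apply: le_trans (ler_norm_sum _ _ _) _.
rewrite !mulr_sumr -big_split/= mulr_sumr; apply: ler_sum => k _.
set w := weight d _; have w0 : 0 < w by exact: weight_gt0.
have kn : (k <= n.+1)%N by exact/ltnW/ltn_ord.
have fc := fejer_close rho_even rho_moment (ltn0Sn n) kn.
rewrite mulrC -mulrBl normrM (ger0_norm (exprn_ge0 2 (ltW w0))).
have c0 : 0 <= cfreq n k :> R by rewrite mulr_ge0// sin_freq_ge0.
apply: le_trans (ler_wpM2r (exprn_ge0 2 (ltW w0)) fc) _.
rewrite -[leLHS]mulrA; apply: ler_wpM2l; first by rewrite ?mulr_ge0 ?(moment_ge0 rho_moment).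
rewrite mulrDl lerD2l/= expr1 expr2 mulrA ler_wpM2r ?(ltW w0)//.
rewrite -[leRHS]mul1r ler_pdivlMr// mulrC mulrA.
have := @expr_weight_le1 R d (b * cfreq n k) 1; rewrite expr1; apply.
  by rewrite mulr_ge0// ltW.
by rewrite muln_gt0.
Qed.

(** The weights decrease in [b], and their coefficients, the Fejer means, are nonnegative. *)
Lemma cyclic_variance_nonincreasing n (b b' : R) : 0 < b -> b <= b' ->
  cyclic_variance n b' <= cyclic_variance n b.
Proof.
move=> b0 bb; apply: ler_sum => k _; apply: ler_wpM2r; first exact: fejer_ge0.
have kn : (k <= n.+1)%N by exact/ltnW/ltn_ord.
have c0 : 0 <= cfreq n k :> R by rewrite mulr_ge0// sin_freq_ge0.
rewrite lerXn2r ?nnegrE ?(ltW (weight_gt0 _ _))// weight_nonincreasing//.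
  by rewrite mulr_ge0// ltW.
by rewrite ler_wpM2r.
Qed.

Lemma variance_trace_ge0 n nu : 0 <= nu -> 0 <= variance_trace n nu.
Proof.
move=> nu0; have HT : (ridge (kept_diff n d d) nu : 'M[R]_n.+1)^T = ridge (kept_diff n d d) nu.
  exact/trmx_resolvent/psd_penalty.
rewrite /variance_trace -mulmxA mxtrace_mulC -{2}HT.
exact: tr_conj_ge0.
Qed.

Lemma bias_trace_ge0 n nu : 0 < nu -> 0 <= bias_trace n nu.
Proof. exact: ridge_bias_ge0. Qed.

Lemma bias_trace_nondecreasing n nu nu' : 0 < nu -> nu <= nu' ->
  bias_trace n nu <= bias_trace n nu'.
Proof. exact: ridge_bias_nondecreasing. Qed.

Section Limits.
Variable b : nat -> R.
Hypothesis b_gt0 : forall n, 0 < b n.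
Hypothesis b_cvg : b @ \oo --> +oo.
Hypothesis b_small : (fun n => b n / n.+1%:R) @ \oo --> (0:R).

Lemma cyclic_variance_cvg :
  (fun n => b n / n.+1%:R * cyclic_variance n (b n)) @ \oo --> g0 * variance_constant d.
Proof.
have w2 := weight_sum2_cvg d_gt0 b_gt0 b_cvg b_small.
have w1 := weight_sum1_cvg d_gt0 b_gt0 b_cvg b_small.
have binv : (fun n => (b n)^-1) @ \oo --> (0:R).
  exact/(gtr0_cvgV0 (nearW _ b_gt0)).
have ninv : (fun n => n.+1%:R^-1 : R) @ \oo --> (0:R) by exact: cvg_harmonic.
have main : (fun n => g0 * (b n / n.+1%:R * weight_sum d 2 n (b n))) @ \oo --> g0 * variance_constant d.
  exact: cvgMr.
rewrite -[X in _ --> X]add0r.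
rewrite (_ : (fun n => _) = (fun n => (b n / n.+1%:R * cyclic_variance n (b n) -
   g0 * (b n / n.+1%:R * weight_sum d 2 n (b n))) + g0 * (b n / n.+1%:R * weight_sum d 2 n (b n)))); last first.
  by apply/funext => n; rewrite subrK.
apply: cvgD => //; apply/norm_cvg0P.
apply: (squeeze_cvgr _ (cvg_cst (0:R)) (_ : (fun n => 2 * A *
   (n.+1%:R^-1 * (b n / n.+1%:R * weight_sum d 2 n (b n)) +
    (b n)^-1 * (b n / n.+1%:R * weight_sum d 1 n (b n)))) @ \oo --> (0:R))); last first.
  rewrite -[X in _ --> X](mulr0 (2 * A)); apply: cvgMr.
  rewrite -[X in _ --> X]addr0; apply: cvgD.
    by rewrite -[X in _ --> X](mul0r (variance_constant d)); exact: (cvgM ninv w2).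
  by rewrite -[X in _ --> X](mul0r (variance_constant d + bias_constant d)); exact: (cvgM binv w1).
apply: nearW => n; rewrite normr_ge0/=.
have q0 : 0 <= b n / n.+1%:R by rewrite divr_ge0// ltW.
rewrite mulrCA -mulrBr normrM (ger0_norm q0).
apply: le_trans (ler_wpM2l q0 (cyclic_variance_close n (b_gt0 n))) _.
by rewrite le_eqVlt; apply/orP; left; apply/eqP; ring.
Qed.

Lemma variance_trace_cvg :
  (fun n => b n / n.+1%:R * variance_trace n (b n ^+ m)) @ \oo --> g0 * variance_constant d.
Proof.
rewrite -[X in _ --> X]add0r.
rewrite (_ : (fun n => _) = (fun n => (b n / n.+1%:R * variance_trace n (b n ^+ m) -
   b n / n.+1%:R * cyclic_variance n (b n)) + b n / n.+1%:R * cyclic_variance n (b n))); last first.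
  by apply/funext => n; rewrite subrK.
apply: cvgD; last exact: cyclic_variance_cvg.
apply/norm_cvg0P.
apply: (squeeze_cvgr _ (cvg_cst (0:R)) (_ : (fun n => b n / n.+1%:R *
   (6 * (`|rho 0| + 2 * A) * d%:R)) @ \oo --> (0:R))); last first.
  by rewrite -[X in _ --> X](mul0r (6 * (`|rho 0| + 2 * A) * d%:R)); apply: cvgMl.
apply: nearW => n; rewrite normr_ge0/=.
have q0 : 0 <= b n / n.+1%:R by rewrite divr_ge0// ltW.
by rewrite -mulrBr normrM (ger0_norm q0) ler_wpM2l// variance_trace_close.
Qed.

(** Up to a bounded error, the bias trace divided by nu is the difference of the two weight sums,
    and the variance constants in their limits cancel. *)
Lemma bias_trace_cvg :
  (fun n => b n / n.+1%:R * (bias_trace n (b n ^+ m) / b n ^+ m)) @ \oo --> bias_constant d.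
Proof.
have w2 := weight_sum2_cvg d_gt0 b_gt0 b_cvg b_small.
have w1 := weight_sum1_cvg d_gt0 b_gt0 b_cvg b_small.
have -> : bias_constant d = 0 + (variance_constant d + bias_constant d - variance_constant d) :> R by rewrite add0r addrAC subrr add0r.
rewrite (_ : (fun n => _) = (fun n => (b n / n.+1%:R * (bias_trace n (b n ^+ m) / b n ^+ m) -
   b n / n.+1%:R * (weight_sum d 1 n (b n) - weight_sum d 2 n (b n))) +
   (b n / n.+1%:R * weight_sum d 1 n (b n) - b n / n.+1%:R * weight_sum d 2 n (b n)))); last first.
  by apply/funext => n; rewrite -(mulrBr _ (weight_sum _ 1 _ _)) subrK.
apply: cvgD; last exact: cvgB.
apply/norm_cvg0P.
apply: (squeeze_cvgr _ (cvg_cst (0:R)) (_ : (fun n => b n / n.+1%:R * (7 * d%:R)) @ \oo --> (0:R))); last first.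
  by rewrite -[X in _ --> X](mul0r (7 * d%:R)); apply: cvgMl.
apply: nearW => n; rewrite normr_ge0/=.
have q0 : 0 <= b n / n.+1%:R by rewrite divr_ge0// ltW.
rewrite -mulrBr normrM (ger0_norm q0) ler_wpM2l//.
have bm : 0 < b n ^+ m by rewrite exprn_gt0.
have := bias_trace_close n (b_gt0 n).
have -> : bias_trace n (b n ^+ m) - b n ^+ m * (weight_sum d 1 n (b n) - weight_sum d 2 n (b n)) =
  b n ^+ m * (bias_trace n (b n ^+ m) / b n ^+ m - (weight_sum d 1 n (b n) - weight_sum d 2 n (b n))).
  by rewrite [RHS]mulrBr [b n ^+ m * (_ / _)]mulrCA mulfV ?mulr1// gt_eqF.
by rewrite normrM (gtr0_norm bm) ler_pM2l.
Qed.

End Limits.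

End RiskAsymptotics.

(** * Continuity of the traces in the penalty parameter *)

Section RidgeContinuity.
Context {R : realType}.

Lemma cvg_sum_fun (I : Type) (r : seq I) (f : I -> R -> R) (l : I -> R) (x0 : R) :
  (forall i, f i x @[x --> x0] --> l i) ->
  (\sum_(i <- r) f i x) @[x --> x0] --> \sum_(i <- r) l i.
Proof.
move=> h; elim: r => [|i r ih].
  by under eq_fun do rewrite big_nil; rewrite big_nil; exact: cvg_cst.
by under eq_fun do rewrite big_cons; rewrite big_cons; exact: cvgD.
Qed.

Variable n : nat.
Implicit Types M N : R -> 'M[R]_n.

Definition mx_cvg M (x0 : R) : Prop := forall i j, M x i j @[x --> x0] --> M x0 i j.

Lemma mx_cvgM M N x0 : mx_cvg M x0 -> mx_cvg N x0 -> mx_cvg (fun x => M x *m N x) x0.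
Proof.
move=> hM hN i j; rewrite mxE; under eq_fun do rewrite mxE.
by apply: cvg_sum_fun => k; exact: cvgM.
Qed.

Lemma mx_cvgB M N x0 : mx_cvg M x0 -> mx_cvg N x0 -> mx_cvg (fun x => M x - N x) x0.
Proof.
move=> hM hN i j; rewrite !mxE; under eq_fun do rewrite !mxE.
exact: cvgB.
Qed.

Lemma mx_cvg_cst (A : 'M[R]_n) x0 : mx_cvg (fun=> A) x0.
Proof. by move=> i j; exact: cvg_cst. Qed.

Lemma mx_cvg_tr M x0 : mx_cvg M x0 -> \tr (M x) @[x --> x0] --> \tr (M x0).
Proof. by move=> hM; apply: cvg_sum_fun => i. Qed.

Lemma ridge_entry_le1 (S : 'M[R]_n) nu i j : 0 <= nu -> `|ridge S nu i j| <= 1.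
Proof.
move=> nu0; have := resolvent_contraction (delta_mx j 0) (psd_penalty S nu0).
rewrite -/(ridge S nu) -colE !bform1E.
have -> : \sum_k (delta_mx j 0 : 'cV[R]_n) k 0 * (delta_mx j 0 : 'cV[R]_n) k 0 = 1.
  rewrite (bigD1 j)//= mxE !eqxx mulr1 big1 ?addr0// => k /negPf kj.
  by rewrite mxE kj mul0r.
rewrite (bigD1 i)//= mxE => h.
have : ridge S nu i j * ridge S nu i j <= 1.
  by apply: le_trans h; rewrite lerDl sumr_ge0// => k _; rewrite -expr2 sqr_ge0.
by rewrite -expr2 -real_normK ?num_real// expr_le1.
Qed.

(** Entries of resolvents are at most 1 in absolute value, so the resolvent identity makes nu H(nu)
    Lipschitz with constant [n], entry by entry; dividing by nu > 0 gives H. *)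
Lemma ridge_continuous (S : 'M[R]_n) (nu0 : R) : 0 < nu0 -> mx_cvg (ridge S) nu0.
Proof.
move=> n0 i j.
have near0 : \forall nu \near nu0, 0 < nu by exact: lt_nbhsr.
have h : (nu * ridge S nu i j) @[nu --> nu0] --> nu0 * ridge S nu0 i j.
  apply: (@cvg_sub0 _ _ _ _ _ _ (fun=> nu0 * ridge S nu0 i j)); last exact: cvg_cst.
  apply/norm_cvg0P.
  apply: (squeeze_cvgr _ (cvg_cst (0:R)) (_ : (`|nu - nu0| * n%:R) @[nu --> nu0] --> (0:R))); last first.
    rewrite -[X in _ --> X](mul0r (n%:R : R)); apply: cvgMl.
    have hB : (nu - nu0) @[nu --> nu0] --> nu0 - nu0.
      by apply: cvgB; [exact: cvg_id|exact: cvg_cst].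
    by have := cvg_norm hB; rewrite subrr normr0 => /(_ (nbhs_filter _)).
  near=> nu; have nup : 0 < nu by near: nu.
  rewrite normr_ge0/=.
  rewrite -[X in `|X|]/(nu * ridge S nu i j - nu0 * ridge S nu0 i j).
  have -> : nu * ridge S nu i j - nu0 * ridge S nu0 i j =
      (nu *: ridge S nu - nu0 *: ridge S nu0) i j by rewrite !mxE.
  rewrite ridge_resolvent_identity// mxE normrM ler_wpM2l// mxE.
  apply: le_trans (ler_norm_sum _ _ _) _.
  apply: (@le_trans _ _ (\sum_(k < n) 1)); last by rewrite sumr_const card_ord.
  apply: ler_sum => k _; rewrite normrM -[leRHS]mulr1.
  by rewrite ler_pM// ridge_entry_le1// ltW.
have h2 : (nu^-1 * (nu * ridge S nu i j)) @[nu --> nu0] --> nu0^-1 * (nu0 * ridge S nu0 i j).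
  by apply: cvgM => //; apply: cvgV; [rewrite gt_eqF|exact: cvg_id].
rewrite mulKf ?gt_eqF// in h2.
apply: cvg_trans h2; apply: near_eq_cvg; near=> nu.
by rewrite mulKf// gt_eqF//; near: nu.
Unshelve. all: by end_near.
Qed.

Lemma ridge_traces_continuous (S M : 'M[R]_n) (nu0 : R) : 0 < nu0 ->
  (\tr (ridge S nu *m ridge S nu *m M) @[nu --> nu0] -->
    \tr (ridge S nu0 *m ridge S nu0 *m M)) /\
  (nu * \tr (ridge S nu - ridge S nu *m ridge S nu) @[nu --> nu0] -->
    nu0 * \tr (ridge S nu0 - ridge S nu0 *m ridge S nu0)).
Proof.
move=> n0; have h := @ridge_continuous S _ n0; have h2 := mx_cvgM h h; split.
  have h3 : mx_cvg (fun nu => ridge S nu *m ridge S nu *m M) nu0 := @mx_cvgM _ (fun=> M) _ h2 (@mx_cvg_cst M nu0).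
  exact: (@mx_cvg_tr _ _ h3).
apply: cvgM; first exact: cvg_id.
have h3 : mx_cvg (fun nu => ridge S nu - ridge S nu *m ridge S nu) nu0 := @mx_cvgB _ _ _ h h2.
exact: (@mx_cvg_tr _ _ h3).
Qed.

End RidgeContinuity.

(** * The bias-variance trade-off *)

Section RatioLimits.
Context {R : realType}.

Lemma cvg0_of_expr (x : nat -> R) m : (0 < m)%N -> (forall n, 0 <= x n) ->
  (fun n => x n ^+ m) @ \oo --> (0:R) -> x @ \oo --> (0:R).
Proof.
move=> m0 x0 /cvgrPdist_lt h; apply/cvgrPdist_lt => e e0.
have := h (e ^+ m) (exprn_gt0 _ e0); apply: filterS => n.
rewrite !sub0r !normrN !ger0_norm ?exprn_ge0// => l.
by rewrite -(ltr_pXn2r m0)// nnegrE// ltW.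
Qed.

Lemma near_shiftS (Q : nat -> Prop) :
  (\forall n \near \oo, Q n.+1) -> \forall n \near \oo, Q n.
Proof.
by move=> [k _ h]; exists k.+1 => // -[//|n] kn; apply: h.
Qed.

Lemma near_unshiftS (Q : nat -> Prop) :
  (\forall n \near \oo, Q n) -> \forall n \near \oo, Q n.+1.
Proof. by move=> [k _ h]; exists k => // n /= kn; apply: h; exact: leqW. Qed.

(** The matrix results are stated for samples of size n + 1; this returns to size [n]. *)
Lemma eq_1o1_shift (u : nat -> \bar R) (v : nat -> R) :
  eq_1o1 (fun n => u n.+1) (fun n => v n.+1) -> eq_1o1 u v.
Proof.
move=> [r [r0 hr]]; exists (fun n => r n.-1); split.
  by rewrite -cvg_shiftS.
exact: near_shiftS.
Qed.

Lemma eq_1o1_ratio (u v : nat -> R) : (forall n, v n != 0) ->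
  (fun n => u n / v n) @ \oo --> (1:R) -> eq_1o1 (fun n => (u n)%:E) v.
Proof.
move=> v0 h; exists (fun n => u n / v n - 1); split.
  by rewrite -[X in _ --> X](subrr (1:R)); apply: cvgB => //; exact: cvg_cst.
by apply: nearW => n; rewrite addrCA subrr addr0 mulrCA mulfV ?mulr1.
Qed.

(** The relative error is a convex combination of the relative errors of [u] and [w]. Hence the two
    terms may have any relative size, as the first asymptotic formula demands. *)
Lemma combination_ratio_cvg (C1 C2 : R) (x y u w : nat -> R) : 0 < C1 -> 0 < C2 ->
  (forall n, 0 < x n) -> (forall n, 0 < y n) -> u @ \oo --> C1 -> w @ \oo --> C2 ->
  (fun n => (x n * u n + y n * w n) / (C1 * x n + C2 * y n)) @ \oo --> (1:R).
Proof.
move=> c1 c2 x0 y0 uC wC.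
have hu : (fun n => `|u n - C1| / C1 + `|w n - C2| / C2) @ \oo --> (0:R).
  have z (f : nat -> R) c : f @ \oo --> c -> (fun n => `|f n - c| / c) @ \oo --> (0:R).
    move=> fc; rewrite -[X in _ --> X](mul0r c^-1); apply: cvgMl.
    have hB : (fun n => f n - c) @ \oo --> c - c by apply: cvgB => //; exact: cvg_cst.
    by have := cvg_norm hB; rewrite subrr normr0 => /(_ _).
  by rewrite -[X in _ --> X](addr0 (0:R)); apply: cvgD; exact: z.
apply: (@cvg_sub0 _ _ _ _ _ _ (fun=> (1:R))); last exact: cvg_cst.
apply/norm_cvg0P; apply: (squeeze_cvgr _ (cvg_cst (0:R)) hu).
apply: nearW => n; rewrite normr_ge0/=.
have a0 : 0 < C1 * x n by rewrite mulr_gt0.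
have b0 : 0 < C2 * y n by rewrite mulr_gt0.
set M := C1 * x n + C2 * y n; have M0 : 0 < M by rewrite addr_gt0.
rewrite -[X in `|X|]/((x n * u n + y n * w n) / M - 1).
have -> : (x n * u n + y n * w n) / M - 1 =
   (C1 * x n / M) * ((u n - C1) / C1) + (C2 * y n / M) * ((w n - C2) / C2).
  by rewrite /M; field; rewrite !gt_eqF.
apply: le_trans (ler_normD _ _) _; rewrite !normrM ![`|_^-1|]ger0_norm ?invr_ge0 ?(ltW c1) ?(ltW c2) ?(ltW M0)//.
have p1 : `|C1| * `|x n| / M <= 1.
  by rewrite -normrM ger0_norm ?(ltW a0)// ler_pdivrMr// mul1r /M lerDl ltW.
have p2 : `|C2| * `|y n| / M <= 1.
  by rewrite -normrM ger0_norm ?(ltW b0)// ler_pdivrMr// mul1r /M lerDr ltW.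
apply: lerD; rewrite -[leRHS]mul1r ler_wpM2r// divr_ge0// ltW//.
Qed.

(* z^m - m z + m - 1 = (z - 1)^2 \sum_(k < m - 1) (m - 1 - k) z^k. *)
Lemma bernoulli_quadratic (z : R) m : (2 <= m)%N -> 0 <= z ->
  (z - 1) ^+ 2 <= z ^+ m - m%:R * z + m%:R - 1.
Proof.
case: m => [|[|m]]// _ z0.
elim: m => [|m ih]; first by rewrite le_eqVlt; apply/orP; left; apply/eqP; ring.
have zm : (m.+2%:R * (z - 1)) * (z - 1) >= 0 by rewrite -mulrA mulr_ge0// -expr2 sqr_ge0.
have [z1|z1] := leP 1 z.
- have h : 0 <= (z - 1) * (z ^+ m.+2 - 1).
    by rewrite mulr_ge0 ?subr_ge0// exprn_ege1.
  rewrite [z ^+ m.+3]exprS -[m.+3%:R]natr1; nra.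
- have h : 0 <= (1 - z) * (1 - z ^+ m.+2).
    by rewrite mulr_ge0 ?subr_ge0 ?(ltW z1)// exprn_ile1// ltW.
  rewrite [z ^+ m.+3]exprS -[m.+3%:R]natr1; nra.
Qed.

End RatioLimits.

(** * The trade-off for abstract variance and bias functions *)

Section BiasVarianceTradeoff.
Context {R : realType} (m : nat).
Hypothesis m_ge2 : (2 <= m)%N.
Variables (V B VC : nat -> R -> R) (t2 s C1 C2 : R).
Hypotheses (C1_gt0 : 0 < C1) (C2_gt0 : 0 < C2) (t2_ge0 : 0 <= t2).
Hypothesis V_ge0 : forall n (nu : R), 0 <= nu -> 0 <= V n nu.
Hypothesis B_ge0 : forall n (nu : R), 0 < nu -> 0 <= B n nu.
Hypothesis B_nondec : forall n (nu nu' : R), 0 < nu -> nu <= nu' -> B n nu <= B n nu'.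
Hypothesis VC_noninc : forall n (b b' : R), 0 < b -> b <= b' -> VC n b' <= VC n b.
Hypothesis V_VC : forall n (b : R), 0 < b -> VC n b - s <= V n (b ^+ m).
Hypothesis V_cont : forall n (nu : R), 0 < nu -> V n x @[x --> nu] --> V n nu.
Hypothesis B_cont : forall n (nu : R), 0 < nu -> B n x @[x --> nu] --> B n nu.
Let scale (b : nat -> R) := [/\ forall n, 0 < b n, b @ \oo --> +oo &
  (fun n => b n / n.+1%:R) @ \oo --> (0:R)].
Hypothesis V_cvg : forall b, scale b ->
  (fun n => b n / n.+1%:R * V n (b n ^+ m)) @ \oo --> C1.
Hypothesis VC_cvg : forall b, scale b ->
  (fun n => b n / n.+1%:R * VC n (b n)) @ \oo --> C1.
Hypothesis B_cvg : forall b, scale b ->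
  (fun n => t2 * (b n / n.+1%:R * (B n (b n ^+ m) / b n ^+ m))) @ \oo --> C2.

(** Here m = 2d, the sample size is n + 1, [V] and [B] are the variance and bias traces and [t2] is
    tau^2. [VC] is the monotone cyclic variance, which exceeds [V] by at most [s]. *)
Definition risk n nu : R := n.+1%:R^-1 * (V n nu + t2 / n.+1%:R ^+ m.-1 * B n nu).

Let m0 : (0 < m)%N. Proof. exact: leq_trans m_ge2. Qed.
Let mR : 0 < m%:R :> R. Proof. by rewrite ltr0n. Qed.
Let a : R := m%:R^-1.
Let N0 n : 0 < n.+1%:R :> R. Proof. by []. Qed.

Lemma powR_root_exprn (x : R) : 0 <= x -> (x `^ a) ^+ m = x.
Proof.
move=> x0; rewrite -powR_mulrn ?powR_ge0// -powRrM mulVf ?gt_eqF// powRr1//.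
Qed.

Lemma scale_root (nu : nat -> R) : (forall n, 0 < nu n) -> nu @ \oo --> +oo ->
  (fun n => nu n / n.+1%:R ^+ m) @ \oo --> (0:R) -> scale (fun n => nu n `^ a).
Proof.
move=> n0 ny nN; have b0 n : 0 < nu n `^ a by exact: powR_gt0.
split => //.
  apply/(gtr0_cvgV0 (nearW _ b0)); apply: (cvg0_of_expr m0).
    by move=> n; rewrite invr_ge0 ltW.
  under eq_fun do rewrite exprVn powR_root_exprn ?ltW//.
  exact/(gtr0_cvgV0 (nearW _ n0)).
apply: (cvg0_of_expr m0); first by move=> n; rewrite divr_ge0// ltW.
under eq_fun do rewrite expr_div_n powR_root_exprn ?ltW//.
exact: nN.
Qed.

Lemma risk_decomposition n (b : R) : 0 < b -> risk n (b ^+ m) =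
  b^-1 * (b / n.+1%:R * V n (b ^+ m)) +
  b ^+ m.-1 / n.+1%:R ^+ m.-1 * (t2 * (b / n.+1%:R * (B n (b ^+ m) / b ^+ m))).
Proof.
move=> b0; rewrite /risk mulrDr; congr (_ + _).
  by rewrite !mulrA mulVf ?mul1r// gt_eqF.
set v := B n _; clearbody v; have -> : b ^+ m = b * b ^+ m.-1 by rewrite -exprS prednK.
have x0 : b ^+ m.-1 != 0 by rewrite gt_eqF// exprn_gt0.
have y0 : n.+1%:R ^+ m.-1 != 0 :> R by rewrite gt_eqF// exprn_gt0.
have z0 : n.+1%:R != 0 :> R by rewrite gt_eqF.
move: (b ^+ m.-1) x0 (n.+1%:R ^+ m.-1) y0 (n.+1%:R) z0 => x x0 y y0 z z0.
by field; rewrite x0 z0 expf_neq0 ?(gt_eqF b0).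
Qed.

Lemma risk_asymptotic (nu : nat -> R) : (forall n, 0 < nu n) -> nu @ \oo --> +oo ->
  (fun n => nu n / n.+1%:R ^+ m) @ \oo --> (0:R) ->
  (fun n => risk n (nu n) / (C1 * nu n `^ (- a) + C2 * nu n `^ (1 - a) * n.+1%:R `^ (- m%:R + 1)))
    @ \oo --> (1:R).
Proof.
move=> n0 ny nN; have sb := scale_root n0 ny nN; have [b0 _ _] := sb.
have x0 n : 0 < (nu n `^ a)^-1 by rewrite invr_gt0.
have y0 n : 0 < (nu n `^ a) ^+ m.-1 / n.+1%:R ^+ m.-1 by rewrite divr_gt0// exprn_gt0.
have := combination_ratio_cvg C1_gt0 C2_gt0 x0 y0 (V_cvg sb) (B_cvg sb).
apply: cvg_trans; apply: near_eq_cvg; apply: nearW => n /=.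
rewrite -risk_decomposition// powR_root_exprn ?ltW// powRN; congr (_ / (_ + _)).
rewrite -mulrA; congr (C2 * (_ * _)).
  rewrite powRB; last by rewrite (gt_eqF (n0 n)) implybT.
  rewrite powRr1 ?(ltW (n0 n))// -{2}(powR_root_exprn (ltW (n0 n))).
  by rewrite -{2}(prednK m0) exprSr mulfK// gt_eqF.
have -> : - m%:R + 1 = - (m.-1%:R) :> R by rewrite -{1}(prednK m0) -natr1; ring.
by rewrite powR_invn.
Qed.

(** The scale b at which variance 1/b and bias (b/n)^(m-1) have the same order: b^m = n^(m-1). *)
Definition rate n : R := n.+1%:R `^ ((m%:R - 1) / m%:R).

Lemma rate_gt0 n : 0 < rate n. Proof. exact: powR_gt0. Qed.

Lemma rate_exprn n : rate n ^+ m = n.+1%:R ^+ m.-1.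
Proof.
rewrite -powR_mulrn ?powR_ge0// /rate -powRrM divfK ?gt_eqF//.
have -> : m%:R - 1 = m.-1%:R :> R by rewrite -{1}(prednK m0) -natr1 addrK.
by rewrite powR_mulrn.
Qed.

Lemma harmonic0 : (fun n => n.+1%:R^-1 : R) @ \oo --> (0:R).
Proof. exact: cvg_harmonic. Qed.

Lemma scale_rate (z : nat -> R) (k K : R) : 0 < k ->
  (forall n, k <= z n <= K) -> scale (fun n => z n * rate n).
Proof.
move=> k0 zk; have z0 n : 0 < z n by have /andP[h _] := zk n; exact: lt_le_trans h.
have zr0 n : 0 < z n * rate n by rewrite mulr_gt0// rate_gt0.
have rV : (fun n => (rate n)^-1) @ \oo --> (0:R).
  apply: (cvg0_of_expr m0) => [n|]; first by rewrite invr_ge0 ltW// rate_gt0.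
  apply: (squeeze_cvgr _ (cvg_cst (0:R)) harmonic0); apply: nearW => n.
  rewrite exprVn rate_exprn invr_ge0 exprn_ge0//= lef_pV2 ?posrE ?exprn_gt0//.
  by rewrite -[leLHS]expr1 ler_weXn2l ?ler1n// -ltnS prednK.
have rN : (fun n => rate n / n.+1%:R) @ \oo --> (0:R).
  apply: (cvg0_of_expr m0) => [n|]; first by rewrite divr_ge0// ltW// rate_gt0.
  rewrite (_ : (fun n => _) = (fun n => n.+1%:R^-1)); first exact: harmonic0.
  apply/funext => n; rewrite expr_div_n rate_exprn -{2}(prednK m0) exprSr invfM mulrA.
  by rewrite mulfV ?mul1r// gt_eqF// exprn_gt0.
split => //.
  apply/(gtr0_cvgV0 (nearW _ zr0)).
  apply: (squeeze_cvgr _ (cvg_cst (0:R)) (_ : (fun n => k^-1 * (rate n)^-1) @ \oo --> (0:R))).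
    apply: nearW => n; rewrite invr_ge0 (ltW (zr0 n))/= invfM ler_wpM2r//.
      by rewrite invr_ge0 ltW// rate_gt0.
    by rewrite lef_pV2 ?posrE//; have /andP[] := zk n.
  by rewrite -[X in _ --> X](mulr0 k^-1); exact: cvgMr.
apply: (squeeze_cvgr _ (cvg_cst (0:R)) (_ : (fun n => K * (rate n / n.+1%:R)) @ \oo --> (0:R))).
  apply: nearW => n; rewrite divr_ge0 ?(ltW (zr0 n))//= -mulrA ler_wpM2r//.
    by rewrite divr_ge0// ltW// rate_gt0.
  by have /andP[] := zk n.
by rewrite -[X in _ --> X](mulr0 K); exact: cvgMr.
Qed.

Definition scaled_risk n z : R := rate n * risk n ((z * rate n) ^+ m).

Definition limit_risk z : R := C1 / z + C2 * z ^+ m.-1.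

Lemma scaled_riskE n z : 0 < z -> let b := z * rate n in
  scaled_risk n z = z^-1 * (b / n.+1%:R * V n (b ^+ m)) +
  z ^+ m.-1 * (t2 * (b / n.+1%:R * (B n (b ^+ m) / b ^+ m))).
Proof.
move=> z0 b; have r0 := rate_gt0 n; have b0 : 0 < b by rewrite mulr_gt0.
rewrite /scaled_risk -/b risk_decomposition// mulrDr; congr (_ + _).
  by rewrite mulrA; congr (_ * _); rewrite /b; field; rewrite !gt_eqF.
rewrite mulrA; congr (_ * _); rewrite -rate_exprn /b exprMn.
have -> : rate n ^+ m = rate n * rate n ^+ m.-1 by rewrite -exprS prednK.
have x0 : rate n ^+ m.-1 != 0 by rewrite gt_eqF// exprn_gt0.
move: (rate n ^+ m.-1) x0 (z ^+ m.-1) => x x0 y.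
by field; rewrite ?x0 ?gt_eqF.
Qed.

(** Convergence along arbitrary sequences in a compact interval takes the place of uniform
    convergence; it is later applied to the rescaled minimizers. *)
Lemma scaled_risk_cvg (z : nat -> R) (k K : R) : 0 < k -> (forall n, k <= z n <= K) ->
  (fun n => scaled_risk n (z n) - limit_risk (z n)) @ \oo --> (0:R).
Proof.
move=> k0 zk; have sb := scale_rate k0 zk.
have z0 n : 0 < z n by have /andP[h _] := zk n; exact: lt_le_trans h.
have c (f : nat -> R) l : f @ \oo --> l -> (fun n => `|f n - l|) @ \oo --> (0:R).
  move=> fl; have hB : (fun n => f n - l) @ \oo --> l - l by apply: cvgB => //; exact: cvg_cst.
  by have := cvg_norm hB; rewrite subrr normr0 => /(_ _).
pose u n := z n * rate n / n.+1%:R * V n ((z n * rate n) ^+ m).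
pose w n := t2 * (z n * rate n / n.+1%:R *
  (B n ((z n * rate n) ^+ m) / (z n * rate n) ^+ m)).
have h1 : (fun n => `|u n - C1|) @ \oo --> (0:R) := c _ _ (V_cvg sb).
have h2 : (fun n => `|w n - C2|) @ \oo --> (0:R) := c _ _ (B_cvg sb).
apply/norm_cvg0P.
apply: (squeeze_cvgr _ (cvg_cst (0:R)) (_ : (fun n => k^-1 * `|u n - C1| + K ^+ m.-1 * `|w n - C2|) @ \oo --> (0:R))).
  apply: nearW => n; rewrite normr_ge0/=.
  have -> : scaled_risk n (z n) - limit_risk (z n) =
     (z n)^-1 * (u n - C1) + z n ^+ m.-1 * (w n - C2).
    by rewrite scaled_riskE// /limit_risk -/(u n) -/(w n); ring.
  have /andP[zk1 zk2] := zk n.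
  apply: le_trans (ler_normD _ _) _; rewrite !normrM; apply: lerD; apply: ler_wpM2r => //.
    by rewrite ger0_norm ?invr_ge0 ?(ltW (z0 n))// lef_pV2 ?posrE.
  rewrite ger0_norm ?exprn_ge0 ?(ltW (z0 n))// lerXn2r ?nnegrE ?(ltW (z0 n))//.
  exact: le_trans (ltW (z0 n)) zk2.
rewrite -[X in _ --> X](addr0 (0:R)); apply: cvgD.
  by rewrite -[X in _ --> X](mulr0 k^-1); exact: cvgMr.
by rewrite -[X in _ --> X](mulr0 (K ^+ m.-1)); exact: cvgMr.
Qed.


Let m1 : 0 < m%:R - 1 :> R.
Proof. by rewrite subr_gt0 ltr1n. Qed.

(** The zero of the derivative -C1 / z^2 + (m-1) C2 z^(m-2) of the limit risk. *)
Definition opt : R := (C1 / (C2 * (m%:R - 1))) `^ a.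

Let opt_arg_gt0 : 0 < C1 / (C2 * (m%:R - 1)).
Proof. by rewrite divr_gt0// mulr_gt0. Qed.

Lemma opt_gt0 : 0 < opt. Proof. exact: powR_gt0. Qed.

Lemma opt_exprn : opt ^+ m = C1 / (C2 * (m%:R - 1)).
Proof. by rewrite powR_root_exprn// ltW. Qed.

Lemma limit_risk_opt : limit_risk opt = C1 / opt * (m%:R / (m%:R - 1)).
Proof.
have o0 := opt_gt0.
have -> : limit_risk opt = (C1 + C2 * opt ^+ m) / opt.
  have -> : opt ^+ m = opt * opt ^+ m.-1 by rewrite -exprS prednK.
  by rewrite /limit_risk; field; rewrite gt_eqF.
by rewrite opt_exprn; field; rewrite !gt_eqF.
Qed.

Lemma limit_risk_opt_gt0 : 0 < limit_risk opt.
Proof.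
by rewrite limit_risk_opt mulr_gt0 ?divr_gt0// opt_gt0.
Qed.

(** With F the limit risk and t = z / opt, the right side equals F(opt) (t^m - m t + m - 1), to
    which the quadratic Bernoulli inequality applies. The gap converts convergence of values into
    convergence of minimizers. *)
Lemma limit_risk_gap z : 0 < z ->
  (z / opt - 1) ^+ 2 * limit_risk opt <= m%:R * (z / opt) * (limit_risk z - limit_risk opt).
Proof.
move=> z0; have o0 := opt_gt0; set t := z / opt.
have t0 : 0 < t by rewrite divr_gt0.
have -> : m%:R * t * (limit_risk z - limit_risk opt) =
   limit_risk opt * (t ^+ m - m%:R * t + m%:R - 1).
  have zE : z = t * opt by rewrite /t divfK// gt_eqF.
  have -> : limit_risk z = (C1 + C2 * (opt ^+ m * t ^+ m)) / (opt * t).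
    rewrite zE -exprMn (mulrC opt t).
    have -> : (t * opt) ^+ m = (t * opt) * (t * opt) ^+ m.-1 by rewrite -exprS prednK.
    by rewrite /limit_risk; field; rewrite !gt_eqF.
  rewrite opt_exprn limit_risk_opt; move: (t ^+ m) => tm.
  by field; rewrite !gt_eqF.
rewrite mulrC; apply: ler_wpM2l; first exact/ltW/limit_risk_opt_gt0.
by apply: bernoulli_quadratic => //; exact: ltW.
Qed.

(* The limit risk is C1 + C2 at 1; the variance alone exceeds it by 1 at k, and so
   does the bias at K, which confines every minimizer to [k, K]. *)
Let k : R := C1 / (C1 + C2 + 1).
Let K : R := (C1 + C2 + 1) / C2.

Let k0 : 0 < k. Proof. by rewrite divr_gt0// !addr_gt0. Qed.
Let k1 : k < 1.
Proof. by rewrite ltr_pdivrMr ?mul1r ?addr_gt0//; have := C2_gt0; lra. Qed.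
Let K1 : 1 < K.
Proof. by rewrite ltr_pdivlMr ?mul1r//; have := C1_gt0; lra. Qed.

Lemma scaled_risk1_cvg : (fun n => scaled_risk n 1) @ \oo --> C1 + C2.
Proof.
have h := @scaled_risk_cvg (fun=> 1) 1 1 ltr01 (fun=> ltac:(by rewrite lexx)).
have e : limit_risk 1 = C1 + C2 by rewrite /limit_risk divr1 expr1n mulr1.
rewrite /= e in h.
apply: (@cvg_sub0 _ _ _ _ _ _ (fun=> C1 + C2)); [exact: h|exact: cvg_cst].
Qed.

(** For small [z] the scale b may stay bounded, where no limit is available. The bias is dropped,
    the variance is replaced by [VC] and moved to z = k by monotonicity; the loss [s] vanishes after
    the factor [rate] / n. The limit is C1 / k. *)
Lemma scaled_risk_lower_small : exists l : nat -> R, l @ \oo --> C1 + C2 + 1 /\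
  forall n z, 0 < z -> z <= k -> l n <= scaled_risk n z.
Proof.
have sb := @scale_rate (fun=> k) k k k0 (fun=> ltac:(by rewrite lexx)).
have [_ _ rN] := sb.
exists (fun n => k^-1 * (k * rate n / n.+1%:R * VC n (k * rate n)) - k^-1 * s * (k * rate n / n.+1%:R)).
split.
  have -> : C1 + C2 + 1 = k^-1 * C1 - k^-1 * s * 0.
    by rewrite mulr0 subr0 /k; field; rewrite !gt_eqF// !addr_gt0.
  by apply: cvgB; apply: cvgMr => //; exact: VC_cvg sb.
move=> n z z0 zk; have r0 := rate_gt0 n.
have zr : 0 < z * rate n by rewrite mulr_gt0.
have -> : k^-1 * (k * rate n / n.+1%:R * VC n (k * rate n)) - k^-1 * s * (k * rate n / n.+1%:R) =
  rate n / n.+1%:R * (VC n (k * rate n) - s).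
  have n0 := N0 n; move: (n.+1%:R) n0 => nn n0; field; rewrite !gt_eqF//.
rewrite /scaled_risk /risk mulrA; apply: ler_wpM2l; first by rewrite divr_ge0// ltW.
apply: (@le_trans _ _ (V n ((z * rate n) ^+ m))).
  apply: le_trans (V_VC _ zr); rewrite lerD2r; apply: VC_noninc => //.
  by rewrite ler_wpM2r// ltW.
by rewrite lerDl mulr_ge0 ?B_ge0 ?exprn_gt0// divr_ge0// exprn_ge0.
Qed.

(** The variance is dropped and the monotone bias is moved down to z = K. Its limit K^(m-1) C2 is at
    least K C2 = C1 + C2 + 1, as K > 1 and m >= 2. *)
Lemma scaled_risk_lower_large : exists l : nat -> R, exists l0 : R,
  [/\ l @ \oo --> l0, C1 + C2 + 1 <= l0 & forall n z, K <= z -> l n <= scaled_risk n z].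
Proof.
have K0 : 0 < K := lt_trans ltr01 K1.
have sb := @scale_rate (fun=> K) K K K0 (fun=> ltac:(by rewrite lexx)).
exists (fun n => K ^+ m.-1 * (t2 * (K * rate n / n.+1%:R * (B n ((K * rate n) ^+ m) / (K * rate n) ^+ m)))).
exists (K ^+ m.-1 * C2); split.
- by apply: cvgMr; exact: B_cvg sb.
- have -> : C1 + C2 + 1 = K ^+ 1 * C2 by rewrite expr1 divfK// gt_eqF.
  by rewrite ler_wpM2r ?(ltW C2_gt0)// ler_weXn2l ?(ltW K1)// -ltnS prednK.
move=> n z Kz; have r0 := rate_gt0 n; have z0 := lt_le_trans K0 Kz.
have Kr : 0 < K * rate n by rewrite mulr_gt0.
cbv beta; have -> : K ^+ m.-1 * (t2 * (K * rate n / n.+1%:R * (B n ((K * rate n) ^+ m) / (K * rate n) ^+ m))) =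
  rate n * (n.+1%:R^-1 * (t2 / n.+1%:R ^+ m.-1 * B n ((K * rate n) ^+ m))).
  rewrite -rate_exprn; move: (B n _) => v; rewrite (exprMn m K (rate n)).
  have -> : rate n ^+ m = rate n * rate n ^+ m.-1 by rewrite -exprS prednK.
  have -> : K ^+ m = K * K ^+ m.-1 by rewrite -exprS prednK.
  have x0 : rate n ^+ m.-1 != 0 by rewrite gt_eqF// exprn_gt0.
  have y0 : K ^+ m.-1 != 0 by rewrite gt_eqF// exprn_gt0.
  have n0 := N0 n; move: (rate n ^+ m.-1) x0 (K ^+ m.-1) y0 (n.+1%:R) n0 => x x0 y y0 nn n0.
  by field; rewrite ?x0 ?y0 !gt_eqF.
rewrite /scaled_risk /risk; apply: ler_wpM2l; first exact: ltW.
apply: ler_wpM2l; first by rewrite invr_ge0.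
have zr : 0 < z * rate n by rewrite mulr_gt0.
apply: (@le_trans _ _ (t2 / n.+1%:R ^+ m.-1 * B n ((z * rate n) ^+ m))).
  apply: ler_wpM2l; first by rewrite divr_ge0// exprn_ge0.
  apply: B_nondec; first exact: (exprn_gt0 _ Kr).
  by rewrite lerXn2r ?nnegrE ?(ltW Kr) ?(ltW zr)// ler_wpM2r// ltW.
by rewrite lerDr V_ge0// exprn_ge0// ltW.
Qed.

Lemma scaled_risk_outside : \forall n \near \oo, forall z, 0 < z ->
  scaled_risk n z <= scaled_risk n 1 -> k <= z <= K.
Proof.
have [l1 [c1 h1]] := scaled_risk_lower_small.
have [l2 [l0 [c2 l0C h2]]] := scaled_risk_lower_large.
have n1 : \forall n \near \oo, C1 + C2 + 2^-1 < l1 n.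
  by apply: (cvgr_gt _ c1); lra.
have n2 : \forall n \near \oo, C1 + C2 + 2^-1 < l2 n.
  by apply: (cvgr_gt _ c2); lra.
have n3 : \forall n \near \oo, scaled_risk n 1 < C1 + C2 + 2^-1.
  by apply: (cvgr_lt _ scaled_risk1_cvg); lra.
near=> n => z z0 le1.
have p1 : C1 + C2 + 2^-1 < l1 n by near: n.
have p2 : C1 + C2 + 2^-1 < l2 n by near: n.
have p3 : scaled_risk n 1 < C1 + C2 + 2^-1 by near: n.
apply/andP; split; rewrite leNgt; apply/negP => zk.
  by have := h1 n z z0 (ltW zk); lra.
by have := h2 n z (ltW zk); lra.
Unshelve. all: by end_near.
Qed.

Lemma scaled_risk_root n nu : 0 < nu -> scaled_risk n (nu `^ a / rate n) = rate n * risk n nu.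
Proof.
move=> n0; rewrite /scaled_risk divfK ?gt_eqF ?rate_gt0//.
by rewrite powR_root_exprn// ltW.
Qed.

Lemma scaled_risk_continuous n z : 0 < z -> {for z, continuous (scaled_risk n)}.
Proof.
move=> z0; have zr : 0 < (z * rate n) ^+ m by rewrite exprn_gt0// mulr_gt0// rate_gt0.
have hz : (x * rate n) @[x --> z] --> z * rate n by apply: cvgMl; exact: cvg_id.
have hp : ((x * rate n) ^+ m) @[x --> z] --> (z * rate n) ^+ m.
  exact: (cvg_comp _ (fun x : R => x ^+ m) hz (@exprn_continuous R m (z * rate n))).
have hV : V n ((x * rate n) ^+ m) @[x --> z] --> V n ((z * rate n) ^+ m).
  exact: (cvg_comp _ (V n) hp (@V_cont n _ zr)).
have hB : B n ((x * rate n) ^+ m) @[x --> z] --> B n ((z * rate n) ^+ m).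
  exact: (cvg_comp _ (B n) hp (@B_cont n _ zr)).
apply: cvgMr; apply: cvgMr; apply: cvgD; first exact: hV.
by apply: cvgMr; exact: hB.
Qed.

(** The extreme value theorem gives a minimum on [k, K]. A point outside has a larger value than 1,
    which lies in the interval. *)
Lemma risk_minimizer_exists : \forall n \near \oo,
  exists nu, 0 < nu /\ forall y, 0 < y -> risk n nu <= risk n y.
Proof.
have ho := scaled_risk_outside; near=> n.
have out : forall z, 0 < z -> scaled_risk n z <= scaled_risk n 1 -> k <= z <= K by near: n.
have kK : k <= K by apply: ltW; exact: lt_trans K1.
have cont : {within `[k, K], continuous (scaled_risk n)}.
  apply: continuous_in_subspaceT => z; rewrite inE/= in_itv/= => /andP[kz _].
  by apply: scaled_risk_continuous; exact: lt_le_trans kz.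
have [z] := EVT_min kK cont; rewrite in_itv/= => /andP[kz zK] hz.
have z0 := lt_le_trans k0 kz.
have zmin y : 0 < y -> scaled_risk n z <= scaled_risk n y.
  move=> y0; have [l|l] := leP (scaled_risk n y) (scaled_risk n 1).
    by apply: hz; rewrite in_itv/= out.
  by apply: le_trans (ltW l); apply: hz; rewrite in_itv/= !ltW.
exists ((z * rate n) ^+ m); split; first by rewrite exprn_gt0// mulr_gt0// rate_gt0.
move=> y y0; have := zmin (y `^ a / rate n) (divr_gt0 (powR_gt0 _ y0) (rate_gt0 n)).
by rewrite scaled_risk_root// /scaled_risk ler_pM2l// rate_gt0.
Unshelve. all: by end_near.
Qed.

Section Minimizers.
Variable nustar : nat -> R.
Hypothesis nustar_min : \forall n \near \oo,
  0 < nustar n /\ forall y, 0 < y -> risk n (nustar n) <= risk n y.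

Let z n : R := nustar n `^ a / rate n.
(** The rescaled minimizer, replaced by 1 at the finitely many [n] where it may leave [k, K], so
    that the bounds hold for every [n]. *)
Let z' n : R := if k <= z n <= K then z n else 1.

Let z'_bounds n : k <= z' n <= K.
Proof. by rewrite /z'; case: ifP => // _; rewrite !ltW. Qed.

Let z'_gt0 n : 0 < z' n.
Proof. by have /andP[h _] := z'_bounds n; exact: lt_le_trans h. Qed.

Let z'_near : \forall n \near \oo, [/\ z' n = z n, 0 < nustar n &
  scaled_risk n (z' n) <= scaled_risk n opt].
Proof.
have ho := scaled_risk_outside; have hm := nustar_min; near=> n.
have out : forall z, 0 < z -> scaled_risk n z <= scaled_risk n 1 -> k <= z <= K by near: n.
have [n0 nmin] : 0 < nustar n /\ forall y, 0 < y -> risk n (nustar n) <= risk n y by near: n.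
have r0 := rate_gt0 n.
have zmin y : 0 < y -> scaled_risk n (z n) <= scaled_risk n y.
  move=> y0; rewrite scaled_risk_root// /scaled_risk ler_pM2l//; apply: nmin.
  by rewrite exprn_gt0// mulr_gt0.
have zin : k <= z n <= K.
  by apply: out; [rewrite divr_gt0// powR_gt0|exact: zmin].
by rewrite /z' zin; split => //; apply: zmin; exact: opt_gt0.
Unshelve. all: by end_near.
Qed.

(** The scaled risk at [z'] is eventually at most that at [opt], so the nonnegative excess of the
    limit risk is bounded by a difference of two approximation errors. *)
Let limit_risk_z'_cvg : (fun n => limit_risk (z' n)) @ \oo --> limit_risk opt.
Proof.
have h1 := scaled_risk_cvg k0 z'_bounds.
have h2 := @scaled_risk_cvg (fun=> opt) opt opt opt_gt0 (fun=> ltac:(by rewrite lexx)).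
apply: (@cvg_sub0 _ _ _ _ _ _ (fun=> limit_risk opt)); last exact: cvg_cst.
apply: (squeeze_cvgr _ (cvg_cst (0:R)) (_ : (fun n =>
  (scaled_risk n opt - limit_risk opt) - (scaled_risk n (z' n) - limit_risk (z' n))) @ \oo --> (0:R))); last first.
  by rewrite -[X in _ --> X](subr0 (0:R)); apply: cvgB.
have hn := z'_near; near=> n.
rewrite -[X in _ <= X <= _]/(limit_risk (z' n) - limit_risk opt).
have [_ _ l] : [/\ z' n = z n, 0 < nustar n & scaled_risk n (z' n) <= scaled_risk n opt] by near: n.
apply/andP; split; last by lra.
have t0 : 0 < m%:R * (z' n / opt) by rewrite mulr_gt0// divr_gt0// opt_gt0.
rewrite -(pmulr_rge0 _ t0); apply: le_trans (limit_risk_gap (z'_gt0 n)).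
by rewrite mulr_ge0 ?sqr_ge0// ltW// limit_risk_opt_gt0.
Unshelve. all: by end_near.
Qed.

Let z'_cvg : (fun n => z' n / opt) @ \oo --> (1:R).
Proof.
apply: (@cvg_sub0 _ _ _ _ _ _ (fun=> (1:R))); last exact: cvg_cst.
apply/norm_cvg0P; apply: (@cvg0_of_expr _ _ 2) => //.
have o0 := opt_gt0; have F0 := limit_risk_opt_gt0.
apply: (squeeze_cvgr _ (cvg_cst (0:R)) (_ : (fun n => (limit_risk opt)^-1 * (m%:R * (K / opt)) *
  (limit_risk (z' n) - limit_risk opt)) @ \oo --> (0:R))); last first.
  rewrite -[X in _ --> X](mulr0 ((limit_risk opt)^-1 * (m%:R * (K / opt)))); apply: cvgMr.
  rewrite -[X in _ --> X](subrr (limit_risk opt)); apply: cvgB => //; exact: cvg_cst.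
apply: nearW => n; rewrite exprn_ge0//= real_normK ?num_real//.
rewrite -[X in X ^+ 2]/(z' n / opt - 1).
have g := limit_risk_gap (z'_gt0 n).
rewrite -[leRHS]mulrA ler_pdivlMl// [leLHS]mulrC; apply: le_trans g _.
have t0 : 0 < m%:R * (z' n / opt) by rewrite mulr_gt0// divr_gt0.
have ge0 : 0 <= limit_risk (z' n) - limit_risk opt.
  rewrite -(pmulr_rge0 _ t0); apply: le_trans (limit_risk_gap (z'_gt0 n)).
  by rewrite mulr_ge0 ?sqr_ge0// ltW.
apply: ler_wpM2r => //; apply: ler_wpM2l; first exact: ltW.
apply: ler_wpM2r; first by rewrite invr_ge0 ltW.
by have /andP[] := z'_bounds n.
Qed.

(** By rescaling, nu* = (z rate)^m = n^(m-1) opt^m (z / opt)^m with sample size n, and the last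
    factor tends to 1. *)
Lemma minimizer_cvg :
  (fun n => nustar n / (n.+1%:R ^+ m.-1 * (C1 / (C2 * (m%:R - 1))))) @ \oo --> (1:R).
Proof.
have h : (fun n => (z' n / opt) ^+ m) @ \oo --> (1:R).
  rewrite -(expr1n R m).
  exact: (cvg_comp _ (fun x : R => x ^+ m) z'_cvg (@exprn_continuous _ m 1)).
apply: cvg_trans h; apply: near_eq_cvg; apply: filterS z'_near => n [-> n0 _].
rewrite /z expr_div_n expr_div_n opt_exprn powR_root_exprn ?(ltW n0)// rate_exprn.
by rewrite [in RHS](invfM (n.+1%:R ^+ m.-1)) mulrA.
Qed.

Lemma minimum_cvg : (fun n => risk n (nustar n) / ((rate n)^-1 * limit_risk opt)) @ \oo --> (1:R).
Proof.
have F0 := limit_risk_opt_gt0.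
have h : (fun n => scaled_risk n (z' n)) @ \oo --> limit_risk opt.
  by apply: (cvg_sub0 (scaled_risk_cvg k0 z'_bounds)).
have {}h : (fun n => scaled_risk n (z' n) / limit_risk opt) @ \oo --> (1:R).
  by rewrite -(mulfV (lt0r_neq0 F0)); apply: cvgMl.
apply: cvg_trans h; apply: near_eq_cvg; apply: filterS z'_near => n [-> n0 _].
rewrite scaled_risk_root//; have := rate_gt0 n.
move: (rate n) (risk n _) (limit_risk opt) F0 => r x F F0 r0.
by field; rewrite !gt_eqF.
Qed.

End Minimizers.

End BiasVarianceTradeoff.

(** * Assembly of the three asymptotic statements *)

Lemma eq_1o1_near (R : realType) (u u' : nat -> \bar R) (v : nat -> R) :
  (\forall n \near \oo, u n = u' n) -> eq_1o1 u' v -> eq_1o1 u v.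
Proof.
move=> h [r [r0 hr]]; exists r; split => //.
by near=> n; rewrite (near h n)//; near: n.
Unshelve. all: by end_near.
Qed.

(** The minimum is (C1 / opt) m / (m - 1) with 1 / opt = (C2 (m-1) / C1)^(1/m); collecting the
    powers of m - 1 gives [c3]. *)
Lemma limit_risk_optE (R : realType) (d : nat) (g0 tau : R) : (0 < d)%N ->
  0 < c1 d g0 -> 0 < c2 d tau ->
  limit_risk (2 * d) (c1 d g0) (c2 d tau) (opt (2 * d) (c1 d g0) (c2 d tau)) = c3 d g0 tau.
Proof.
move=> d0 p1 p2; rewrite /c3; move: (c1 d g0) (c2 d tau) p1 p2 => C1 C2 p1 p2.
have m2 : (2 <= 2 * d)%N by rewrite leq_pmulr.
rewrite limit_risk_opt//.
have m1 : 0 < (2 * d)%:R - 1 :> R by rewrite subr_gt0 ltr1n.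
rewrite /opt; set a := (2 * d)%:R^-1; set M := (2 * d)%:R - 1 in m1 *.
have -> : C1 / (C2 * M) = (C2 / C1 * M)^-1 by rewrite !invfM invrK mulrA [C1 / C2]mulrC.
have q0 : 0 < C2 / C1 by rewrite divr_gt0.
have b0 : 0 < C2 / C1 * M by rewrite mulr_gt0.
rewrite -(powR_inv1 (ltW b0)) -powRrM mulN1r powRN invrK (powRM _ (ltW q0) (ltW m1)).
rewrite powRD; last by rewrite (gt_eqF m1) implybT.
by rewrite (powR_inv1 (ltW m1)) -/a; ring.
Qed.

Theorem mainTheorem3 (R : realType) (d : nat) (hd : (1 <= d)%N)
  (disp : nat -> measure_display)
  (T : forall n, measurableType (disp n))
  (P : forall n, probability (T n) R)
  (eps mu gamma : forall n, nat -> {RV (P n) >-> R})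
  (rho : int -> R) (tau : R) (htau : 0 < tau)
  (heps : forall n, mean_zero_stationary (eps n) rho)
  (heps_law : forall n m, same_law (eps n) (eps m))
  (hmu : forall n t w, (d.+1 <= t <= n)%N ->
     iter d nabla (fun s => mu n s w) t = gamma n t w)
  (hgamma_iid : forall n, iid (fun t => (d.+1 <= t <= n)%N) (gamma n))
  (hgamma_var : forall n,
     mean_zero_variance (fun t => (d.+1 <= t <= n)%N) (gamma n)
       (tau ^+ 2 / n%:R ^+ (2 * d - 1)))
  (hind_gamma : forall n, independent_processes
     xpredT (eps n) (fun t => (d.+1 <= t <= n)%N) (gamma n))
  (hind_mu : forall n, independent_processes
     xpredT (eps n) (fun t => (1 <= t <= n)%N) (mu n))
  (hrho : (\sum_(1 <= j <oo) (j%:R * `|rho j%:Z|)%:E < +oo)%E)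
  (hg0 : 0 < spectral_function rho 0) :
  let D n nu := mean_sq_error d n (mu n) (eps n) nu in
  let C1 := c1 d (spectral_function rho 0) in
  let C2 := c2 d tau in
  let C3 := c3 d (spectral_function rho 0) tau in
  [/\ forall nu : nat -> R, (forall n, 0 < nu n) ->
        nu @ \oo --> +oo ->
        (fun n => nu n / n%:R ^+ (2 * d)) @ \oo --> (0 : R) ->
        eq_1o1 (fun n => D n (nu n))
          (fun n => C1 * nu n `^ (- (2 * d)%:R^-1) +
             C2 * nu n `^ (1 - (2 * d)%:R^-1) * n%:R `^ (- (2 * d)%:R + 1)),
      \forall n \near \oo, exists nu, minimizer_gt0 (D n) nu &
      forall nustar : nat -> R,
        (\forall n \near \oo, minimizer_gt0 (D n) (nustar n)) ->
        eq_1o1 (fun n => (nustar n)%:E)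
          (fun n => n%:R ^+ (2 * d - 1) * ((2 * d)%:R - 1)^-1 * (C1 / C2)) /\
        eq_1o1 (fun n => D n (nustar n))
          (fun n => n%:R `^ (- ((2 * d)%:R - 1) / (2 * d)%:R) * C3)].
Proof.
move=> D C1 C2 C3.
have m2 : (2 <= 2 * d)%N by rewrite leq_pmulr.
(* All [eps n] share the autocovariance [rho], so the process of index 0 yields its symmetry and,
   below, its positivity. *)
have rho_even : forall j, rho (- j) = rho j by exact: rho_symmetric (heps 0%N).
pose A := fine (\sum_(1 <= j <oo) (j%:R * `|rho j%:Z|)%:E)%E.
have rho_moment N : \sum_(1 <= j < N) j%:R * `|rho j%:Z| <= A.
  have nn j : (0 <= (j%:R * `|rho j%:Z|)%:E)%E by rewrite lee_fin mulr_ge0.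
  rewrite -lee_fin fineK; last by rewrite ge0_fin_numE// nneseries_ge0.
  rewrite -sumEFin; exact: nneseries_lim_ge.
have rho_psd := psd_covmx (heps 0%N).
have t2 : 0 < tau ^+ 2 by rewrite exprn_gt0.
pose V := variance_trace d rho; pose B := @bias_trace R d; pose VC := cyclic_variance d rho.
have DE n nu : 0 < nu -> D n.+1 nu = (risk (2 * d) V B (tau ^+ 2) n nu)%:E.
  move=> nu0; rewrite /D (mean_sq_errorE (heps n.+1) _ (hgamma_iid n.+1).1 (hgamma_var n.+1) (hind_gamma n.+1) nu0).
    by rewrite /risk -subn1.
  by move=> t w; exact: hmu.
have C1E : C1 = spectral_function rho 0 * variance_constant d by rewrite /C1 /c1 /variance_constant mulrA.
have C2E : C2 = tau ^+ 2 * bias_constant d by rewrite /C2 /c2 /bias_constant mulrA.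
have p1 : 0 < C1 by rewrite C1E mulr_gt0// variance_constant_gt0.
have p2 : 0 < C2 by rewrite C2E mulr_gt0// bias_constant_gt0.
pose s := 6 * (`|rho 0| + 2 * A) * d%:R.
have V0 n nu : 0 <= nu -> 0 <= V n nu by move=> ?; exact: variance_trace_ge0.
have B0 n nu : 0 < nu -> 0 <= B n nu by move=> ?; exact: bias_trace_ge0.
have Bnd n nu nu' : 0 < nu -> nu <= nu' -> B n nu <= B n nu'.
  by move=> ? ?; exact: bias_trace_nondecreasing.
have VCni n b b' : 0 < b -> b <= b' -> VC n b' <= VC n b.
  by move=> ? ?; exact: cyclic_variance_nonincreasing.
have VVC n b : 0 < b -> VC n b - s <= V n (b ^+ (2 * d)).
  move=> b0; have := variance_trace_close d rho_even rho_moment n b0.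
  by rewrite -/V -/VC -/s ler_norml => /andP[h _]; lra.
have Vc n (nu : R) : 0 < nu -> V n x @[x --> nu] --> V n nu.
  by move=> nu0; exact: (ridge_traces_continuous _ _ nu0).1.
have Bc n (nu : R) : 0 < nu -> B n x @[x --> nu] --> B n nu.
  by move=> nu0; exact: (ridge_traces_continuous _ 0 nu0).2.
have Vcvg b : [/\ forall n, 0 < b n, b @ \oo --> +oo & (fun n => b n / n.+1%:R) @ \oo --> (0:R)] ->
    (fun n => b n / n.+1%:R * V n (b n ^+ (2 * d))) @ \oo --> C1.
  by move=> [? ? ?]; rewrite C1E; exact: variance_trace_cvg.
have VCcvg b : [/\ forall n, 0 < b n, b @ \oo --> +oo & (fun n => b n / n.+1%:R) @ \oo --> (0:R)] ->
    (fun n => b n / n.+1%:R * VC n (b n)) @ \oo --> C1.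
  by move=> [? ? ?]; rewrite C1E; exact: cyclic_variance_cvg.
have Bcvg b : [/\ forall n, 0 < b n, b @ \oo --> +oo & (fun n => b n / n.+1%:R) @ \oo --> (0:R)] ->
    (fun n => tau ^+ 2 * (b n / n.+1%:R * (B n (b n ^+ (2 * d)) / b n ^+ (2 * d)))) @ \oo --> C2.
  by move=> [? ? ?]; rewrite C2E; apply: cvgMr; exact: bias_trace_cvg.
have C3E : limit_risk (2 * d) C1 C2 (opt (2 * d) C1 C2) = C3 by exact: limit_risk_optE.
(* From here on only the collected properties of the traces and constants matter. *)
clearbody D C1 C2 C3 V B VC s.
split.
- move=> nu nu0 nuy nuN; apply: eq_1o1_shift.
  under eq_fun do rewrite DE//.
  apply: eq_1o1_ratio.
    by move=> n; rewrite gt_eqF// addr_gt0// !mulr_gt0 ?powR_gt0.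
  apply: (risk_asymptotic m2 p1 p2 Vcvg Bcvg (fun n => nu0 n.+1)).
    by rewrite cvg_shiftS.
  by rewrite (cvg_shiftS (fun n => nu n / n%:R ^+ (2 * d))).
- apply: near_shiftS.
  have := risk_minimizer_exists m2 p1 p2 (ltW t2) V0 B0 Bnd VCni VVC Vc Bc Vcvg VCcvg Bcvg.
  apply: filterS => n [nu [nu0 hnu]]; exists nu; split => // y y0.
  by rewrite !DE// lee_fin hnu.
- move=> nustar hmin.
  have hmin' : \forall n \near \oo, 0 < nustar n.+1 /\
      forall y, 0 < y -> risk (2 * d) V B (tau ^+ 2) n (nustar n.+1) <= risk (2 * d) V B (tau ^+ 2) n y.
    apply: filterS (near_unshiftS hmin) => n [n0 h]; split => // y y0.
    by rewrite -lee_fin -!DE// h.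
  split; apply: eq_1o1_shift.
    apply: eq_1o1_ratio.
      by move=> n; rewrite gt_eqF//; apply: mulr_gt0 (divr_gt0 p1 p2); rewrite divr_gt0 ?exprn_gt0 ?subr_gt0 ?ltr1n.
    have := minimizer_cvg m2 p1 p2 (ltW t2) V0 B0 Bnd VCni VVC Vcvg VCcvg Bcvg hmin'.
    apply: cvg_trans; apply: near_eq_cvg; apply: nearW => n.
    by congr (nustar _ / _); rewrite subn1 (invfM C2); ring.
  apply: (@eq_1o1_near _ _ (fun n => (risk (2 * d) V B (tau ^+ 2) n (nustar n.+1))%:E)).
    by apply: filterS hmin' => n [n0 _]; rewrite DE.
  have F0 := limit_risk_opt_gt0 m2 p1 p2.
  have vE n : n.+1%:R `^ (- ((2 * d)%:R - 1) / (2 * d)%:R) * C3 =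
     (rate (2 * d) n)^-1 * limit_risk (2 * d) C1 C2 (opt (2 * d) C1 C2).
    by rewrite C3E /rate -powRN mulNr.
  under [X in eq_1o1 _ X]eq_fun do rewrite vE.
  apply: eq_1o1_ratio.
    by move=> n; rewrite gt_eqF// mulr_gt0 ?invr_gt0 ?rate_gt0.
  exact: (minimum_cvg m2 p1 p2 (ltW t2) V0 B0 Bnd VCni VVC Vcvg VCcvg Bcvg hmin').
Qed.
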